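(* Let $\{w_i\}_{i=1}^n$ be a basis of $\mathbb{R}^n$ and let $S\subseteq[n]$ have cardinality $|S|=d$. Let $(S_1,\dots,S_m)$ form a uniform cover of $S$ with weights $(p_1,\dots,p_m)$. Let $H=\mathrm{span}\{w_k : k\in S\}$, $H_j=\mathrm{span}\{w_k : k\in S_j\}$, $\widetilde{H}_j=\mathrm{span}\{w_k : k\in S\setminus S_j\}$, $d_j=\dim H_j=|S_j|$, $\widetilde{d}_j=d-d_j=\dim\widetilde{H}_j$ and $p=\sum_{j=1}^m p_j$. Then for every $f\in\mathcal{F}(\mathbb{R}^n)$ the following four inequalities hold: $$\Vert P_{H^\perp}f\Vert_1^{p-1}\Vert f\Vert_1\leqslant\frac{d!\prod_{j=1}^m|\wedge_{k\in S\setminus S_j}w_k|^{p_j}}{|\wedge_{i\in S}w_i|^{p-1}\prod_{j=1}^m(d_j!)^{p_j}}\prod_{j=1}^m\Vert P_{\widetilde{H}_j^\perp}f\Vert_1^{p_j},$$ $$\Vert P_{H^\perp}f\Vert_1\Vert f\Vert_1^{p-1}\leqslant\frac{(d!)^{p-1}\prod_{j=1}^m|\wedge_{k\in S_j}w_k|^{p_j}}{|\wedge_{i\in S}w_i|\prod_{j=1}^m(\widetilde{d}_j!)^{p_j}}\prod_{j=1}^m\Vert P_{H_j^\perp}f\Vert_1^{p_j},$$ $$\Vert P_{H^\perp}f\Vert_1^{p-1}\Vert f\Vert_1\leqslant\frac{d!\prod_{j=1}^m|\wedge_{k\in S_j}w_k|^{p_j}}{|\wedge_{i\in S}w_i|\prod_{j=1}^m(d_j!)^{p_j}}\prod_{j=1}^m\Vert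 P_{H_j\oplus H^\perp}f\Vert_1^{p_j},$$ $$\Vert P_{H^\perp}f\Vert_1\Vert f\Vert_1^{p-1}\leqslant\frac{(d!)^{p-1}\prod_{j=1}^m|\wedge_{k\in S\setminus S_j}w_k|^{p_j}}{|\wedge_{i\in S}w_i|^{p-1}\prod_{j=1}^m(\widetilde{d}_j!)^{p_j}}\prod_{j=1}^m\Vert P_{\widetilde{H}_j\oplus H^\perp}f\Vert_1^{p_j}.$$
   Context: $[n]=\{1,\dots,n\}$. For $m\geqslant1$, subsets $S_1,\dots,S_m\subseteq S$ (not necessarily distinct) form a uniform cover of $S\subseteq[n]$ with weights $(p_1,\dots,p_m)$, $p_j>0$ for all $j$, if $\sum_{j=1}^m p_j\chi_{S_j}(i)=1$ for every $i\in S$. For vectors $u_1,\dots,u_k$, $|\wedge_{i=1}^k u_i|$ is the $k$-dimensional volume of the parallelepiped they span (equal to $1$ for the empty family). $\mathcal{F}(\mathbb{R}^n)$ is the set of integrable log-concave functions $f:\mathbb{R}^n\to[0,\infty)$, i.e. $f=e^{-v}$ with $v:\mathbb{R}^n\to(-\infty,\infty]$ convex. For a linear subspace $F$ of $\mathbb{R}^n$ with orthogonal complement $F^\perp$ in $\mathbb{R}^n$, $P_Ff(x)=\sup_{y\in F^\perp}f(x+y)$, $x\in F$. $\Vert f\Vert_1$ is the integral of $f$ over $\mathbb{R}^n$ and $\Vert P_Ff\Vert_1$ is the integral of $P_Ff$ over $F$ with respect to Lebesgue measure on $F$ (unit point mass on $\{0\}$). *)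

(* Defs.v *)
From HB Require Import structures.
From mathcomp Require Import all_boot all_order all_algebra.
From mathcomp Require Import all_classical all_reals all_analysis.

Set Implicit Arguments.
Unset Strict Implicit.
Unset Printing Implicit Defensive.

Import Order.TTheory GRing.Theory Num.Theory.
Import numFieldNormedType.Exports.

Local Open Scope classical_set_scope.
Local Open Scope ring_scope.

(** The points of R^n are the row vectors 'rV[R]_n. The n-dimensional Lebesgue
    measure, which the library does not provide, lives on n.-tuple R: it is the
    completion of the n-fold product of the Lebesgue measure of the line.
    Functions on 'rV[R]_n are integrated through [row_of]. *)

Lemma product_sigma_finite (R : realType) (d1 d2 : measure_display)
    (T1 : measurableType d1) (T2 : measurableType d2)
    (m1 : {sigma_finite_measure set T1 -> \bar R})
    (m2 : {sigma_finite_measure set T2 -> \bar R}) :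
  sigma_finite setT (m1 \x m2)%E.
Proof.
have /sigma_finiteP[F [TF ndF Foo]] := sigma_finiteT m1.
have /sigma_finiteP[G [TG ndG Goo]] := sigma_finiteT m2.
exists (fun k => F k `*` G k).
  rewrite -setXTT TF TG predeqE => -[x y]; split.
    move=> [/= [i _ Fix] [j _ Gjy]]; exists (maxn i j) => //; split.
    - by move: x Fix; exact/subsetPset/ndF/leq_maxl.
    - by move: y Gjy; exact/subsetPset/ndG/leq_maxr.
  by move=> [k _ []/= ? ?]; split; exists k.
move=> k; have [? ?] := Foo k; have [? ?] := Goo k.
split; first exact: measurableX.
by rewrite product_measure1E// lte_mul_pinfty// ge0_fin_numE.
Qed.

Section product_lebesgue.
Context {R : realType}.
Local Notation mR := (measurableTypeR R).

Definition consp n (x : mR * n.-tuple mR) : n.+1.-tuple mR :=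
  [the n.+1.-tuple _ of x.1 :: x.2].

Lemma measurable_consp n : measurable_fun [set: _] (@consp n).
Proof. exact: measurable_cons. Qed.

Section lebesgue_cons.
Variables (n : nat) (mu : {sigma_finite_measure set (n.-tuple mR) -> \bar R}).

Definition lebesgue_cons : set (n.+1.-tuple mR) -> \bar R :=
  pushforward (@lebesgue_measure R \x mu)%E (@consp n).

Let lebesgue_cons0 : lebesgue_cons set0 = 0%E.
Proof. by rewrite /lebesgue_cons /pushforward preimage_set0 measure0. Qed.

Let lebesgue_cons_ge0 A : (0 <= lebesgue_cons A)%E.
Proof. by rewrite /lebesgue_cons /pushforward; apply: measure_ge0. Qed.

Let lebesgue_cons_sigma_additive : semi_sigma_additive lebesgue_cons.
Proof.
move=> F mF tF mUF; rewrite /lebesgue_cons /pushforward preimage_bigcup.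
apply: measure_semi_sigma_additive.
- by move=> k; rewrite -[X in measurable X]setTI; exact: measurable_consp.
- apply/trivIsetP => /= i j _ _ ij; rewrite -preimage_setI.
  by move/trivIsetP : tF => /(_ _ _ _ _ ij) ->//; rewrite preimage_set0.
- rewrite -preimage_bigcup -[X in measurable X]setTI.
  exact: measurable_consp.
Qed.

HB.instance Definition _ := isMeasure.Build _ _ _
  lebesgue_cons lebesgue_cons0 lebesgue_cons_ge0 lebesgue_cons_sigma_additive.

Let lebesgue_cons_sigma_finite : sigma_finite setT lebesgue_cons.
Proof.
have /= [F FT Fm] := product_sigma_finite (@lebesgue_measure R) mu.
pose g (t : n.+1.-tuple mR) := (thead t, [tuple of behead t] : n.-tuple mR).
have gK : cancel (@consp n) g.
  by move=> [x t]; rewrite /g /consp/=; congr pair; exact: val_inj.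
have mg : measurable_fun [set: _] g.
  apply: measurable_fun_pair; first exact: measurable_tnth.
  exact: measurable_behead.
exists (fun k => g @^-1` F k).
  by rewrite -preimage_bigcup -FT preimage_setT.
move=> k; have [mF Foo] := Fm k; split.
  by rewrite -[X in measurable X]setTI; exact: mg.
rewrite /lebesgue_cons /pushforward.
suff -> : @consp n @^-1` (g @^-1` F k) = F k by [].
by apply/seteqP; split=> x /=; rewrite gK.
Qed.

HB.instance Definition _ :=
  Measure_isSigmaFinite.Build _ _ _ lebesgue_cons lebesgue_cons_sigma_finite.

End lebesgue_cons.

Fixpoint product_lebesgue n :
    {sigma_finite_measure set (n.-tuple mR) -> \bar R} :=
  match n with
  | 0 => [the {sigma_finite_measure set _ -> \bar R} of
            @dirac _ (0.-tuple mR) [tuple] R]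
  | k.+1 => [the {sigma_finite_measure set _ -> \bar R} of
               lebesgue_cons (product_lebesgue k)]
  end.

End product_lebesgue.

Definition lebesgue {R : realType} n :
    {measure set (caratheodory_type ((@product_lebesgue R n)^*)%mu) -> \bar R} :=
  [the {measure set _ -> \bar R} of
     @completed_measure_extension _ _ _ (@product_lebesgue R n)].

Definition row_of {R : realType} n (t : n.-tuple R) : 'rV[R]_n :=
  \row_i tnth t i.

Section subspaces.
Context {R : realType} {n : nat}.
Implicit Types (F : {vspace 'rV[R]_n}) (x y : 'rV[R]_n).

Definition dotr x y : R := \sum_i x 0 i * y 0 i.

Lemma mulmx_trE k (A : 'M[R]_(k, n)) y i : (A *m y^T) i 0 = dotr (row i A) y.
Proof. by rewrite mxE; apply: eq_bigr => j _; rewrite !mxE. Qed.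

Definition orthocomp F : {vspace 'rV[R]_n} :=
  (\bigcap_(i < \dim F) lker (linfun (mulmxr ((vbasis F)`_i)^T)))%VS.

Lemma dotrE x y : x *m y^T = (dotr x y)%:M.
Proof.
apply/matrixP => i j; rewrite !ord1 mulmx_trE !mxE eqxx mulr1n.
by congr dotr; apply/rowP => k; rewrite mxE.
Qed.

Lemma dotrC x y : dotr x y = dotr y x.
Proof. by apply: eq_bigr => i _; rewrite mulrC. Qed.

Lemma dotrD x y z : dotr x (y + z) = dotr x y + dotr x z.
Proof. by rewrite -big_split; apply: eq_bigr => i _; rewrite mxE mulrDr. Qed.

Lemma dotrZ a x y : dotr x (a *: y) = a * dotr x y.
Proof. by rewrite mulr_sumr; apply: eq_bigr => i _; rewrite mxE mulrCA. Qed.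

Lemma dotr_gt0 x : x != 0 -> 0 < dotr x x.
Proof.
move=> x0; have sq i : i \in index_enum 'I_n -> 0 <= x 0 i * x 0 i.
  by rewrite -expr2 sqr_ge0.
rewrite lt_def sumr_ge0 ?andbT; last by move=> i _; rewrite -expr2 sqr_ge0.
apply: contraNneq x0 => /psumr_eq0P xx0; apply/eqP/rowP => i; rewrite mxE.
have /eqP := xx0 (fun i _ => sq i (mem_index_enum i)) i isT.
by rewrite mulf_eq0 orbb => /eqP.
Qed.

Lemma mem_orthocomp F x :
  x \in orthocomp F <-> forall y, y \in F -> dotr x y = 0.
Proof.
have lkerE y : (x \in lker (linfun (mulmxr y^T : 'rV[R]_n -> 'rV[R]_1))) =
    (dotr x y == 0).
  by rewrite memv_ker lfunE/= dotrE -scalemx1 scaler_eq0 oner_eq0 orbF.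
split=> [xF y /coord_vbasis ->|xF].
  rewrite /dotr.
  have -> : forall z : 'rV[R]_n, \sum_i x 0 i * z 0 i = dotr x z by [].
  elim/big_rec : _ => [|i z _ IH].
    by rewrite -(scale0r (0 : 'rV[R]_n)) dotrZ mul0r.
  rewrite dotrD dotrZ IH addr0.
  move: xF => /subv_bigcapP /(_ i isT); rewrite -memvE lkerE => /eqP ->.
  by rewrite mulr0.
apply/subv_bigcapP => i _; rewrite -memvE lkerE; apply/eqP/xF.
by rewrite vbasis_mem// mem_nth// size_tuple.
Qed.

Definition is_orthonormal_basis F (E : 'M[R]_(\dim F, n)) :=
  E *m E^T = 1%:M /\ forall x, x \in F <-> exists t, x = t *m E.

Lemma orthonormal_basis_exists F : exists E, @is_orthonormal_basis F E.
Proof.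
rewrite /is_orthonormal_basis.
elim: {F}(\dim F) {-2}F (erefl (\dim F)) => [|k IH] F dF.
  rewrite dF.
  exists 0; split; first by apply/matrixP => -[].
  move: dF => /eqP; rewrite dimv_eq0 => /eqP -> x; rewrite memv0.
  split=> [/eqP ->|[t ->]]; last by rewrite mulmx0.
  by exists 0; rewrite mulmx0.
rewrite dF.
have F0 : F != 0%VS by rewrite -dimv_eq0 dF.
pose v := vpick F.
have v0 : v != 0 by rewrite vpick0.
pose u := (Num.sqrt (dotr v v))^-1 *: v.
have uF : u \in F by rewrite memvZ// memv_pick.
have uu : dotr u u = 1.
  rewrite dotrZ dotrC dotrZ mulrA -invfM -expr2 sqr_sqrtr.
    by rewrite mulVf// gt_eqF// dotr_gt0.
  by rewrite ltW// dotr_gt0.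
pose G := (F :&: orthocomp <[u]>)%VS.
have GP x : x \in G <-> x \in F /\ dotr x u = 0.
  rewrite memv_cap; split=> [/andP[-> /mem_orthocomp]|[-> xu]].
    by move=> /(_ u); rewrite memv_line => ->.
  by apply/mem_orthocomp => _ /vlineP[a ->]; rewrite dotrZ xu mulr0.
have uG : (<[u]> :&: G)%VS = 0%VS.
  apply/eqP; rewrite -subv0; apply/subvP => _ /memv_capP[/vlineP[a ->]].
  by move=> /GP[_]; rewrite dotrC dotrZ uu mulr1 => ->; rewrite scale0r mem0v.
have FE : F = (<[u]> + G)%VS.
  apply/eqP; rewrite eqEsubv subv_add capvSl -memvE uF !andbT.
  apply/subvP => x xF.
  have -> : x = dotr x u *: u + (x - dotr x u *: u) by rewrite addrC subrK.
  apply: memv_add; first by rewrite memvZ// memv_line.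
  apply/GP; split; first by rewrite memvB// memvZ.
  by rewrite dotrC -scaleNr dotrD dotrZ uu mulr1 dotrC subrr.
have u0 : u != 0.
  apply: contra_eq_neq uu => ->.
  by rewrite -(scale0r (0 : 'rV[R]_n)) dotrZ mul0r eq_sym oner_eq0.
have dG : \dim G = k.
  have := dimv_disjoint_sum uG; rewrite -FE dF dim_vline u0 add1n.
  by move=> [].
have := IH G dG; rewrite dG => -[E [EE EP]].
have Eu i : dotr (row i E) u = 0.
  have /GP[_ //] : row i E \in G.
  by apply/EP; exists (delta_mx 0 i); rewrite rowE.
have Eu0 : E *m u^T = 0.
  by apply/matrixP => i j; rewrite !ord1 mulmx_trE Eu mxE.
have CE : col_mx u E *m (col_mx u E)^T = 1%:M.
  rewrite tr_col_mx mul_col_row EE dotrE uu Eu0.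
  rewrite -[u *m E^T]trmxK trmx_mul trmxK Eu0 trmx0.
  by rewrite -scalar_mx_block.
exists (col_mx u E); split; first exact: CE.
have CM a (t : 'rV_k) : row_mx a%:M t *m col_mx u E = a *: u + t *m E.
  by rewrite mul_row_col mul_scalar_mx.
move=> x; split=> [|[t ->]].
  rewrite {1}FE => /memv_addP[_ /vlineP[a ->] [y /EP[t ->] ->]].
  by exists (row_mx a%:M t); exact/esym/CM.
rewrite -[t](hsubmxK (t : 'rV_(1 + k))) [lsubmx _]mx11_scalar.
rewrite CM.
apply: memvD; first by rewrite memvZ.
by have /GP[] : rsubmx (t : 'rV_(1 + k)) *m E \in G by apply/EP; eexists.
Qed.

Definition orthonormal_basis F : 'M[R]_(\dim F, n) :=
  projT1 (cid (orthonormal_basis_exists F)).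

Lemma orthonormal_basisP F : is_orthonormal_basis (orthonormal_basis F).
Proof. exact: (projT2 (cid (orthonormal_basis_exists F))). Qed.

(** Lebesgue measure and integral on F, transported from R^(dim F) by an
    orthonormal basis; for F = 0 they are those of the unit mass at 0. *)
Definition subspace_point F (t : (\dim F).-tuple R) : 'rV[R]_n :=
  row_of t *m orthonormal_basis F.

Definition subspace_measure F (A : set 'rV[R]_n) : \bar R :=
  lebesgue (\dim F) [set t | A (subspace_point t)].

Definition subspace_integral F (g : 'rV[R]_n -> \bar R) : \bar R :=
  (\int[lebesgue (\dim F)]_t g (subspace_point t))%E.

End subspaces.

Section statement.
Context {R : realType} {n : nat}.
Implicit Types (f : 'rV[R]_n -> R) (w : 'I_n -> 'rV[R]_n) (A : {set 'I_n}).

Definition uniform_cover (S : {set 'I_n}) m (C : 'I_m -> {set 'I_n})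
    (p : 'I_m -> R) :=
  [/\ (0 < m)%N, forall j, C j \subset S, forall j, 0 < p j &
      forall i, i \in S -> \sum_j p j * (i \in C j)%:R = 1].

Definition wspan w A : {vspace 'rV[R]_n} := <<[seq w k | k in A]>>%VS.

Definition parallelepiped w A : set 'rV[R]_n :=
  [set x | exists2 c : 'I_n -> R, (forall k, 0 <= c k <= 1) &
     x = \sum_(k in A) c k *: w k].

(** The #|A|-dimensional volume; it vanishes when the vectors are dependent. *)
Definition wedge_norm w A : R :=
  if \dim (wspan w A) == #|A|
  then fine (subspace_measure (wspan w A) (parallelepiped w A)) else 0.

Definition log_concave f :=
  exists v : 'rV[R]_n -> \bar R,
    [/\ forall x, (v x != -oo)%E,
        forall x y (t : R), 0 < t < 1 ->
          (v (t *: x + (1 - t) *: y)%R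
             <= t%:E * v x + (1 - t)%R%:E * v y)%E &
        forall x, ((f x)%:E = expeR (- v x))%E].

Definition integrable_log_concave f :=
  log_concave f /\ (lebesgue n).-integrable setT (fun t => (f (row_of t))%:E).

(** Extended-real valued: the supremum, or its integral over F, can be infinite
    when f vanishes almost everywhere. Only the values on F matter. *)
Definition proj_fun (F : {vspace 'rV[R]_n}) f (x : 'rV[R]_n) : \bar R :=
  ereal_sup [set (f (x + y))%:E | y in [set y | y \in orthocomp F]].

Definition norm1 f : \bar R := (\int[lebesgue n]_t (f (row_of t))%:E)%E.

Definition norm1_proj (F : {vspace 'rV[R]_n}) f : \bar R :=
  subspace_integral F (proj_fun F f).

End statement.

(* Main.v *)
Require Import Defs.
From mathcomp Require Import all_boot all_order all_algebra.
From mathcomp Require Import all_classical all_reals all_analysis.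
From mathcomp Require Import measurable_realfun ring lra.

(** Why the inequalities hold.

    Coordinates. Writing points as sums of t_k w_k turns f into a log-concave
    function of t. Projecting f along the span of the w_k with k in T becomes
    taking the supremum over the coordinates t_k with k in T, and the integral
    of the projection is the integral of this supremum over the other
    coordinates, times |det W| divided by the volume of the w_k with k in T
    ([norm1_projE]; [norm1E] when nothing is projected). In the first
    inequality the factors |det W| cancel, and what is left is a statement on
    the coordinate marginals of one function G,
      J(∅)^(p-1) J(S) <= d! / prod_j (d_j!)^(q_j) * prod_j J(C_j)^(q_j),
    where J(A) is the integral, over the coordinates in A and outside S, of
    the supremum of G over the coordinates in S but not in A ([marg_ineq]).

    Marginals. Each direction i of S is symmetrized: on a line with parameter
    t the function becomes t |-> sup_a min (G(a), G(a + t)). Its superlevel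
    sets are the difference sets of those of G, so its integral is doubled; it
    is largest at t = 0, and log-concavity is preserved. Integrating over the
    directions outside S gives, by Prekopa's theorem, a log-concave function
    whose maximum B is attained at the origin. Its integral over the
    coordinate subspace of A is 2^d J(S) for A = S and at most 2^|A| J(A) in
    general, while B is at least J(∅); the powers of 2 cancel because the
    numbers q_j d_j add up to d. It remains to treat sections through the
    maximum. Let L_A(s) be the volume of the section by the subspace of A of
    the level set at height e^-s B. Finner's inequality bounds L_S by the
    product of the L_(C_j)^(q_j) ([finner], [lvol_finner]), log-concavity
    gives th^|A| L_A(s) <= L_A(th s) ([lvol_dilate]), and then the integral of
    e^-s L_A^(d/|A|) is at most d! as soon as that of e^-s L_A is less than
    |A|! ([berwald]). The weighted inequality between arithmetic and geometric
    means, with weights q_j d_j / d, combines the three ([isect_ineq]).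

    Measurability. Projections of f need not be measurable, so that their
    integrals are lower integrals. If f is bounded below by a positive constant
    on some box, contractions toward the center of the box bring f below its
    lower semicontinuous regularization, which is a Borel function, up to
    factors tending to 1 ([lscreg_comb], [integral_lebesgue_ub]); the exact
    formulas follow, for the regularization instead of f. Otherwise f vanishes
    off a hyperplane ([box_or_hyperplane]) and its integral is 0, which leaves
    only the case p = 1, where every C_j is S.

    The other inequalities. The second one is the first for the sets S \ C_j
    with weights q_j / (p - 1), raised to the power p - 1
    ([complement_inequality]). The last two are the first two for the frame in
    which the w_k with k in S are replaced by their dual basis inside H: there
    the vectors indexed by S \ A are orthogonal to H_A, so that the complement
    of their span is H_A + H^perp, and their volume is that of the w_k with k
    in A divided by that of the w_k with k in S, by Jacobi's identity on
    complementary minors ([dual_frame]). *)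

Set Implicit Arguments.
Unset Strict Implicit.
Unset Printing Implicit Defensive.

Import Order.TTheory GRing.Theory Num.Theory.
Import numFieldNormedType.Exports.
Import HBNNSimple.

Local Open Scope classical_set_scope.
Local Open Scope ring_scope.

(** * Integrals on the line *)

Section line.
Context {R : realType}.
Local Notation mR := (measurableTypeR R).
Local Notation mu := (@lebesgue_measure R).
Local Open Scope ereal_scope.

(** Holds for arbitrary nonnegative functions, since their integral is a
    supremum over the simple functions below them. *)
Lemma le_integral_ge0 d (T : measurableType d) (m : {measure set T -> \bar R})
    (f g : T -> \bar R) :
  (forall x, 0 <= f x) -> (forall x, f x <= g x) ->
  \int[m]_x f x <= \int[m]_x g x.
Proof.
move=> f0 fg; have g0 x : 0 <= g x by exact: le_trans (fg x).
rewrite !ge0_integralTE//; apply: ereal_sup_le => _ [h /= hf <-].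
by exists h => // x; exact: le_trans (hf x) (fg x).
Qed.

Definition image_measure d1 d2 (T1 : measurableType d1) (T2 : measurableType d2)
    (m : {measure set T1 -> \bar R}) (f : T1 -> T2)
    (mf : measurable_fun setT f) : {measure set T2 -> \bar R}.
Proof. by unshelve refine (pushforward m f : {measure set T2 -> \bar R}). Defined.

Lemma measurable_affine (a b : R) :
  measurable_fun [set: mR] (fun r : mR => (a * r + b)%R : mR).
Proof.
by apply: measurable_funD => //; exact: measurable_funM.
Qed.

(** Both sides are measures in [A], and they agree on half-open intervals. *)
Lemma lebesgue_measure_affine (a b : R) (A : set R) : (a != 0)%R ->
  measurable A ->
  `|a|%:E * mu ((fun r : mR => (a * r + b)%R : mR) @^-1` A) = mu A.
Proof.
move=> a0 mA; pose phi (r : mR) : mR := (a * r + b)%R.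
have mphi : measurable_fun setT phi by exact: measurable_affine.
pose m : {measure set mR -> \bar R} :=
  mscale (NngNum (normr_ge0 a)) (image_measure mu mphi).
transitivity (m A) => //.
apply/esym/lebesgue_measure_unique => // _ [[x y] _ <-]; apply/esym.
change (`|a|%:E * mu (phi @^-1` `]x, y]) = mu `]x, y]).
have [a_gt0|a_lt0|a00] := ltgtP a 0%R; last by rewrite a00 eqxx in a0.
- have -> : phi @^-1` `]x, y] = `[((y - b) / a)%R, ((x - b) / a)%R[%classic.
    apply/seteqP; split => r /=; rewrite !in_itv/= /phi.
      by rewrite ler_ndivrMr// ltr_ndivlMr// => /andP[h1 h2]; apply/andP; split; lra.
    by rewrite ler_ndivrMr// ltr_ndivlMr// => /andP[h1 h2]; apply/andP; split; lra.
  rewrite !lebesgue_measure_itv/= !lte_fin ltr_ndivlMr// divfK ?lt_eqF// ltrD2r.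
  case: ifP => _; last by rewrite mule0.
  by rewrite -EFinB -EFinM -EFinB ltr0_norm//; congr _%:E; field; rewrite lt_eqF.
- have -> : phi @^-1` `]x, y] = `]((x - b) / a)%R, ((y - b) / a)%R]%classic.
    apply/seteqP; split => r /=; rewrite !in_itv/= /phi.
      by rewrite ler_pdivlMr// ltr_pdivrMr// => /andP[h1 h2]; apply/andP; split; lra.
    by rewrite ler_pdivlMr// ltr_pdivrMr// => /andP[h1 h2]; apply/andP; split; lra.
  rewrite !lebesgue_measure_itv/= !lte_fin ltr_pM2r ?invr_gt0// ltrD2r.
  case: ifP => _; last by rewrite mule0.
  by rewrite -EFinB -EFinM -EFinB gtr0_norm//; congr _%:E; field; rewrite gt_eqF.
Qed.

Lemma integral_affine (a b : R) (f : mR -> \bar R) : (a != 0)%R ->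
  measurable_fun setT f -> (forall r, 0 <= f r) ->
  `|a|%:E * \int[mu]_r f (a * r + b)%R = \int[mu]_r f r.
Proof.
move=> a0 mf f0; pose phi (r : mR) : mR := (a * r + b)%R.
have mphi : measurable_fun setT phi by exact: measurable_affine.
have -> : \int[mu]_r f (a * r + b)%R = \int[image_measure mu mphi]_r f r.
  by rewrite ge0_integral_pushforward// => x _; exact: f0.
rewrite -(ge0_integral_mscale _ _ (NngNum (normr_ge0 a)))//.
apply: eq_measure_integral => A mA _ /=.
by rewrite /mscale/= /pushforward lebesgue_measure_affine.
Qed.

Lemma integral_dilation (a : R) (f : mR -> \bar R) : (0 < a)%R ->
  measurable_fun setT f -> (forall r, 0 <= f r) ->
  a%:E * \int[mu]_r f (a * r)%R = \int[mu]_r f r.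
Proof.
move=> a0 mf f0; rewrite -(@integral_affine a 0 f)// ?gt_eqF// gtr0_norm//.
by congr (_ * _); apply: eq_integral => r _; rewrite addr0.
Qed.

End line.

(** * Iterated integrals over coordinates *)

Section iterated.
Context {R : realType} {n : nat}.
Local Notation mR := (measurableTypeR R).
Local Notation mu := (@lebesgue_measure R).
Local Notation T := (n.-tuple mR).
Implicit Types (x y : T) (i j : 'I_n) (F G : T -> \bar R) (l : seq 'I_n).
Local Open Scope ereal_scope.

Definition upd x i (r : R) : T :=
  [tuple (if j == i then r else tnth x j) | j < n].

Lemma tnth_upd x i r j : tnth (upd x i r) j = if j == i then r else tnth x j.
Proof. by rewrite tnth_mktuple. Qed.

Lemma upd_upd x i r s : upd (upd x i r) i s = upd x i s.
Proof. by apply: eq_from_tnth => j; rewrite !tnth_upd; case: eqP. Qed.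

Lemma updC x i j r s : i != j -> upd (upd x i r) j s = upd (upd x j s) i r.
Proof.
move=> ij; apply: eq_from_tnth => k; rewrite !tnth_upd.
by case: (eqVneq k j) => // ->; rewrite eq_sym (negbTE ij).
Qed.

Lemma measurable_upd i : measurable_fun [set: T * mR] (fun z => upd z.1 i z.2).
Proof.
apply/measurable_fun_tnthP => j.
rewrite (_ : _ \o _ = fun z => if j == i then z.2 else tnth z.1 j); last first.
  by apply/funext => z /=; rewrite tnth_upd.
case: eqP => _; first exact: measurable_snd.
apply: (@measurableT_comp _ _ _ _ _ _ (fun x : T => tnth x j)); last exact: measurable_fst.
exact: measurable_tnth.
Qed.

Lemma measurable_upd2 x i : measurable_fun [set: mR] (upd x i).
Proof.
by apply: (@measurableT_comp _ _ _ _ _ _ (fun z : T * mR => upd z.1 i z.2) _ (pair x)) => //; exact: measurable_upd.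
Qed.

Definition nnm F := measurable_fun setT F /\ forall x, 0 <= F x.

(** Integrating a coordinate out leaves a function of all [n] coordinates that
    ignores this one: with a fixed domain, the set and the order of the
    integrated coordinates can vary freely. *)
Definition int1 i F x := \int[mu]_r F (upd x i r).
Definition iint l F := foldr int1 F l.

Lemma le_int1 i F G : (forall x, 0 <= F x) -> (forall x, F x <= G x) ->
  forall x, int1 i F x <= int1 i G x.
Proof. by move=> F0 FG x; exact: le_integral_ge0. Qed.

Lemma nnm_int1 i F : nnm F -> nnm (int1 i F).
Proof.
move=> [mF F0]; split; last by move=> x; exact: integral_ge0.
apply: (measurable_fun_fubini_tonelli_F (m2 := mu) (fun z : T * mR => F (upd z.1 i z.2))) => //.
by apply: measurableT_comp => //; exact: measurable_upd.
Qed.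

Lemma nnm_iint l F : nnm F -> nnm (iint l F).
Proof. by move=> nF; elim: l => //= i l; exact: nnm_int1. Qed.

Lemma nnm_upd F x i : nnm F -> measurable_fun setT (fun r : mR => F (upd x i r)).
Proof. by move=> [mF _]; apply: measurableT_comp => //; exact: measurable_upd2. Qed.

(** Tonelli's theorem. *)
Lemma int1C i j F : nnm F -> int1 i (int1 j F) = int1 j (int1 i F).
Proof.
move=> nF; have [->//|ij] := eqVneq i j; case: nF => mF F0.
apply/funext => x; rewrite /int1.
transitivity (\int[mu]_r \int[mu]_s F (upd (upd x i r) j s)).
  by [].
transitivity (\int[mu]_s \int[mu]_r F (upd (upd x i r) j s)); last first.
  by apply: eq_integral => r _; apply: eq_integral => s _; rewrite updC.
apply: (fubini_tonelli (fun z : mR * mR => F (upd (upd x i z.1) j z.2))) => //.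
apply: measurableT_comp => //.
apply: (@measurableT_comp _ _ _ _ _ _ (fun z : T * mR => upd z.1 j z.2) _
  (fun z : mR * mR => (upd x i z.1, z.2))); first exact: measurable_upd.
apply: measurable_fun_pair => //.
by apply: (@measurableT_comp _ _ _ _ _ _ (upd x i)) => //; exact: measurable_upd2.
Qed.

Lemma int1_iint i l F : nnm F -> int1 i (iint l F) = iint l (int1 i F).
Proof.
by move=> nF; elim: l => //= j l IH; rewrite int1C ?IH//; exact: nnm_iint.
Qed.

Lemma iint_cat l l' F : iint (l ++ l') F = iint l (iint l' F).
Proof. by rewrite /iint foldr_cat. Qed.

Lemma perm_iint l l' F : nnm F -> perm_eq l l' -> iint l F = iint l' F.
Proof.
move=> nF; elim: l l' => [|i l IH] l'; first by rewrite perm_sym => /perm_nilP ->.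
move=> ll'; have il' : i \in l' by rewrite -(perm_mem ll') mem_head.
case/splitPr: il' ll' => a b; rewrite perm_sym -cat1s perm_catCA/= perm_cons perm_sym => ll'.
rewrite /= (IH _ ll') !iint_cat /= int1_iint//; exact: nnm_iint.
Qed.

Lemma le_iint l F G : (forall x, 0 <= F x) -> (forall x, F x <= G x) ->
  forall x, iint l F x <= iint l G x.
Proof.
move=> F0 FG; elim: l => //= i l IH x; apply: le_int1 => // {}x.
by elim: l {IH} x => //= j l IH x; exact: integral_ge0.
Qed.

Lemma iint_agree l F x y : (forall j, j \notin l -> tnth x j = tnth y j) ->
  iint l F x = iint l F y.
Proof.
elim: l x y => [|i l IH] x y xy.
  by congr F; apply: eq_from_tnth => j; exact: xy.
apply: eq_integral => r _; apply: IH => j jl; rewrite !tnth_upd.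
by case: eqP => // /eqP ji; apply: xy; rewrite inE negb_or ji.
Qed.

Definition indep i F := forall x r, F (upd x i r) = F x.

Lemma indep_iint i l F : indep i F -> indep i (iint l F).
Proof.
move=> iF; elim: l => //= j l IH x r; rewrite /int1.
have [->|ij] := eqVneq i j; first by under eq_integral do rewrite upd_upd.
by apply: eq_integral => s _; rewrite updC// IH.
Qed.

Lemma int1Zl i F G : nnm F -> (forall x, 0 <= G x) -> indep i G ->
  int1 i (fun x => G x * F x) = fun x => G x * int1 i F x.
Proof.
move=> nF G0 iG; apply/funext => x; rewrite /int1.
under eq_integral do rewrite iG.
by rewrite ge0_integralZl//; [exact: nnm_upd|move=> ? _; apply: nF.2].
Qed.

Lemma iintZl l (c : \bar R) F : nnm F -> 0 <= c ->
  iint l (fun x => c * F x) = fun x => c * iint l F x.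
Proof.
move=> nF c0; elim: l => //= i l ->; rewrite int1Zl//; exact: nnm_iint.
Qed.

Definition dilate (a : R) x : T := [tuple (a * tnth x j)%R | j < n].

Lemma dilate_upd a x i r : dilate a (upd x i r) = upd (dilate a x) i (a * r)%R.
Proof.
apply: eq_from_tnth => j; rewrite !(tnth_mktuple, tnth_upd).
by case: eqP.
Qed.

Lemma iint_dilate (a : R) l F : (0 < a)%R -> nnm F -> forall x,
  (a ^+ size l)%:E * iint l (F \o dilate a) x = iint l F (dilate a x).
Proof.
move=> a0 nF; elim: l => [|i l IH] x; first by rewrite expr0 mul1e.
have nl : nnm (iint l F) by exact: nnm_iint.
rewrite /= /int1.
rewrite -[RHS](@integral_affine _ a 0) ?gt_eqF//; last 2 first.
- exact: nnm_upd.
- by move=> r; exact: nl.2.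
under [in RHS]eq_integral do rewrite addr0 -dilate_upd -IH.
have nFs : nnm (F \o dilate a).
  split; last by move=> y; exact: nF.2.
  apply: measurableT_comp; first exact: nF.1.
  apply/measurable_fun_tnthP => j.
  rewrite (_ : _ \o _ = fun z => (a * tnth z j)%R); last first.
    by apply/funext => z /=; rewrite tnth_mktuple.
  by apply: measurable_funM => //; exact: measurable_tnth.
rewrite ge0_integralZl//; last 3 first.
- by apply: nnm_upd; exact: nnm_iint.
- by move=> r _; apply: (nnm_iint l nFs).2.
- by rewrite lee_fin exprn_ge0// ltW.
by rewrite gtr0_norm// muleA -EFinM exprS.
Qed.

End iterated.

(** * Means and lengths of intervals *)

Section amgm.
Context {R : realType}.

Lemma powR_sumr (I : Type) (r : seq I) (P : pred I) (b : R) (a : I -> R) :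
  0 < b -> b `^ (\sum_(i <- r | P i) a i) = \prod_(i <- r | P i) b `^ a i.
Proof.
move=> b0; elim/big_rec2: _ => [|i y x _ <-]; first by rewrite powRr0.
by rewrite powRD// (gt_eqF b0) implybT.
Qed.

(** The inequality ln y <= y - 1 at y = x_i / A, where A is the arithmetic
    mean, weighted and summed. *)
Lemma amgm (I : finType) (P : pred I) (al x : I -> R) :
  (forall i, P i -> 0 <= al i) -> \sum_(i | P i) al i = 1 ->
  (forall i, P i -> 0 <= x i) ->
  \prod_(i | P i) x i `^ al i <= \sum_(i | P i) al i * x i.
Proof.
move=> al0 al1 x0.
have S0 : 0 <= \sum_(i | P i) al i * x i.
  by apply: sumr_ge0 => i Pi; rewrite mulr_ge0 ?al0 ?x0.
have [/existsP[i /andP[/andP[Pi xi] ali]]|] :=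
    boolP [exists i, (P i && (x i == 0)) && (al i != 0)].
  by rewrite (bigD1 i)//= (eqP xi) powR0// mul0r.
rewrite negb_exists => /forallP nz.
pose A := \sum_(i | P i) al i * x i.
have A0 : 0 < A.
  rewrite lt_neqAle S0 andbT eq_sym psumr_eq0; last first.
    by move=> i Pi; rewrite mulr_ge0 ?al0 ?x0.
  apply/negP => /allP h.
  have : \sum_(i | P i) al i = 0.
    apply: big1 => i Pi; have := h i (mem_index_enum _); rewrite Pi/= mulf_eq0.
    move=> /orP[/eqP//|xi]; have := nz i; rewrite Pi xi/= negbK => /eqP //.
  by rewrite al1 => /eqP; rewrite oner_eq0.
have key i : P i -> x i `^ al i <= expR (al i * (x i / A - 1)) * A `^ al i.
  move=> Pi; have := nz i; rewrite Pi/=.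
  have [xi0|xi0 _] := eqVneq (x i) 0.
    by rewrite /= negbK => /eqP ->; rewrite !powRr0 mul0r expR0 mul1r.
  have xp : 0 < x i by rewrite lt_neqAle eq_sym xi0 x0.
  have -> : x i `^ al i = expR (al i * ln (x i)) by rewrite /powR (negbTE xi0).
  have -> : A `^ al i = expR (al i * ln A) by rewrite /powR gt_eqF.
  rewrite -expRD ler_expR -mulrDr ler_wpM2l ?al0//.
  have := @le_ln1Dx R (x i / A - 1).
  rewrite [X in ln X]addrC subrK ln_div ?posrE// => h.
  have /h : -1 < x i / A - 1 by rewrite ltrBrDl subrr divr_gt0.
  lra.
apply: (@le_trans _ _ (\prod_(i | P i) (expR (al i * (x i / A - 1)) * A `^ al i))).
  by apply: ler_prod => i Pi; rewrite powR_ge0 key.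
rewrite big_split/= -expR_sum.
have -> : \sum_(i | P i) al i * (x i / A - 1) = 0.
  under eq_bigr do rewrite mulrBr mulr1 mulrA.
  by rewrite sumrB -mulr_suml al1 -/A divff ?gt_eqF// subrr.
rewrite expR0 mul1r.
by rewrite -powR_sumr// al1 powRr1// ltW.
Qed.

Lemma amgm2 (t a b : R) : 0 <= t <= 1 -> 0 <= a -> 0 <= b ->
  a `^ t * b `^ (1 - t) <= t * a + (1 - t) * b.
Proof.
move=> /andP[t0 t1] a0 b0.
have := @amgm bool predT (fun i => if i then t else 1 - t)
  (fun i => if i then a else b).
rewrite !big_bool/=; apply.
- by case; rewrite ?subr_ge0.
- by rewrite addrC subrK.
- by case.
Qed.

Lemma ltr_geom (t a b c d : R) : 0 < t < 1 -> 0 <= a -> 0 <= b ->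
  a < c -> b < d -> a `^ t * b `^ (1 - t) < c `^ t * d `^ (1 - t).
Proof.
move=> /andP[t0 t1] a0 b0 ac bd.
apply: ltr_pM; rewrite ?powR_ge0//.
- by apply: gt0_ltr_powR; rewrite ?nnegrE// ltW// (le_lt_trans a0).
- by apply: gt0_ltr_powR; rewrite ?nnegrE ?subr_gt0// ltW// (le_lt_trans b0).
Qed.

End amgm.

Section ereal_aux.
Context {R : realType}.
Local Open Scope ereal_scope.

(** Infinite or unattained values are compared through the reals strictly
    below them; log-concavity and the Prekopa-Leindler inequality are stated
    in the same way. *)
Lemma lee_approx (X Z : \bar R) : (forall a : R, a%:E < X -> a%:E <= Z) -> X <= Z.
Proof.
move=> h; rewrite leNgt; apply/negP => ZX.
case: X h ZX => [x| |] h ZX.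
- move: Z h ZX => [z| |] h; rewrite ?lte_fin// => zx.
    have := h ((z + x) / 2)%R; rewrite lte_fin lee_fin; lra.
  by have := h (x - 1)%R; rewrite lte_fin ltrBlDr ltrDl ltr01 => /(_ isT).
- case: Z h ZX => [z| |] h // _.
    have := h (z + 1)%R; rewrite ltry => /(_ isT); rewrite lee_fin; lra.
  by have := h 0%R; rewrite ltry => /(_ isT).
- by rewrite ltNge leNye in ZX.
Qed.

Lemma exists_between (a : R) (X : \bar R) : a%:E < X ->
  exists2 b : R, (a < b)%R & b%:E < X.
Proof.
case: X => [x| |]//; rewrite ?lte_fin.
  by move=> ax; exists ((a + x) / 2)%R; rewrite ?lte_fin; lra.
by move=> _; exists (a + 1)%R; rewrite ?ltry// ltrDl.
Qed.

Lemma lee_conv (t : R) (X Y Z : \bar R) : (0 < t < 1)%R -> 0 <= X -> 0 <= Y ->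
  (forall a b : R, a%:E < X -> b%:E < Y -> (t * a + (1 - t) * b)%:E <= Z) ->
  t%:E * X + (1 - t)%:E * Y <= Z.
Proof.
move=> /andP[t0 t1] X0 Y0 h.
have t1' : (0 < 1 - t)%R by rewrite subr_gt0.
apply: lee_approx => c.
case: X X0 h => [x||]// X0 h; case: Y Y0 h => [y||]// Y0 h.
- rewrite -!EFinM -EFinD lte_fin => cxy.
  pose e := (t * x + (1 - t) * y - c)%R.
  have e0 : (0 < e)%R by rewrite subr_gt0.
  apply: le_trans (h (x - e)%R (y - e)%R _ _); rewrite ?lte_fin ?gtrBl//.
  by rewrite lee_fin /e; lra.
- move=> _; apply: le_trans (h (x - 1)%R ((c - t * (x - 1)) / (1 - t))%R _ _).
  + by rewrite lee_fin [X in (_ + X)%R]mulrC divfK ?gt_eqF// addrC subrK.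
  + by rewrite lte_fin; lra.
  + by rewrite ltry.
- move=> _; apply: le_trans (h ((c - (1 - t) * (y - 1)) / t)%R (y - 1)%R _ _).
  + by rewrite lee_fin [(t * _)%R]mulrC divfK ?gt_eqF// subrK.
  + by rewrite ltry.
  + by rewrite lte_fin; lra.
- move=> _; apply: le_trans (h c c _ _); rewrite ?ltry// lee_fin; lra.
Qed.

End ereal_aux.

Section length.
Context {R : realType}.
Local Notation mR := (measurableTypeR R).
Local Notation mu := (@lebesgue_measure R).
Local Open Scope ereal_scope.
Implicit Types A B C : set R.

Lemma length_ge A (a1 a2 : R) : is_interval A -> A a1 -> A a2 ->
  (a2 - a1)%:E <= mu A.
Proof.
move=> iA A1 A2; have [a21|a12] := ltP a2 a1.
  by apply: (@le_trans _ _ 0) => //; rewrite lee_fin subr_le0 ltW.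
have <- : mu `[a1, a2] = (a2 - a1)%:E.
  rewrite lebesgue_measure_itv/= lte_fin EFinB.
  by case: ltP => // a21; rewrite -EFinB; congr _%:E; lra.
apply: le_measure; rewrite ?inE//; first exact: is_interval_measurable.
by move=> x /=; rewrite in_itv/= => x12; exact: iA x12.
Qed.

Lemma length_lt A (c : R) : is_interval A -> A !=set0 -> c%:E < mu A ->
  exists a1 a2, [/\ A a1, A a2, (a1 <= a2)%R & (c < a2 - a1)%R].
Proof.
move=> iA [a0 Aa0] cA.
have [c0|c0] := ltP c 0%R.
  by exists a0, a0; split => //; rewrite subrr.
apply: contrapT => h.
have k a1 a2 : A a1 -> A a2 -> (a2 - a1 <= c)%R.
  move=> A1 A2; have [a12|a21] := leP a1 a2; last by lra.
  by rewrite leNgt; apply/negP => ca; apply: h; exists a1, a2.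
have sA : has_sup A.
  by split; [exists a0|exists (a0 + c)%R => x Ax; have := k _ _ Aa0 Ax; lra].
have : mu A <= mu `[(sup A - c)%R, sup A].
  apply: le_measure; rewrite ?inE//; first exact: is_interval_measurable.
  move=> x Ax /=; rewrite in_itv/=; apply/andP; split; last first.
    by apply: sup_upper_bound.
  rewrite lerBlDr; apply: sup_le_ub; first by exists a0.
  by move=> y Ay; have := k _ _ Ax Ay; lra.
rewrite lebesgue_measure_itv/= lte_fin; case: ifP => _.
  by rewrite -EFinB => /(lt_le_trans cA); rewrite lte_fin; lra.
by move=> /(lt_le_trans cA); rewrite lte_fin ltNge c0.
Qed.

Lemma interval_conv A (t x y : R) : is_interval A -> (0 < t < 1)%R -> A x ->
  A y -> A (t * x + (1 - t) * y)%R.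
Proof.
move=> iA t01 Ax Ay; have [xy|yx] := leP x y.
  by apply: (iA x y) => //; nra.
by apply: (iA y x) => //; nra.
Qed.

(** The Brunn-Minkowski inequality on the line: endpoints that almost realize
    the lengths of [A] and [B] are combined into two points of [C]. *)
Lemma length_conv A B C (t : R) : (0 < t < 1)%R ->
  is_interval A -> is_interval B -> is_interval C -> A !=set0 -> B !=set0 ->
  (forall x y, A x -> B y -> C (t * x + (1 - t) * y)%R) ->
  t%:E * mu A + (1 - t)%:E * mu B <= mu C.
Proof.
move=> t01 iA iB iC A0 B0 ABC; apply: lee_conv => // a b aA bB.
have [a1 [a2 [A1 A2 a12 aa]]] := length_lt iA A0 aA.
have [b1 [b2 [B1 B2 b12 bb]]] := length_lt iB B0 bB.
apply: le_trans (length_ge iC (ABC _ _ A1 B1) (ABC _ _ A2 B2)).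
rewrite lee_fin; nra.
Qed.

Definition difference_set A : set R := [set r | exists2 a, A a & A (a + r)%R].

Lemma is_interval_difference A : is_interval A -> is_interval (difference_set A).
Proof.
move=> iA r s [a Aa Aar] [b Ab Abs] u /andP[ru us].
have [rs|sr] := ltP r s; last first.
  by exists a => //; have -> : u = r by lra.
pose k := ((s - u) / (s - r))%R.
have k01 : (0 <= k <= 1)%R.
  by rewrite divr_ge0 ?ler_pdivrMr/= ?mul1r ?subr_gt0//; lra.
have uE : u = (k * r + (1 - k) * s)%R.
  by rewrite /k; field; lra.
have cv x y : A x -> A y -> A (k * x + (1 - k) * y)%R.
  move=> Ax Ay; have [k1|k1] := eqVneq k 1%R.
    by rewrite k1 subrr mul0r addr0 mul1r.
  have [k0|k0] := eqVneq k 0%R.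
    by rewrite k0 subr0 mul0r add0r mul1r.
  by apply: interval_conv => //; lra.
exists (k * a + (1 - k) * b)%R; first exact: cv.
have -> : (k * a + (1 - k) * b + u = k * (a + r) + (1 - k) * (b + s))%R.
  by rewrite uE; ring.
exact: cv.
Qed.

(** Up to its endpoints, the difference set of an interval of length c is the
    interval from -c to c. *)
Lemma length_difference A : is_interval A ->
  mu (difference_set A) = 2%:E * mu A.
Proof.
move=> iA; have iD := is_interval_difference iA.
have [->|/set0P A0] := eqVneq A set0.
  rewrite measure0 mule0 (_ : difference_set _ = set0) ?measure0//.
  by apply/seteqP; split => // r [].
have D0 : difference_set A !=set0.
  by case: A0 => a Aa; exists 0%R; exists a => //; rewrite addr0.
apply/eqP; rewrite eq_le; apply/andP; split.
  apply: lee_approx => c /(length_lt iD D0)[u1 [u2 [[p1 A1 A1'] [p2 A2 A2'] _ cu]]].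
  apply: (@le_trans _ _ ((p2 + u2) - (p1 + u1) + (p1 - p2))%:E).
    by rewrite lee_fin; lra.
  rewrite EFinD mule_natl mule2n; apply: leeD; exact: length_ge.
rewrite mule_natl mule2n.
have h01 : (0 < (2^-1 : R) < 1)%R by rewrite invr_gt0 ltr0n invf_lt1 ?ltr0n// ltr1n.
have := @lee_conv _ (2^-1)%R (2%:E * mu A) (2%:E * mu A) (mu (difference_set A)) h01.
have hh : (1 - 2^-1 = 2^-1 :> R)%R by field.
rewrite hh !muleA -EFinM mulVf ?mul1e//; apply; rewrite ?mule_ge0//.
move=> a b.
have P (c : R) : c%:E < 2%:E * mu A -> exists2 u, (c < 2 * u)%R & difference_set A u /\ difference_set A (- u)%R.
  move=> cA; have : (c / 2)%:E < mu A.
    by rewrite -(@lte_pmul2l _ 2%:E)// -EFinM [(2 * _)%R]mulrC divfK.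
  move=> /(length_lt iA A0)[a1 [a2 [A1 A2 a12 ca]]].
  exists (a2 - a1)%R; first lra.
  by split; [exists a1|exists a2] => //; rewrite ?opprB addrC subrK.
move=> /P[u au [Du Du']] /P[v bv [Dv Dv']].
apply: (@le_trans _ _ (Num.max u v - - Num.max u v)%:E).
  by rewrite lee_fin maxEle; case: ifP; lra.
by apply: length_ge => //; rewrite maxEle; case: ifP.
Qed.

End length.

(** * The Prékopa-Leindler inequality on the line *)

Section layercake.
Context {R : realType}.
Local Notation mR := (measurableTypeR R).
Local Notation mu := (@lebesgue_measure R).
Local Open Scope ereal_scope.

(** The indicator of the interval from 0 to [u], whose integral is [u]: with
    it the layer-cake formula is an exchange of integrals. *)
Definition lev (u : \bar R) (r : R) : \bar R :=
  ((0 <= r)%R && (r%:E < u)%E)%:R%:E.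

Lemma lev_ge0 u r : 0 <= lev u r.
Proof. by rewrite lee_fin ler0n. Qed.

Lemma integral_lev u : 0 <= u -> \int[mu]_r lev u r = u.
Proof.
move=> u0.
pose A : set mR := [set r | (0 <= r)%R /\ r%:E < u].
have AE : (fun r => lev u r) = EFin \o \1_A.
  apply/funext => r; rewrite /lev /= indicE; congr (_%:R%:E); congr nat_of_bool.
  by apply/idP/idP => [/andP h|]; [rewrite mem_set|rewrite inE => -[-> ->]].
case: u u0 @A AE => [x||]// x0 A ->.
- have AE : A = `[0%R, x[%classic.
    by apply/seteqP; split => r; rewrite /A /= in_itv/= lte_fin; [move=> [-> ->]|move=> /andP].
  rewrite AE integral_indic// setIT /= lebesgue_measure_itv/= lte_fin.
  rewrite oppr0 adde0; case: ltP => // ?; congr _%:E.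
  by apply/eqP; rewrite eq_le -lee_fin x0; apply/andP.
- have AE : A = `[0%R, +oo[%classic.
    by apply/seteqP; split => r; rewrite /A /= in_itv/= andbT ?ltry; [move=> [->]|].
  by rewrite AE integral_indic// setIT /= lebesgue_measure_itv/= ltry.
Qed.

Lemma measurable_lev d (T : measurableType d) (f : T -> \bar R) :
  measurable_fun setT f ->
  measurable_fun [set: T * mR] (fun z => lev (f z.1) z.2).
Proof.
move=> mf; apply/measurable_EFinP.
rewrite (_ : (fun _ => _) =
   \1_([set z : T * mR | (0 <= z.2)%R] `&` [set z : T * mR | (z.2)%:E < f z.1])); last first.
  apply/funext => z; rewrite /= indicE; congr (_%:R); congr nat_of_bool.
  by apply/idP/idP => [/andP h|]; [rewrite mem_set|rewrite inE => -[-> ->]].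
apply: measurable_indic; apply: measurableI.
  rewrite (_ : mkset _ = setT `&` snd @^-1` `[0%R, +oo[%classic).
    by apply: measurable_snd => //; exact: measurable_itv.
  by rewrite setTI; apply/seteqP; split => z; rewrite /= in_itv/= andbT.
rewrite -[X in measurable X]setTI; apply: measurable_lte => //.
  by apply/measurable_EFinP; exact: measurable_snd.
by apply: measurableT_comp => //; exact: measurable_fst.
Qed.

Definition height (f : mR -> \bar R) (r : R) : \bar R := \int[mu]_x lev (f x) r.

Lemma height_ge0 f r : 0 <= height f r.
Proof. by apply: integral_ge0 => x _; exact: lev_ge0. Qed.

Lemma heightE f r : measurable_fun setT f -> (0 <= r)%R ->
  height f r = mu [set x | r%:E < f x].
Proof.
move=> mf r0; rewrite /height.
have -> : (fun x => lev (f x) r) = EFin \o \1_[set x : mR | r%:E < f x].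
  apply/funext => x; rewrite /lev /= indicE; congr (_%:R%:E); congr nat_of_bool.
  by rewrite r0/=; apply/idP/idP => [h|]; [rewrite mem_set|rewrite inE].
rewrite integral_indic// ?setIT//.
by rewrite -[X in measurable X]setTI; apply: measurable_lte => //; exact: measurable_cst.
Qed.

Lemma height_lt0 f r : (r < 0)%R -> height f r = 0.
Proof.
move=> r0; apply: integral0_eq => x _.
by rewrite /lev leNgt r0.
Qed.

Lemma measurable_height f : measurable_fun setT f -> measurable_fun setT (height f : mR -> _).
Proof.
move=> mf.
apply: (measurable_fun_fubini_tonelli_G (m1 := mu) (fun z : mR * mR => lev (f z.1) z.2)).
  exact: measurable_lev.
by move=> z; exact: lev_ge0.
Qed.

(** Tonelli's theorem for [lev]. *)
Lemma layer_cake f : measurable_fun setT f -> (forall x, 0 <= f x) ->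
  \int[mu]_x f x = \int[mu]_r height f r.
Proof.
move=> mf f0.
transitivity (\int[mu]_x \int[mu]_r lev (f x) r).
  by apply: eq_integral => x _; rewrite integral_lev.
apply: (fubini_tonelli (m1 := mu) (m2 := mu) (fun z : mR * mR => lev (f z.1) z.2)).
  exact: measurable_lev.
by move=> z; exact: lev_ge0.
Qed.

Definition qconcave (f : mR -> \bar R) :=
  forall r : R, (0 <= r)%R -> is_interval [set x | r%:E < f x].

(** The superlevel sets of [g] are the difference sets of those of [f], which
    are intervals; the layer-cake formula does the rest. *)
Lemma integral_sup_min (f g : mR -> \bar R) :
  measurable_fun setT f -> measurable_fun setT g -> (forall x, 0 <= f x) ->
  qconcave f ->
  (forall r, g r = ereal_sup [set mine (f a) (f (a + r)%R) | a in setT]) ->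
  \int[mu]_r g r = 2%:E * \int[mu]_r f r.
Proof.
move=> mf mg f0 qf gE.
have g0 r : 0 <= g r.
  rewrite gE; apply: (@le_trans _ _ (mine (f 0%R) (f (0 + r)%R))).
    by rewrite le_min !f0.
  by apply: ereal_sup_ubound; exists 0%R.
rewrite (layer_cake mf)// (layer_cake mg)//.
rewrite -ge0_integralZl//; last 2 first.
- exact: measurable_height.
- by move=> r _; exact: height_ge0.
apply: eq_integral => r _; have [r0|r0] := ltP r 0%R.
  by rewrite !height_lt0// mule0.
rewrite !heightE// -length_difference; last exact: qf.
congr (mu _); apply/seteqP; split => u /=.
  rewrite gE => /ereal_sup_gt[_ [a _ <-]].
  by rewrite lt_min => /andP[ra rau]; exists a.
move=> [a ra rau]; rewrite gE.
apply: (@lt_le_trans _ _ (mine (f a) (f (a + u)%R))); first by rewrite lt_min ra.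
by apply: ereal_sup_ubound; exists a.
Qed.

(** Monotone convergence along the truncations at integer heights. *)
Lemma exists_trunc (f : mR -> \bar R) (a : R) :
  measurable_fun setT f -> (forall x, 0 <= f x) -> a%:E < \int[mu]_r f r ->
  exists2 K : R, (0 < K)%R & a%:E < \int[mu]_r mine (f r) K%:E.
Proof.
move=> mf f0 af.
pose g n r := mine (f r) n.+1%:R%:E.
have mg n : measurable_fun setT (g n).
  by apply: measurable_mine => //; exact: measurable_cst.
have gn0 n r : 0 <= g n r by rewrite le_min f0 lee_fin ler0n.
have ndg r : nondecreasing_seq (g ^~ r).
  move=> m n mn; rewrite /g le_min ge_min lexx/= ge_min.
  by rewrite lee_fin ler_nat ltnS mn orbT.
have cg r : limn (g ^~ r) = f r.
  apply/cvg_lim => //.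
  rewrite (_ : f r = ereal_sup (range (g ^~ r))); first exact: ereal_nondecreasing_cvgn.
  apply/eqP; rewrite eq_le; apply/andP; split; last first.
    by apply: ge_ereal_sup => _ [n _ <-]; rewrite /g ge_min lexx.
  apply: lee_approx => c cf.
  have [n cn] : exists n : nat, (c < n.+1%:R)%R.
    by exists (Num.trunc c); rewrite truncnS_gt.
  apply: (@le_trans _ _ (g n r)); last by apply: ereal_sup_ubound; exists n.
  by rewrite le_min (ltW cf) lee_fin ltW.
have := @monotone_convergence _ _ _ mu setT measurableT g mg (fun n x _ => gn0 n x) (fun x _ => ndg x).
under eq_integral do rewrite cg.
rewrite (_ : limn _ = ereal_sup (range (fun n => \int[mu]_x g n x))); last first.
  apply/cvg_lim => //; apply: ereal_nondecreasing_cvgn => m n mn.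
  by apply: le_integral_ge0 => // x; exact: ndg.
move=> fE; move: af; rewrite fE => /ereal_sup_gt[_ [n _ <-] an].
by exists n.+1%:R; rewrite ?ltr0n.
Qed.

Lemma ge0_integral_lin (c d : R) (u v : mR -> \bar R) :
  measurable_fun setT u -> measurable_fun setT v ->
  (forall x, 0 <= u x) -> (forall x, 0 <= v x) -> (0 <= c)%R -> (0 <= d)%R ->
  \int[mu]_r (c%:E * u r + d%:E * v r) = c%:E * \int[mu]_r u r + d%:E * \int[mu]_r v r.
Proof.
move=> mu' mv u0 v0 c0 d0; rewrite ge0_integralD//; last 4 first.
- by move=> x _; rewrite mule_ge0.
- by apply: emeasurable_funM => //; exact: measurable_cst.
- by move=> x _; rewrite mule_ge0.
- by apply: emeasurable_funM => //; exact: measurable_cst.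
by rewrite !ge0_integralZl//.
Qed.

(** An arithmetic mean of the integrals of the normalized functions dominates
    their geometric mean, which has the scaling of the conclusion. *)
Lemma geom_le_scaled (t a b al be : R) (I J u v w : \bar R) : (0 < t < 1)%R ->
  (0 < a)%R -> (0 < b)%R -> (0 < al)%R -> (0 < be)%R ->
  I = al%:E * u -> J = be%:E * v -> a%:E < I -> b%:E < J ->
  t%:E * u + (1 - t)%:E * v <= w ->
  (a `^ t * b `^ (1 - t))%:E <= (al `^ t * be `^ (1 - t))%:E * w.
Proof.
move=> t01 a0 b0 al0 be0 -> -> af bg key.
have [t0 t1] := andP t01.
have t01' : (0 <= t <= 1)%R by rewrite !ltW.
have ga0 : (0 < al `^ t * be `^ (1 - t))%R by rewrite mulr_gt0// powR_gt0.
apply: (@le_trans _ _ ((al `^ t * be `^ (1 - t))%:E * (t%:E * (a / al)%:E + (1 - t)%:E * (b / be)%:E))).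
  rewrite -[t%:E * _]EFinM -[(1 - t)%:E * _]EFinM -EFinD -EFinM lee_fin.
  have -> : (a `^ t * b `^ (1 - t) = al `^ t * be `^ (1 - t) * ((a / al) `^ t * (b / be) `^ (1 - t)))%R.
    rewrite mulrACA -!powRM ?divr_ge0 ?ltW//.
    by rewrite ![(_ * (_ / _))%R]mulrC !divfK ?gt_eqF.
  by rewrite ler_pM2l// amgm2// divr_ge0// ltW.
rewrite lee_pmul2l//; apply: le_trans key; apply: leeD.
  rewrite lee_pmul2l//; apply: ltW; rewrite -(@lte_pmul2l _ al%:E)//.
  by rewrite -EFinM mulrC divfK ?gt_eqF.
rewrite lee_pmul2l ?lte_fin ?subr_gt0//; apply: ltW; rewrite -(@lte_pmul2l _ be%:E)//.
by rewrite -EFinM mulrC divfK ?gt_eqF.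
Qed.

(** After division by their suprema [al] and [be], both functions have
    nonempty superlevel sets at every height below 1. There [length_conv]
    compares them with the superlevel sets of [h], and integrating over the
    heights bounds an arithmetic mean of the two integrals. *)
Lemma prekopa_leindler_bounded (f g h : mR -> \bar R) (t M : R) :
  (0 < t < 1)%R ->
  measurable_fun setT f -> measurable_fun setT g -> measurable_fun setT h ->
  (forall x, 0 <= f x <= M%:E) -> (forall x, 0 <= g x <= M%:E) ->
  (forall x, 0 <= h x) ->
  qconcave f -> qconcave g -> qconcave h ->
  (forall (x y a b : R), (0 < a)%R -> (0 < b)%R -> a%:E < f x -> b%:E < g y ->
     (a `^ t * b `^ (1 - t))%:E <= h (t * x + (1 - t) * y)%R) ->
  forall a b : R, (0 < a)%R -> (0 < b)%R -> a%:E < \int[mu]_r f r ->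
    b%:E < \int[mu]_r g r -> (a `^ t * b `^ (1 - t))%:E <= \int[mu]_r h r.
Proof.
move=> t01 mf mg mh fM gM h0 qf qg qh fgh a b a0 b0 af bg.
have [t0 t1] := andP t01.
have t01' : (0 <= t <= 1)%R by rewrite !ltW.
have sup_pos (k : mR -> \bar R) (c : R) : (forall x, 0 <= k x <= M%:E) ->
    (0 < c)%R -> c%:E < \int[mu]_r k r ->
    exists2 s : R, (0 < s)%R & ereal_sup (range k) = s%:E.
  move=> kM c0 ck.
  have s0 : 0 < ereal_sup (range k).
    rewrite ltNge; apply/negP => k0; move: ck; rewrite integral0_eq ?lte_fin.
      by rewrite ltNge (ltW c0).
    move=> x _; apply/eqP; rewrite eq_le; have /andP[-> _] := kM x.
    by rewrite andbT (le_trans _ k0)//; apply: ereal_sup_ubound; exists x.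
  have sM : ereal_sup (range k) <= M%:E.
    by apply: ge_ereal_sup => _ [x _ <-]; have /andP[] := kM x.
  move: s0 sM; case: (ereal_sup _) => [s| |]; [|by rewrite leye_eq|by []].
  by rewrite lte_fin; exists s.
have [al al0 alE] := sup_pos f a fM a0 af.
have [be be0 beE] := sup_pos g b gM b0 bg.
have f0 x : 0 <= f x by have /andP[] := fM x.
have g0 x : 0 <= g x by have /andP[] := gM x.
(* the height of h that corresponds to the height 1 of the normalized f and g
   *)
pose ga : R := (al `^ t * be `^ (1 - t))%R.
have ga0 : (0 < ga)%R by rewrite mulr_gt0// powR_gt0.
have scale (k : mR -> \bar R) (c : R) : (0 < c)%R -> measurable_fun setT k ->
    (forall x, 0 <= k x) ->
    \int[mu]_r k r = c%:E * \int[mu]_r height k (c * r)%R.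
  move=> c0 mk k0; rewrite (layer_cake mk k0).
  exact: (esym (@integral_dilation R c (height k) c0 (measurable_height mk) (height_ge0 k))).
have mhs (k : mR -> \bar R) (c : R) : measurable_fun setT k ->
    measurable_fun setT (fun r : mR => height k (c * r)%R).
  move=> mk; apply: (@measurableT_comp _ _ _ _ _ _ (height k : mR -> \bar R) _ (fun r : mR => c * r : mR)%R).
    exact: measurable_height.
  exact: measurable_funM.
have key : \int[mu]_r (t%:E * height f (al * r)%R + (1 - t)%:E * height g (be * r)%R) <=
    \int[mu]_r height h (ga * r)%R.
  apply: le_integral_ge0 => r.
    by rewrite adde_ge0// mule_ge0 ?height_ge0// lee_fin ?subr_ge0 ltW.
  have [r0|r0] := ltP r 0%R.
    by rewrite !height_lt0 ?mule0 ?adde0// nmulr_llt0 || rewrite pmulr_rlt0.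
  have ar0 : (0 <= al * r)%R by rewrite mulr_ge0// ltW.
  have br0 : (0 <= be * r)%R by rewrite mulr_ge0// ltW.
  have gr0 : (0 <= ga * r)%R by rewrite mulr_ge0// ltW.
  have [r1|r1] := leP 1%R r.
    rewrite (heightE mf ar0) (heightE mg br0) (heightE mh gr0).
    have e0 (k : mR -> \bar R) (s : R) : (0 < s)%R -> ereal_sup (range k) = s%:E ->
        [set x | (s * r)%:E < k x] = set0.
      move=> s0 sE; rewrite -subset0 => x /=; apply/negP; rewrite -leNgt.
      apply: (@le_trans _ _ s%:E).
        by rewrite -sE; apply: ereal_sup_ubound; exists x.
      by rewrite lee_fin ler_peMr// ltW.
    by rewrite (e0 f)// (e0 g)// !measure0 !mule0 adde0.
  rewrite (heightE mf ar0) (heightE mg br0) (heightE mh gr0).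
  have n0 (k : mR -> \bar R) (s : R) : (0 < s)%R -> ereal_sup (range k) = s%:E ->
      [set x | (s * r)%:E < k x] !=set0.
    move=> s0 sE; have : (s * r)%:E < ereal_sup (range k).
      by rewrite sE lte_fin gtr_pMr.
    by move=> /ereal_sup_gt[_ [x _ <-] ?]; exists x.
  apply: length_conv => //.
  - exact: qf.
  - exact: qg.
  - exact: qh.
  - exact: n0.
  - exact: n0.
  move=> x y /= /exists_between[a' aa' ax] /exists_between[b' bb' bx].
  apply: lt_le_trans (fgh x y a' b' _ _ ax bx).
  - rewrite lte_fin; apply: le_lt_trans (ltr_geom t01 ar0 br0 aa' bb').
    rewrite !powRM ?(ltW al0) ?(ltW be0)// mulrACA -powRD; last first.
      by rewrite addrC subrK oner_eq0.
    by rewrite (_ : t + (1 - t) = 1)%R ?powRr1//; ring.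
  - exact: le_lt_trans aa'.
  - exact: le_lt_trans bb'.
have : t%:E * \int[mu]_r height f (al * r)%R + (1 - t)%:E * \int[mu]_r height g (be * r)%R <=
    \int[mu]_r height h (ga * r)%R.
  by rewrite -ge0_integral_lin//; [exact: mhs|exact: mhs|..] => [r|r||];
    rewrite ?height_ge0 ?subr_ge0// ltW.
move=> key2; rewrite (scale h ga)//.
exact: (geom_le_scaled t01 a0 b0 al0 be0 (scale f al al0 mf f0) (scale g be be0 mg g0) af bg key2).
Qed.

(** Truncating [f] and [g] keeps their integrals above [a] and [b] and
    preserves the hypothesis on [h]. *)
Lemma prekopa_leindler1 (f g h : mR -> \bar R) (t : R) :
  (0 < t < 1)%R ->
  measurable_fun setT f -> measurable_fun setT g -> measurable_fun setT h ->
  (forall x, 0 <= f x) -> (forall x, 0 <= g x) -> (forall x, 0 <= h x) ->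
  qconcave f -> qconcave g -> qconcave h ->
  (forall (x y a b : R), (0 < a)%R -> (0 < b)%R -> a%:E < f x -> b%:E < g y ->
     (a `^ t * b `^ (1 - t))%:E <= h (t * x + (1 - t) * y)%R) ->
  forall a b : R, (0 < a)%R -> (0 < b)%R -> a%:E < \int[mu]_r f r ->
    b%:E < \int[mu]_r g r -> (a `^ t * b `^ (1 - t))%:E <= \int[mu]_r h r.
Proof.
move=> t01 mf mg mh f0 g0 h0 qf qg qh fgh a b a0 b0 af bg.
have [K K0 afK] := exists_trunc mf f0 af.
have [L L0 bgL] := exists_trunc mg g0 bg.
have qtr (k : mR -> \bar R) (c : R) : qconcave k -> qconcave (fun r => mine (k r) c%:E).
  move=> qk r r0 x y /=; rewrite !lt_min => /andP[rx rc] /andP[ry _] z xyz /=.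
  by rewrite lt_min rc andbT; apply: (qk r r0 x y).
have tr (k : mR -> \bar R) (c d : R) : (0 < c)%R -> (forall x, 0 <= k x) ->
    forall x, 0 <= mine (k x) c%:E <= (Num.max c d)%:E.
  move=> c0 k0 x; rewrite le_min k0 lee_fin (ltW c0)/= ge_min.
  by apply/orP; right; rewrite lee_fin le_max lexx.
have mm (k : mR -> \bar R) (c : R) : measurable_fun setT k ->
    measurable_fun setT (fun r => mine (k r) c%:E).
  by move=> mk; apply: measurable_mine => //; exact: measurable_cst.
apply: (@prekopa_leindler_bounded _ _ h t (Num.max K L) t01 _ _ mh _ _ h0 _ _ qh _ _ _ a0 b0 afK bgL).
- exact: mm.
- exact: mm.
- exact: tr.
- by rewrite maxC; exact: tr.
- exact: qtr.
- exact: qtr.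
move=> x y a' b' a'0 b'0; rewrite !lt_min => /andP[ax _] /andP[bx _].
exact: fgh.
Qed.

End layercake.

(** * Symmetrizations and suprema over coordinates *)

Section operators.
Context {R : realType} {n : nat}.
Local Notation mR := (measurableTypeR R).
Local Notation mu := (@lebesgue_measure R).
Local Notation T := (n.-tuple mR).
Implicit Types (x y z : T) (i j : 'I_n) (F G : T -> \bar R) (l : seq 'I_n).
Local Open Scope ereal_scope.

Definition comb (t : R) x y : T :=
  [tuple (t * tnth x j + (1 - t) * tnth y j)%R | j < n].

Lemma comb_upd t x y i r s :
  comb t (upd x i r) (upd y i s) = upd (comb t x y) i (t * r + (1 - t) * s)%R.
Proof.
by apply: eq_from_tnth => j; rewrite !(tnth_mktuple, tnth_upd); case: eqP.
Qed.

(** Log-concavity tested on real strict lower bounds, which covers the values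
    0 and [+oo]. *)
Definition lcv F := forall (t : R) x y (a b : R), (0 < t < 1)%R ->
  (0 < a)%R -> (0 < b)%R -> a%:E < F x -> b%:E < F y ->
  (a `^ t * b `^ (1 - t))%:E <= F (comb t x y).

Lemma powR_conv (c t : R) : (0 <= c)%R -> (c `^ t * c `^ (1 - t) = c)%R.
Proof.
move=> c0; have tt : (t + (1 - t) = 1)%R by rewrite addrC subrK.
by rewrite -powRD tt ?oner_eq0// powRr1.
Qed.

Lemma lcv_quasi F (t c : R) x y : lcv F -> (0 < t < 1)%R -> (0 <= c)%R ->
  c%:E < F x -> c%:E < F y -> c%:E < F (comb t x y).
Proof.
move=> lF t01 c0 /exists_between[a ca ax] /exists_between[b cb bx].
apply: lt_le_trans (lF t x y a b t01 _ _ ax bx).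
- by rewrite lte_fin -[X in (X < _)%R](powR_conv t c0) ltr_geom.
- exact: le_lt_trans ca.
- exact: le_lt_trans cb.
Qed.

Lemma qconcave_line F x i : lcv F -> qconcave (fun r => F (upd x i r)).
Proof.
move=> lF c c0 r s /= cr cs u /andP[ru us].
have [->//|ur] := eqVneq u r.
have [->//|us'] := eqVneq u s.
have {}ru : (r < u)%R by rewrite lt_neqAle eq_sym ur.
have {}us : (u < s)%R by rewrite lt_neqAle us'.
pose t := ((s - u) / (s - r))%R.
have rs : (0 < s - r)%R by lra.
have t01 : (0 < t < 1)%R.
  by rewrite divr_gt0 ?ltr_pdivrMr//= ?mul1r; lra.
have -> : upd x i u = comb t (upd x i r) (upd x i s).
  rewrite comb_upd; have -> : comb t x x = x.
    by apply: eq_from_tnth => j; rewrite tnth_mktuple; ring.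
  by congr upd; rewrite /t; field; rewrite gt_eqF.
exact: lcv_quasi.
Qed.

(** Prekopa's theorem: on each line it is the Prekopa-Leindler inequality. *)
Lemma lcv_int1 i F : nnm F -> lcv F -> lcv (int1 i F).
Proof.
move=> nF lF t x y a b t01 a0 b0 ax bx.
apply: (@prekopa_leindler1 R (fun r => F (upd x i r)) (fun r => F (upd y i r))
   (fun r => F (upd (comb t x y) i r)) t t01).
- exact: nnm_upd.
- exact: nnm_upd.
- exact: nnm_upd.
- by move=> r; exact: nF.2.
- by move=> r; exact: nF.2.
- by move=> r; exact: nF.2.
- exact: qconcave_line.
- exact: qconcave_line.
- exact: qconcave_line.
- move=> r s c d c0 d0 cr ds; rewrite -comb_upd; exact: lF.
- exact: a0.
- exact: b0.
- exact: ax.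
- exact: bx.
Qed.

Lemma lcv_iint l F : nnm F -> lcv F -> lcv (iint l F).
Proof.
by move=> nF lF; elim: l => //= i l IH; apply: lcv_int1 => //; exact: nnm_iint.
Qed.

(** Lower semicontinuity for the neighbourhoods given by boxes. *)
Definition lsc F := forall x (c : R), c%:E < F x -> exists2 e : R, (0 < e)%R &
  forall y, (forall j, (`|tnth x j - tnth y j| < e)%R) -> c%:E < F y.

(** A superlevel set is the union of the rational boxes that it contains. *)
Lemma lsc_measurable F : lsc F -> measurable_fun setT F.
Proof.
move=> lF; apply: (measurability _ (ErealGenOInfty.measurableE R)) => //.
move=> _ [_ [c ->] <-]; rewrite setTI.
pose box (q : n.-tuple rat * nat) : set T :=
  \big[setI/setT]_(j < n) [set x | (`|tnth x j - ratr (tnth q.1 j)| < q.2.+1%:R^-1)%R].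
have mbox q : measurable (box q).
  apply: big_ind => //; first by move=> A B; exact: measurableI.
  move=> j _.
  rewrite (_ : mkset _ = setT `&` (fun x : T => tnth x j) @^-1` ball (ratr (tnth q.1 j) : R) (q.2.+1%:R^-1)).
    apply: measurable_tnth => //; exact: measurable_ball.
  by rewrite setTI; apply/seteqP; split => x; rewrite /= -ball_normE /ball_/= distrC.
have boxE q x : box q x <-> forall j, (`|tnth x j - ratr (tnth q.1 j)| < q.2.+1%:R^-1)%R.
  rewrite /box; split.
    by move=> + j; rewrite (bigD1 j)//= => -[].
  by move=> h; elim/big_rec : _ => // j A _ Ax; split => //; exact: h.
rewrite (_ : _ @^-1` _ = \bigcup_(q in [set q | box q `<=` [set x | c%:E < F x]]) box q).
  rewrite bigcup_mkcond; apply: countable_bigcupT_measurable => [|q]; first exact: countableP.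
  by case: ifP.
apply/seteqP; split => x /=; last first.
  by move=> [q qF qx]; rewrite in_itv/= andbT; exact: qF.
rewrite in_itv/= andbT => cx; have [e e0 eF] := lF x c cx.
pose m := Num.trunc (2 / e).
have m1 : (m.+1%:R^-1 < e / 2)%R.
  rewrite invf_plt ?posrE ?divr_gt0// invf_div; exact: truncnS_gt.
have qx j : exists q : rat, (`|tnth x j - ratr q| < m.+1%:R^-1)%R.
  have : (tnth x j - m.+1%:R^-1 < tnth x j + m.+1%:R^-1)%R.
    by rewrite ltrD2l gt0_cp ?invr_gt0.
  move=> /rat_in_itvoo[q]; rewrite in_itv/= => /andP[q1 q2]; exists q.
  rewrite distrC ltr_norml; apply/andP; split; first by rewrite ltrBrDl.
  by rewrite ltrBlDl.
pose q := [tuple projT1 (cid (qx j)) | j < n].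
have qP j : (`|tnth x j - ratr (tnth q j)| < m.+1%:R^-1)%R.
  by rewrite tnth_mktuple; exact: projT2 (cid (qx j)).
exists (q, m); last exact/boxE.
move=> y /boxE /= yq; apply: eF => j.
have := ler_distD (ratr (tnth q j)) (tnth x j) (tnth y j).
have := qP j; have := yq j; move: m1; rewrite (distrC (tnth y j)) => m1 h1 h2 h3.
apply: le_lt_trans h3 _; rewrite [e]splitr; apply: ltrD; exact: lt_trans m1.
Qed.

(** On each line in direction [i] the superlevel sets are replaced by their
    difference sets. Being written with suprema only, this symmetrization
    preserves log-concavity and lower semicontinuity. *)
Definition dsym i F x : \bar R :=
  ereal_sup [set mine (F (upd x i a)) (F (upd x i (a + tnth x i)%R)) | a in [set: R]].
Definition dsyms l F := foldr dsym F l.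

Definition agree (A : {set 'I_n}) x y := forall j, j \notin A -> tnth x j = tnth y j.

(** The projection along the coordinates in [A]. *)
Definition msup (A : {set 'I_n}) F x : \bar R := ereal_sup [set F y | y in agree A x].

Lemma dsym_gt i F x (c : R) : c%:E < dsym i F x <->
  exists2 a, c%:E < F (upd x i a) & c%:E < F (upd x i (a + tnth x i)%R).
Proof.
split=> [/ereal_sup_gt[_ [a _ <-]]|[a h1 h2]].
  by rewrite lt_min => /andP[h1 h2]; exists a.
apply: (@lt_le_trans _ _ (mine (F (upd x i a)) (F (upd x i (a + tnth x i)%R)))).
  by rewrite lt_min h1.
by apply: ereal_sup_ubound; exists a.
Qed.

Lemma le_ereal_gt (X Y : \bar R) : 0 <= Y ->
  (forall c : R, (0 <= c)%R -> c%:E < X -> c%:E < Y) -> X <= Y.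
Proof.
move=> Y0 h; apply: lee_approx => c cX; have [c0|c0] := leP 0%R c.
  by apply/ltW/h.
by apply: le_trans Y0; rewrite lee_fin ltW.
Qed.

Lemma dsym_ge0 i F : (forall x, 0 <= F x) -> forall x, 0 <= dsym i F x.
Proof.
move=> F0 x; apply: (@le_trans _ _ (mine (F (upd x i 0%R)) (F (upd x i (0 + tnth x i)%R)))).
  by rewrite le_min !F0.
by apply: ereal_sup_ubound; exists 0%R.
Qed.

Lemma lcv_dsym i F : lcv F -> lcv (dsym i F).
Proof.
move=> lF t x y a b t01 a0 b0 /dsym_gt[u au au'] /dsym_gt[v bv bv'].
apply: le_trans; last first.
  by apply: ereal_sup_ubound; exists (t * u + (1 - t) * v)%R => //.
rewrite le_min -comb_upd lF//=.
rewrite (_ : t * u + (1 - t) * v + tnth (comb t x y) i =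
   t * (u + tnth x i) + (1 - t) * (v + tnth y i))%R; last first.
  by rewrite tnth_mktuple; ring.
by rewrite -comb_upd lF.
Qed.

Lemma near_upd x y i (r s e : R) : (forall j, (`|tnth x j - tnth y j| < e)%R) ->
  (`|r - s| < e)%R ->
  forall j, (`|tnth (upd x i r) j - tnth (upd y i s) j| < e)%R.
Proof. by move=> xy rs j; rewrite !tnth_upd; case: eqP. Qed.

Lemma lsc_dsym i F : lsc F -> lsc (dsym i F).
Proof.
move=> lF x c /dsym_gt[a /lF[d d0 dF] /lF[e e0 eF]].
exists (Num.min d e); first by rewrite lt_min d0.
move=> y xy; apply/dsym_gt; exists a.
  apply: dF; apply: near_upd.
    by move=> j; apply: lt_le_trans (xy j) _; rewrite ge_min lexx.
  by rewrite subrr normr0.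
apply: eF; apply: near_upd.
  by move=> j; apply: lt_le_trans (xy j) _; rewrite ge_min lexx orbT.
rewrite opprD addrACA subrr add0r.
by apply: lt_le_trans (xy i) _; rewrite ge_min lexx orbT.
Qed.

Lemma msup_ge A F x y : agree A x y -> F y <= msup A F x.
Proof. by move=> xy; apply: ereal_sup_ubound; exists y. Qed.

Lemma msup_gt A F x (c : R) : c%:E < msup A F x <-> exists2 y, agree A x y & c%:E < F y.
Proof.
split=> [/ereal_sup_gt[_ [y xy <-]]|[y xy cy]]; first by exists y.
exact: lt_le_trans (msup_ge F xy).
Qed.

Lemma msup_ge0 A F : (forall x, 0 <= F x) -> forall x, 0 <= msup A F x.
Proof. by move=> F0 x; apply: le_trans (F0 x) _; exact: msup_ge. Qed.

Lemma msup_agree A F x y : agree A x y -> msup A F x = msup A F y.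
Proof.
move=> xy; congr ereal_sup; apply/seteqP; split => _ [z xz <-]; exists z => //.
  by move=> j jA; rewrite -xy// xz.
by move=> j jA; rewrite xy// xz.
Qed.

Lemma lcv_msup A F : lcv F -> lcv (msup A F).
Proof.
move=> lF t x y a b t01 a0 b0 /msup_gt[u xu au] /msup_gt[v yv bv].
apply: le_trans (lF _ _ _ _ _ t01 a0 b0 au bv) _; apply: msup_ge => j jA.
by rewrite !tnth_mktuple xu// yv.
Qed.

Lemma lsc_msup A F : lsc F -> lsc (msup A F).
Proof.
move=> lF x c /msup_gt[y xy /lF[e e0 eF]]; exists e => // z xz; apply/msup_gt.
exists [tuple (if j \in A then tnth y j else tnth z j) | j < n].
  by move=> j jA; rewrite tnth_mktuple (negbTE jA).
apply: eF => j; rewrite tnth_mktuple; case: ifPn => jA.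
  by rewrite subrr normr0.
by rewrite -xy.
Qed.

Definition reg F := [/\ forall x, 0 <= F x, lcv F & lsc F].

Lemma reg_nnm F : reg F -> nnm F.
Proof. by move=> [F0 _ lF]; split => //; exact: lsc_measurable. Qed.

Lemma reg_dsyms l F : reg F -> reg (dsyms l F).
Proof.
move=> rF; elim: l => //= i l [h1 h2 h3]; split.
- exact: dsym_ge0.
- exact: lcv_dsym.
- exact: lsc_dsym.
Qed.

Lemma reg_msup A F : reg F -> reg (msup A F).
Proof. by move=> [h1 h2 h3]; split; [exact: msup_ge0|exact: lcv_msup|exact: lsc_msup]. Qed.

(** A difference set is twice as long as the interval it comes from. *)
Lemma int1_dsym i F : reg F -> int1 i (dsym i F) = fun x => 2%:E * int1 i F x.
Proof.
move=> rF; have [F0 lF _] := rF; have nF := reg_nnm rF.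
have nD : nnm (dsym i F) by apply: reg_nnm; apply: (reg_dsyms [:: i] rF).
apply/funext => x; apply: (@integral_sup_min R (fun r => F (upd x i r))).
- exact: nnm_upd.
- exact: nnm_upd.
- by move=> r; exact: F0.
- exact: qconcave_line.
- move=> r; rewrite /dsym; congr ereal_sup; apply/seteqP.
  by split => _ [a _ <-]; exists a => //; rewrite !upd_upd tnth_upd eqxx.
Qed.

Lemma iint_dsyms l F : reg F -> iint l (dsyms l F) = fun x => (2 ^+ size l)%:E * iint l F x.
Proof.
move=> rF; have nF := reg_nnm rF.
elim: l => [|i l IH]; first by apply/funext => x; rewrite expr0 mul1e.
have rl := reg_dsyms l rF; have nl := reg_nnm rl.
have nil : nnm (dsym i (dsyms l F)) by apply: reg_nnm; exact: (reg_dsyms (i :: l) rF).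
rewrite /= int1_iint// int1_dsym// iintZl//; last exact: nnm_int1.
rewrite -int1_iint// IH.
apply/funext => x; rewrite (@int1Zl _ _ i (iint l F) (fun=> (2 ^+ size l)%:E))//; last exact: nnm_iint.
by rewrite muleA -EFinM exprS.
Qed.

(** A symmetrized function is largest where the symmetrized coordinate
    vanishes. *)
Definition zdec i F := forall x, F x <= F (upd x i 0%R).

Lemma zdec_dsym i F : (forall x, 0 <= F x) -> zdec i (dsym i F).
Proof.
move=> F0 x; apply: le_ereal_gt; first exact: dsym_ge0.
move=> c _ /dsym_gt[a h1 h2]; apply/dsym_gt; exists a; rewrite upd_upd//.
by rewrite tnth_upd eqxx addr0.
Qed.

Lemma zdec_dsym' i j F : (forall x, 0 <= F x) -> zdec i F -> zdec i (dsym j F).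
Proof.
move=> F0; have [<-|ij] := eqVneq i j; first by move=> _; exact: zdec_dsym.
move=> zF x; apply: le_ereal_gt; first exact: dsym_ge0.
move=> c _ /dsym_gt[a h1 h2]; apply/dsym_gt; exists a.
  by rewrite updC//; apply: lt_le_trans (zF _).
by rewrite updC// tnth_upd eq_sym (negbTE ij); apply: lt_le_trans (zF _).
Qed.

Lemma zdec_dsyms i l F : reg F -> i \in l -> zdec i (dsyms l F).
Proof.
move=> rF; elim: l => //= j l IH; rewrite inE.
have [h1 _ _] := reg_dsyms l rF.
by case: (eqVneq i j) => [->|_] /= il; [exact: zdec_dsym|exact/zdec_dsym'/IH].
Qed.

Lemma zdec_iint i l F : nnm F -> i \notin l -> zdec i F -> zdec i (iint l F).
Proof.
move=> nF; elim: l => //= j l IH; rewrite inE negb_or => /andP[ij il] zF x.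
rewrite /int1; apply: le_integral_ge0 => r; first exact: (nnm_iint l nF).2.
by rewrite updC//; exact: IH.
Qed.

(** At points whose coordinates in [A] vanish, symmetrizing in these
    directions amounts to no more than taking a supremum over them. *)
Lemma dsyms_le_msup (A : {set 'I_n}) l (F1 F2 : T -> \bar R) : uniq l ->
  (forall x, 0 <= F2 x) ->
  (forall x y, agree A x y -> F1 x <= F2 y) ->
  forall x y, agree A x y -> (forall i, i \in l -> i \in A -> tnth x i = 0%R) ->
    dsyms l F1 x <= dsyms [seq i <- l | i \notin A] F2 y.
Proof.
move=> + F20 F12; elim: l => [_ x y xy _|i l IH]; first exact: F12.
move=> /andP[il ul] x y xy x0 /=.
have D0 k z : 0 <= dsyms k F2 z by elim: k z => //= j k IHk z; exact: dsym_ge0.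
apply: le_ereal_gt; first exact: (D0 (if i \notin A then i :: _ else _)).
have xl j a : j \in l -> j \in A -> tnth (upd x i a) j = 0%R.
  move=> jl jA; rewrite tnth_upd; case: eqP => [ji|_].
    by rewrite -ji jl in il.
  by apply: x0 => //; rewrite inE jl orbT.
move=> c _ /dsym_gt[a h1 h2]; case: ifPn => iA; last first.
  apply: lt_le_trans h1 _; apply: IH => //; last by move=> j jl jA; exact: xl.
  move=> j jA; rewrite tnth_upd; case: eqP => [ji|_]; last exact: xy.
  by rewrite ji (negbNE iA) in jA.
apply/dsym_gt; exists a.
  apply: lt_le_trans h1 _; apply: IH => //; last by move=> j jl jA; exact: xl.
  by move=> j jA; rewrite !tnth_upd; case: eqP => // _; exact: xy.
apply: lt_le_trans h2 _; apply: IH => //; last by move=> j jl jA; exact: xl.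
by move=> j jA; rewrite !tnth_upd; case: eqP => [_|_]; rewrite (xy _)//.
Qed.

End operators.

(** * Gamma integrals and a Berwald-type inequality *)

Section gamma.
Context {R : realType}.
Local Notation mR := (measurableTypeR R).
Local Notation mu := (@lebesgue_measure R).

(** A primitive of s^k e^-s, from repeated integration by parts. *)
Fixpoint gprim (k : nat) (s : R) : R :=
  if k is k'.+1 then - (s ^+ k'.+1 * expR (- s)) + k'.+1%:R * gprim k' s
  else - expR (- s).

Lemma is_derive_expRN (s : R) : is_derive s 1 (fun s : R => expR (- s)) (- expR (- s)).
Proof.
have h1 : is_derive (- s) 1 (@expR R) (expR (- s)) by exact: is_derive_expR.
have h2 : is_derive s 1 (-%R : R -> R) (- 1) by exact: is_deriveNid.
by have := is_derive1_comp h1 h2; rewrite mulrN1.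
Qed.

Lemma is_derive_gprim k (s : R) : is_derive s 1 (gprim k) (s ^+ k * expR (- s)).
Proof.
elim: k => [|k IH] /=.
  have := is_derive_expRN s => h.
  by apply: is_derive_eq; rewrite opprK expr0 mul1r.
have h := is_derive_expRN s.
have h3 : is_derive s 1 (fun s : R => s ^+ k.+1) (k.+1%:R * s ^+ k).
  have -> : (fun s : R => s ^+ k.+1) = (id : R -> R) ^+ k.+1.
    by apply/funext => x; rewrite exprfctE.
  by apply: is_derive_eq; rewrite /GRing.scale/= mulr1 mulr_natl.
have h2 : is_derive s 1 (fun s : R => s ^+ k.+1 * expR (- s))
    (s ^+ k.+1 * (- expR (- s)) + expR (- s) * (k.+1%:R * s ^+ k)).
  exact: (is_deriveM h3 h).
have -> : (fun s0 : R => - (s0 ^+ k.+1 * expR (- s0)) + k.+1%:R * gprim k s0) =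
  (- (fun s : R => s ^+ k.+1 * expR (- s))) + (k.+1%:R *: gprim k) by [].
apply: (is_derive_eq (is_deriveD (is_deriveN h2) (is_deriveZ (k.+1%:R) IH))).
by rewrite /GRing.scale/= mulrN opprD opprK mulrCA [expR _ * _]mulrC subrK.
Qed.

Lemma cvg_gprim k : gprim k s @[s --> +oo] --> (0 : R).
Proof.
have h j : (fun s : R => s ^+ j * expR (- s)) s @[s --> +oo] --> (0 : R).
  apply/cvgrPdist_lt => e e0; near=> s.
  have s0 : 0 < s by near: s; apply: nbhs_pinfty_gt; rewrite num_real.
  have se : j.+1`!%:R / e < s by near: s; apply: nbhs_pinfty_gt; rewrite num_real.
  rewrite sub0r normrN ger0_norm ?mulr_ge0 ?expR_ge0 ?exprn_ge0 ?(ltW s0)//.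
  have := @expR_ge1Dxn R s j (ltW s0).
  have f0 : 0 < j.+1`!%:R :> R by rewrite ltr0n fact_gt0.
  rewrite expRN => h; rewrite ltr_pdivrMr ?expR_gt0//.
  have h2 : s ^+ j.+1 / j.+1`!%:R < expR s by lra.
  apply: (@le_lt_trans _ _ (e * (s ^+ j.+1 / j.+1`!%:R))); last by rewrite ltr_pM2l.
  rewrite exprSr; have -> : e * (s ^+ j * s / j.+1`!%:R) = s ^+ j * (s * e / j.+1`!%:R) by ring.
  rewrite ler_peMr ?exprn_ge0 ?(ltW s0)//.
  by move: se; rewrite ltr_pdivrMr// => se; rewrite ler_pdivlMr// mul1r ltW.
elim: k => [|k IH] /=.
  rewrite -oppr0; apply: cvgN; have := h 0%N; apply: cvg_trans.
  by apply: near_eq_cvg; apply: nearW => s; rewrite expr0 mul1r.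
rewrite -[X in _ --> X]addr0; apply: cvgD.
  by rewrite -oppr0; apply: cvgN; exact: h.
by rewrite -[X in _ --> X](mulr0 k.+1%:R); apply: cvgMr.
Unshelve. all: by end_near. Qed.

Lemma gprim0 k : gprim k 0 = - k`!%:R.
Proof.
elim: k => [|k IH] /=; first by rewrite oppr0 expR0.
by rewrite expr0n/= mul0r oppr0 add0r IH factS natrM mulrN.
Qed.

Lemma continuous_gamma k : continuous (fun s : R => s ^+ k * expR (- s)).
Proof.
move=> s; apply: cvgM; first exact: exprn_continuous.
have h : {for s, continuous (fun s : R => expR (- s))}.
  apply/differentiable_continuous/derivable1_diffP.
  exact: (@ex_derive _ _ _ _ _ _ _ (is_derive_expRN s)).
exact: h.
Qed.

Lemma integral_gprim k (a : R) : 0 <= a ->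
  (\int[mu]_(s in `[a, +oo[) (s ^+ k * expR (- s))%:E = (- gprim k a)%:E)%E.
Proof.
move=> a0; rewrite (@ge0_continuous_FTC2y _ _ (gprim k) _ 0)//.
- by rewrite sub0e EFinN.
- by move=> s sa; rewrite mulr_ge0 ?expR_ge0// exprn_ge0// (le_trans a0).
- exact/continuous_subspaceT/continuous_gamma.
- exact: cvg_gprim.
- by move=> s _; exact: (@ex_derive _ _ _ _ _ _ _ (is_derive_gprim k s)).
- have h : {for a, continuous (gprim k)}.
    apply/differentiable_continuous/derivable1_diffP.
    exact: (@ex_derive _ _ _ _ _ _ _ (is_derive_gprim k a)).
  exact: cvg_at_right_filter h.
- by move=> s _; rewrite derive1E; have := is_derive_gprim k s => h; exact: derive_val.
Qed.

(** The weight of the layer-cake formula in the scale of heights e^-s. *)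
Definition wexp (s : R) : R := ((0 < s)%R)%:R * expR (- s).

Lemma wexp_ge0 s : 0 <= wexp s.
Proof. by rewrite mulr_ge0 ?expR_ge0// ler0n. Qed.

Lemma measurable_expRN : measurable_fun setT (fun s : mR => expR (- s) : mR).
Proof.
apply: (@measurableT_comp _ _ _ _ _ _ (@expR R) _ (fun s : mR => - s : mR)).
  exact: measurable_expR.
exact: measurable_funN.
Qed.

Lemma measurable_wexp : measurable_fun setT (wexp : mR -> mR).
Proof.
apply: measurable_funM; last exact: measurable_expRN.
rewrite (_ : (fun _ => _) = \1_(`]0, +oo[%classic : set mR)).
  by apply: measurable_indic; exact: measurable_itv.
apply/funext => s; rewrite indicE; congr (_%:R); congr nat_of_bool.
by apply/idP/idP => [h|]; [rewrite inE /= in_itv/= andbT|rewrite inE /= in_itv/= andbT].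
Qed.

Lemma integral_wexp (h : mR -> \bar R) :
  (\int[mu]_s ((wexp s)%:E * h s) =
   \int[mu]_(s in `]0%R, +oo[) ((expR (- s))%:E * h s))%E.
Proof.
rewrite [RHS]integral_mkcond; apply: eq_integral => s _.
rewrite patchE /wexp; case: ifPn => [|]; rewrite ?inE ?notin_setE /= in_itv/= andbT.
  by move=> ->; rewrite mul1r.
by move=> /negP/negbTE ->; rewrite mul0r mul0e.
Qed.

Lemma measurable_gamma k :
  measurable_fun setT (fun s : mR => (s ^+ k * expR (- s))%:E).
Proof.
apply/measurable_EFinP; apply: measurable_funM; last exact: measurable_expRN.
exact: exprn_measurable.
Qed.

Lemma integral_wexpX k : (\int[mu]_s ((wexp s)%:E * (s ^+ k)%:E) = k`!%:R%:E)%E.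
Proof.
rewrite integral_wexp -[k`!%:R]opprK -gprim0 -(@integral_gprim k 0)//.
rewrite -integral_itv_obnd_cbnd; last first.
  by apply: measurable_funTS; exact: measurable_gamma.
by apply: eq_integral => s _; rewrite -EFinM mulrC.
Qed.

(** The layer-cake formula for the number [u], at heights e^-s. *)
Lemma integral_wexp_tail (u : \bar R) : (0 <= u <= 1)%E ->
  (\int[mu]_s ((wexp s)%:E * ((expR (- s))%:E < u)%E%:R%:E) = u)%E.
Proof.
move=> /andP[u0 u1].
have [->|un0] := eqVneq u 0%E.
  by rewrite integral0_eq// => s _; rewrite lte_fin ltNge expR_ge0/= mule0.
case: u u0 u1 un0 => [u| |]//; rewrite !lee_fin => u0 u1 un0.
have {un0}u0 : 0 < u by rewrite lt_neqAle u0 andbT eq_sym.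
pose a := - ln u.
have a0 : 0 <= a by rewrite oppr_ge0 ln_le0.
transitivity (\int[mu]_(s in `]a, +oo[) (s ^+ 0 * expR (- s))%:E)%E.
  rewrite [RHS]integral_mkcond; apply: eq_integral => s _.
  rewrite patchE lte_fin /wexp mem_setE in_itv/= andbT.
  have -> : (expR (- s) < u)%R = (a < s)%R by rewrite -{1}(lnK u0) ltr_expR /a ltrNl.
  case: (ltP a s) => as_; last by rewrite mulr0n mule0.
  by rewrite expr0 mul1r (le_lt_trans a0 as_) !mulr1n mule1 mul1r.
rewrite integral_itv_obnd_cbnd; last first.
  by apply: measurable_funTS; exact: (measurable_gamma 0).
by rewrite integral_gprim//= opprK /a opprK lnK.
Qed.

End gamma.

Section berwald.
Context {R : realType}.
Local Notation mR := (measurableTypeR R).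
Local Notation mu := (@lebesgue_measure R).

(** The tangent line at [X] of the convex function x^b, in the form of an
    inequality between weighted means. *)
Lemma powR_tangent (b X Y : R) : 1 <= b -> 0 <= X -> 0 <= Y ->
  X `^ b - Y `^ b <= b * X `^ (b - 1) * (X - Y).
Proof.
move=> b1 X0 Y0; have b0 : 0 < b by exact: lt_le_trans b1.
have := @amgm2 R ((b - 1) / b) (X `^ b) (Y `^ b).
rewrite !powR_ge0 divr_ge0 ?subr_ge0 ?(ltW b0)// ler_pdivrMr// mul1r gerBl ler01.
move=> /(_ isT isT isT).
have -> : 1 - (b - 1) / b = b^-1 by field; rewrite gt_eqF.
rewrite -!powRrM [b * ((b - 1) / b)]mulrC divfK ?gt_eqF// divff ?gt_eqF// powRr1//.
rewrite -(ler_pM2l b0).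
have -> : b * ((b - 1) / b * X `^ b + b^-1 * Y `^ b) = (b - 1) * X `^ b + Y `^ b.
  by field; rewrite gt_eqF.
have -> : X `^ b = X * X `^ (b - 1) by rewrite mulr_powRB1.
nra.
Qed.

(** Moving the point of tangency from [X] away from [Y] to [Z] only weakens
    the tangent line inequality. *)
Lemma powR_chord (b X Y Z : R) : 1 <= b -> 0 <= X -> 0 <= Y -> 0 <= Z ->
  (Y <= X <= Z) || (Z <= X <= Y) ->
  X `^ b - Y `^ b <= b * Z `^ (b - 1) * (X - Y).
Proof.
move=> b1 X0 Y0 Z0 h; apply: le_trans (powR_tangent b1 X0 Y0) _.
have b0 : 0 < b by exact: lt_le_trans b1.
have bb : 0 <= b - 1 by rewrite subr_ge0.
have [/andP[YX XZ]|/andP[ZX XY]] := orP h.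
  apply: ler_wpM2r; rewrite ?subr_ge0// ler_pM2l//.
  by apply: ge0_ler_powR; rewrite ?nnegrE.
rewrite -lerN2 -!mulrN opprB; apply: ler_wpM2r; rewrite ?subr_ge0// ler_pM2l//.
by apply: ge0_ler_powR; rewrite ?nnegrE.
Qed.

(** The ratio of [phi s] to s^a is nonincreasing, by homogeneity, so it is at
    least 1 before some point s0 and at most 1 after it. With b = d/a,
    convexity of x^b bounds phi^b - s^d by b (s0^a)^(b-1) (phi - s^a) on both
    sides of s0. Integrated against e^-s the right-hand side is at most 0,
    because s^a integrates to a!, and s^d integrates to d!. *)
Lemma berwald (phi : R -> R) (a d : nat) :
  (0 < a)%N -> (a <= d)%N -> measurable_fun setT (phi : mR -> mR) ->
  (forall s, 0 <= phi s) ->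
  (forall s s', 0 < s -> s <= s' -> phi s <= phi s') ->
  (forall s th, 0 < s -> 0 < th -> th < 1 -> th ^+ a * phi s <= phi (th * s)) ->
  (\int[mu]_s ((wexp s)%:E * (phi s)%:E) < a`!%:R%:E)%E ->
  (\int[mu]_s ((wexp s)%:E * (phi s `^ (d%:R / a%:R))%:E) <= d`!%:R%:E)%E.
Proof.
move=> a0 ad mphi phi0 phim phih phia.
pose b : R := d%:R / a%:R; rewrite -/b.
have a0R : 0 < a%:R :> R by rewrite ltr0n.
have b1 : 1 <= b by rewrite ler_pdivlMr// mul1r ler_nat.
have b0 : 0 <= b by exact: le_trans b1.
have sdE (s : R) : 0 <= s -> (s ^+ a) `^ b = s ^+ d.
  move=> s0; rewrite -powR_mulrn// -powRrM /b mulrC divfK ?gt_eqF//.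
  by rewrite powR_mulrn.
have rootP X : 0 < X -> exists2 r : R, 0 < r & r ^+ a = X.
  move=> X0; exists (X `^ (a%:R^-1)); first exact: powR_gt0.
  by rewrite -powR_mulrn ?powR_ge0// -powRrM mulVf ?gt_eqF// powRr1// ltW.
(* the points before s0: an initial segment of the positive reals *)
pose E : set R := [set s | 0 < s /\ s ^+ a <= phi s].
have Edown s s' : E s' -> 0 < s -> s <= s' -> E s.
  move=> [s'0 s'E] s0; rewrite le_eqVlt => /orP[/eqP ->//|ss']; split => //.
  have th1 : s / s' < 1 by rewrite ltr_pdivrMr// mul1r.
  have := phih s' (s / s') s'0 (divr_gt0 s0 s'0) th1.
  rewrite divfK ?gt_eqF//; apply: le_trans.
  rewrite expr_div_n -[leLHS](@divfK _ (s' ^+ a)) ?gt_eqF ?exprn_gt0//.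
  by apply: ler_wpM2l => //; rewrite divr_ge0// exprn_ge0// ltW.
(* otherwise phi is above s^a everywhere, against the bound on its integral *)
have Ebnd : has_ubound E.
  apply: contrapT => nub.
  have all_E s : 0 < s -> E s.
    move=> s0; apply: contrapT => nEs; apply: nub; exists s => s' Es'.
    by rewrite leNgt; apply/negP => ss'; apply: nEs; apply: Edown Es' s0 (ltW ss').
  move: phia; rewrite ltNge => /negP; apply.
  rewrite -integral_wexpX; apply: le_integral_ge0 => s; rewrite /wexp; have [s0|s0] := ltP 0 s; rewrite ?mul0r ?mul0e//.
    by rewrite mul1r -EFinM lee_fin mulr_ge0 ?expR_ge0// exprn_ge0// ltW.
  rewrite mul1r -!EFinM lee_fin ler_pM2l ?expR_gt0//.
  by have [] := all_E _ s0.
(* K is the slope of x^b at the value x = s0^a *)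
have [K K0 key] : exists2 K : R, 0 <= K & forall s, 0 < s ->
    phi s `^ b + K * s ^+ a <= s ^+ d + K * phi s.
  have [E0|/set0P Ene] := eqVneq E set0.
    exists 0 => // s s0; rewrite !mul0r !addr0 -sdE ?(ltW s0)//.
    apply: ge0_ler_powR; rewrite ?nnegrE ?exprn_ge0 ?(ltW s0)//.
    have [//|h] := leP (phi s) (s ^+ a).
    have : E s by split => //; exact: ltW.
    by rewrite E0.
  have supE : has_sup E by split.
  pose s0 := sup E.
  have s0_ge0 : 0 <= s0.
    case: Ene => s Es; apply: le_trans (ltW (proj1 Es)) _.
    exact: sup_upper_bound.
  exists (b * (s0 ^+ a) `^ (b - 1)).
    by rewrite mulr_ge0 ?powR_ge0.
  move=> s sp.
  have sa0 : 0 <= s ^+ a by rewrite exprn_ge0// ltW.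
  have Z0 : 0 <= s0 ^+ a by rewrite exprn_ge0.
  suff : phi s `^ b - (s ^+ a) `^ b <= b * (s0 ^+ a) `^ (b - 1) * (phi s - s ^+ a).
    by rewrite (sdE _ (ltW sp)) mulrBr; lra.
  apply: powR_chord => //.
  have [sX|Xs] := leP (s ^+ a) (phi s); rewrite /= ?andbT ?andbF ?orbF.
    have Es : E s by [].
    have ss0 : s <= s0 by apply: sup_upper_bound.
    apply/orP; left; rewrite leNgt; apply/negP => Zphi.
    have [r r0 rE] := rootP _ (le_lt_trans Z0 Zphi).
    have s0r : s0 < r.
      by rewrite -(@ltr_pXn2r _ a) ?nnegrE ?(ltW r0)// rE.
    have : E r.
      split => //; rewrite rE; apply: phim => //.
      by apply: le_trans ss0 _; exact: ltW.
    by move=> /(sup_upper_bound supE); rewrite leNgt s0r.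
  rewrite (ltW Xs) andbT.
  have nEs : ~ E s by move=> [_]; rewrite leNgt Xs.
  have s0s : s0 <= s.
    apply: sup_le_ub => // s' Es'; rewrite leNgt; apply/negP => ss'.
    by apply: nEs; apply: Edown Es' sp (ltW ss').
  rewrite leNgt; apply/negP => phiZ.
  have [phis0|phisp] := leP (phi s) 0.
    have := Ene => -[s' Es'].
    have s's : s' <= s by apply: le_trans s0s; apply: sup_upper_bound.
    have h1 := phim s' s (proj1 Es') s's.
    have h2 := lt_le_trans (exprn_gt0 a (proj1 Es')) (proj2 Es').
    by have := lt_le_trans h2 (le_trans h1 phis0); rewrite ltxx.
  have [r r0 rE] := rootP _ phisp.
  have rs0 : r < s0.
    by rewrite -(@ltr_pXn2r _ a) ?nnegrE ?(ltW r0)// rE.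
  have [s' Es' rs'] := sup_gt Ene rs0.
  have s's : s' <= s by apply: le_trans s0s; apply: sup_upper_bound.
  have h1 := phim s' s (proj1 Es') s's.
  have h2 := proj2 Es'.
  have h3 : r ^+ a < s' ^+ a.
    by rewrite ltr_pXn2r// ?nnegrE ltW// (proj1 Es').
  by have := lt_le_trans h3 (le_trans h2 h1); rewrite rE ltxx.
have mpow : measurable_fun setT (fun s : mR => (phi s `^ b : mR)).
  exact: (measurableT_comp (@measurable_powR R b) mphi).
have mw := @measurable_wexp R.
have : (\int[mu]_s ((wexp s)%:E * (phi s `^ b + K * s ^+ a)%:E) <=
        \int[mu]_s ((wexp s)%:E * (s ^+ d + K * phi s)%:E))%E.
  apply: le_integral_ge0 => s; rewrite /wexp; have [s0|s0] := ltP 0 s; rewrite ?mul0r ?mul0e//.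
    rewrite mul1r -EFinM lee_fin mulr_ge0 ?expR_ge0//.
    by rewrite addr_ge0 ?powR_ge0// mulr_ge0// exprn_ge0// ltW.
  by rewrite mul1r -!EFinM lee_fin ler_pM2l ?expR_gt0// key.
have lin (u v : mR -> R) (c : R) : 0 <= c -> measurable_fun setT (u : mR -> mR) ->
    measurable_fun setT (v : mR -> mR) ->
    (forall s, 0 < s -> 0 <= u s) -> (forall s, 0 < s -> 0 <= v s) ->
    (\int[mu]_s ((wexp s)%:E * (u s + c * v s)%:E) =
     \int[mu]_s ((wexp s)%:E * (u s)%:E) + c%:E * \int[mu]_s ((wexp s)%:E * (v s)%:E))%E.
  move=> c0 mu' mv u0 v0.
  have w0 (k : mR -> R) : (forall s, 0 < s -> 0 <= k s) ->
      forall s, (0 <= (wexp s)%:E * (k s)%:E)%E.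
    move=> k0 s; rewrite /wexp -EFinM lee_fin; have [s0|s0] := ltP 0 s; last by rewrite !mul0r.
    by rewrite mul1r mulr_ge0 ?expR_ge0// k0.
  have mwk (k : mR -> R) : measurable_fun setT (k : mR -> mR) ->
      measurable_fun setT (fun s : mR => ((wexp s)%:E * (k s)%:E)%E).
    by move=> mk; apply: emeasurable_funM; exact/measurable_EFinP.
  rewrite -ge0_integralZl//; [|exact: mwk|by move=> s _; exact: w0].
  rewrite -ge0_integralD//; last 4 first.
  - by move=> s _; exact: w0.
  - exact: mwk.
  - by move=> s _; rewrite mule_ge0 ?lee_fin//; exact: w0.
  - by apply: emeasurable_funM; [exact: measurable_cst|exact: mwk].
  by apply: eq_integral => s _; rewrite -!EFinM -EFinD; congr _%:E; ring.
have mX k : measurable_fun setT (fun s : mR => (s ^+ k : mR)) by exact: exprn_measurable.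
have X0 k (s : R) : 0 < s -> 0 <= s ^+ k by move=> s0; rewrite exprn_ge0// ltW.
rewrite (lin (fun s => phi s `^ b) (fun s => s ^+ a))//; [|by move=> s _; exact: powR_ge0|exact: X0].
rewrite (lin (fun s => s ^+ d) phi)//; last exact: X0.
rewrite !integral_wexpX.
set I := (\int[mu]_s _)%E; set J := (\int[mu]_s _)%E in phia *.
have J0 : (0 <= J)%E.
  apply: integral_ge0 => s _; rewrite -EFinM lee_fin mulr_ge0//.
  exact: wexp_ge0.
move=> h; have {}h : (I + (K * a`!%:R)%:E <= d`!%:R%:E + (K * a`!%:R)%:E)%E.
  rewrite EFinM; apply: le_trans h _; rewrite leeD2l// lee_wpmul2l ?lee_fin//.
  exact: ltW.
by move: h; rewrite leeD2rE.
Qed.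

End berwald.

(** * Hölder and Finner inequalities *)

Section hoelder_finner.
Context {R : realType}.
Local Notation mR := (measurableTypeR R).
Local Notation mu := (@lebesgue_measure R).

Lemma powR_limit1 (X Z c a : R) : 0 <= a -> 0 <= Z -> 0 <= c ->
  (forall v, c < v -> X <= Z * v `^ a) -> X <= Z * c `^ a.
Proof.
move=> a0 Z0 c0 h.
move: a0; rewrite le_eqVlt => /orP[/eqP a0|a0].
  by have := h (c + 1); rewrite -a0 !powRr0 ltrDl ltr01 => /(_ isT).
move: Z0; rewrite le_eqVlt => /orP[/eqP Z0|Z0].
  by have := h (c + 1); rewrite -Z0 !mul0r ltrDl ltr01 => /(_ isT).
rewrite leNgt; apply/negP => XZ.
have XZ0 : c `^ a < X / Z by rewrite ltr_pdivlMr// mulrC.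
have X0 : 0 < X / Z by apply: le_lt_trans XZ0; exact: powR_ge0.
pose w := (X / Z) `^ a^-1.
have wE : w `^ a = X / Z by rewrite /w -powRrM mulVf ?gt_eqF// powRr1// ltW.
have cw : c < w.
  rewrite ltNge; apply/negP => wc; move: XZ0; rewrite -wE ltNge => /negP; apply.
  by apply: ge0_ler_powR; rewrite ?nnegrE ?powR_ge0// ltW.
pose v := (c + w) / 2.
have cv : c < v by rewrite /v; lra.
have vw : v < w by rewrite /v; lra.
have := h v cv; rewrite leNgt => /negP; apply.
rewrite mulrC -ltr_pdivlMr// -wE.
by apply: gt0_ltr_powR; rewrite ?nnegrE ?powR_ge0// ltW// (le_lt_trans c0).
Qed.

(** Strict upper bounds of the factors are used wherever a division by
    possibly vanishing factors would be needed; this recovers the sharp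
    inequality. *)
Lemma powR_limit (I : finType) (P : pred I) (a c : I -> R) (X : R) :
  (forall i, 0 <= a i) -> (forall i, 0 <= c i) ->
  (forall c' : I -> R, (forall i, c i < c' i) -> X <= \prod_(i | P i) c' i `^ a i) ->
  X <= \prod_(i | P i) c i `^ a i.
Proof.
move=> a0 c0 h.
suff gen (r : seq I) (Y : R) : uniq r -> 0 <= Y ->
    (forall c' : I -> R, (forall i, c i < c' i) ->
       X <= Y * \prod_(i <- r | P i) c' i `^ a i) ->
    X <= Y * \prod_(i <- r | P i) c i `^ a i.
  rewrite -[leRHS]mul1r; apply: gen => //; first exact: index_enum_uniq.
  by move=> c' cc'; rewrite mul1r; exact: h.
elim: r Y => [Y _ _ hY|i r IH Y /andP[ir ur] Y0 hY].
  have := hY (fun i => c i + 1); rewrite !big_nil; apply => i.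
  by rewrite ltrDl.
rewrite big_cons; case: ifPn => Pi; last first.
  by apply: IH => // c' cc'; have := hY c' cc'; rewrite big_cons (negbTE Pi).
rewrite [_ `^ _ * _]mulrC mulrA; apply: powR_limit1 => //.
  by rewrite mulr_ge0// prodr_ge0// => j _; exact: powR_ge0.
move=> v cv; rewrite -mulrA [_ * v `^ _]mulrC mulrA.
apply: IH => //; first by rewrite mulr_ge0// powR_ge0.
move=> c' cc'; have := hY (fun k => if k == i then v else c' k).
rewrite big_cons Pi eqxx mulrA.
rewrite (_ : \prod_(k <- r | P k) _ = \prod_(k <- r | P k) c' k `^ a k); last first.
  rewrite big_seq_cond [RHS]big_seq_cond; apply: eq_bigr => k /andP[kr _].
  by case: eqP => // ki; rewrite -ki kr in ir.
by apply => k; case: eqP => [->|].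
Qed.

(** The weighted inequality of means for [f i] divided by a number [c' i]
    slightly larger than its integral; then [c' i] decreases to the integral.
    *)
Lemma hoelder_multi (I : finType) (P : pred I) (a : I -> R) (f : I -> mR -> R) :
  (forall i, 0 <= a i) -> \sum_(i | P i) a i = 1 ->
  (forall i, measurable_fun setT (f i : mR -> mR)) ->
  (forall i r, 0 <= f i r) ->
  (forall i, P i -> (\int[mu]_r (f i r)%:E < +oo)%E) ->
  (\int[mu]_r (\prod_(i | P i) f i r `^ a i)%:E <=
   (\prod_(i | P i) fine (\int[mu]_r (f i r)%:E) `^ a i)%:E)%E.
Proof.
move=> a0 a1 mf f0 foo.
pose J i := (\int[mu]_r (f i r)%:E)%E.
have J0 i : (0 <= J i)%E by apply: integral_ge0 => r _; rewrite lee_fin.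
have JE i : P i -> J i = (fine (J i))%:E.
  by move=> Pi; rewrite fineK// ge0_fin_numE//; exact: foo.
have key (c' : I -> R) : (forall i, fine (J i) < c' i) ->
    (\int[mu]_r (\prod_(i | P i) f i r `^ a i)%:E <= (\prod_(i | P i) c' i `^ a i)%:E)%E.
  move=> Jc.
  have c0 i : 0 < c' i by apply: le_lt_trans (Jc i); exact: fine_ge0.
  have C0 : 0 <= \prod_(i | P i) c' i `^ a i.
    by apply: prodr_ge0 => i _; exact: powR_ge0.
  apply: (@le_trans _ _ (\int[mu]_r ((\prod_(i | P i) c' i `^ a i)%:E *
     \sum_(i <- [seq i <- index_enum I | P i]) (a i / c' i)%:E * (f i r)%:E))%E).
    apply: le_integral_ge0 => r.
      by rewrite lee_fin prodr_ge0// => i _; exact: powR_ge0.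
    rewrite big_filter; under [X in (_ * X)%E]eq_bigr do rewrite -EFinM.
    rewrite sumEFin -EFinM lee_fin.
    have -> : \prod_(i | P i) f i r `^ a i =
        (\prod_(i | P i) c' i `^ a i) * \prod_(i | P i) (f i r / c' i) `^ a i.
      rewrite -big_split; apply: eq_bigr => i _ /=.
      rewrite -powRM ?divr_ge0 ?(ltW (c0 i))//.
      by rewrite [c' i * _]mulrC divfK// gt_eqF.
    rewrite ler_wpM2l//; under [leRHS]eq_bigr do rewrite mulrAC -mulrA.
    by apply: amgm => // i _; rewrite divr_ge0// ltW.
  have mterm i : measurable_fun setT (fun r : mR => ((a i / c' i)%:E * (f i r)%:E)%E).
    under eq_fun do rewrite -EFinM.
    by apply/measurable_EFinP; apply: measurable_funM => //; exact: mf.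
  have term0 i r : (0 <= (a i / c' i)%:E * (f i r)%:E)%E.
    by rewrite mule_ge0 ?lee_fin ?divr_ge0 ?(ltW (c0 i)).
  rewrite ge0_integralZl//; last 2 first.
  - exact: emeasurable_sum.
  - by move=> r _; apply: sume_ge0.
  rewrite ge0_integral_sum//.
  rewrite -[leRHS]mule1; apply: lee_wpmul2l; first by rewrite lee_fin.
  rewrite big_filter -a1 -sumEFin; apply: lee_sum => i Pi.
  rewrite ge0_integralZl//; last 3 first.
  - by apply/measurable_EFinP; exact: mf.
  - by move=> r _; rewrite lee_fin.
  - by rewrite lee_fin divr_ge0 ?(ltW (c0 i)).
  rewrite -/(J i) JE// -EFinM lee_fin -mulrA ler_piMr//.
  by rewrite mulrC ler_pdivrMr// mul1r ltW.
have X0 : (0 <= \int[mu]_r (\prod_(i | P i) f i r `^ a i)%:E)%E.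
  by apply: integral_ge0 => r _; rewrite lee_fin prodr_ge0// => i _; exact: powR_ge0.
have Xfin : (\int[mu]_r (\prod_(i | P i) f i r `^ a i)%:E)%E \is a fin_num.
  rewrite ge0_fin_numE//; apply: le_lt_trans (key (fun i => fine (J i) + 1) _) _.
    by move=> i; rewrite ltrDl.
  by rewrite ltry.
rewrite -(fineK Xfin) lee_fin; apply: powR_limit => //.
  by move=> i; exact: (fine_ge0 (J0 i)).
by move=> c' Jc; rewrite -lee_fin (fineK Xfin); exact: key.
Qed.

Lemma measurable_prod_pred (I : finType) (P : pred I) (h : I -> mR -> R) :
  (forall i, measurable_fun setT (h i : mR -> mR)) ->
  measurable_fun setT (fun r : mR => (\prod_(i | P i) h i r : mR)).
Proof.
move=> mh; elim: (index_enum I) => [|i s IH].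
  by under eq_fun do rewrite big_nil; exact: measurable_cst.
under eq_fun do rewrite big_cons; case: (P i) => //.
exact: (measurable_funM (mh i) IH).
Qed.

Context {n : nat}.
Local Notation T := (n.-tuple mR).
Implicit Types (x y z : T) (i : 'I_n) (F G : T -> \bar R) (l : seq 'I_n).

Lemma iint_ge0 l F : (forall x, 0 <= F x)%E -> forall x, (0 <= iint l F x)%E.
Proof. by move=> F0; elim: l => //= i l IH x; exact: integral_ge0. Qed.

(** One coordinate [i] at a time: the factors that do not depend on [i] are
    constant, and the exponents of the others add up to 1, so that Hoelder's
    inequality applies to them. *)
Lemma finner m (A : 'I_m -> {set 'I_n}) (q : 'I_m -> R) (g : 'I_m -> T -> \bar R) l :
  uniq l -> (forall j, 0 <= q j) ->
  (forall i, i \in l -> \sum_(j | i \in A j) q j = 1) ->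
  (forall j, nnm (g j)) ->
  (forall j i, i \in l -> i \notin A j -> indep i (g j)) ->
  (forall j k x, (iint [seq i <- drop k l | i \in A j] (g j) x < +oo)%E) ->
  forall x, (iint l (fun x => (\prod_j fine (g j x) `^ q j)%:E) x <=
    (\prod_j fine (iint [seq i <- l | i \in A j] (g j) x) `^ q j)%:E)%E.
Proof.
move=> + q0 + ng; elim: l => [//|i l IH] /andP[il ul] q1 ig goo x.
pose h j x := fine (iint [seq i <- l | i \in A j] (g j) x).
have goo' j y : (iint [seq i <- l | i \in A j] (g j) y < +oo)%E.
  by have := goo j 1%N y; rewrite drop1.
have nh j : nnm (iint [seq i <- l | i \in A j] (g j)) by exact: nnm_iint.
have h0 j y : 0 <= h j y by rewrite fine_ge0//; exact: (nh j).2.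
have hE j y : (h j y)%:E = iint [seq i <- l | i \in A j] (g j) y.
  by rewrite fineK// ge0_fin_numE//; exact: (nh j).2.
have {}IH := IH ul (fun k kl => q1 k (mem_behead (s := i :: l) kl))
  (fun j k kl => ig j k (mem_behead (s := i :: l) kl)) (fun j k => goo j k.+1).
apply: (@le_trans _ _ (int1 i (fun y => (\prod_j h j y `^ q j)%:E) x)).
  apply: le_int1 => //; apply: iint_ge0 => y; rewrite lee_fin.
  by apply: prodr_ge0 => j _; exact: powR_ge0.
rewrite [X in (_ <= X%:E)%E](bigID (fun j => i \in A j))/=.
have C0 : 0 <= \prod_(j | i \notin A j) h j x `^ q j.
  by apply: prodr_ge0 => j _; exact: powR_ge0.
have mhj j : measurable_fun setT (fun r : mR => (h j (upd x i r) : mR)).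
  apply: (measurableT_comp (fine_measurable measurableT)) => //.
  exact: nnm_upd.
have -> : int1 i (fun y => (\prod_j h j y `^ q j)%:E) x =
    (\int[mu]_r ((\prod_(j | i \notin A j) h j x `^ q j)%:E *
       (\prod_(j | i \in A j) h j (upd x i r) `^ q j)%:E))%E.
  apply: eq_integral => r _; rewrite -EFinM; congr (_%:E).
  rewrite (bigID (fun j => i \in A j))/= mulrC; congr (_ * _).
  apply: eq_bigr => j iA; rewrite /h indep_iint//.
  by apply: ig => //; exact: mem_head.
rewrite ge0_integralZl//; last 2 first.
- apply/measurable_EFinP; apply: measurable_prod_pred => j.
  exact: (measurableT_comp (@measurable_powR R (q j)) (mhj j)).
- by move=> r _; rewrite lee_fin prodr_ge0// => j _; exact: powR_ge0.
rewrite mulrC EFinM; apply: lee_pmul => //.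
- by apply: integral_ge0 => r _; rewrite lee_fin prodr_ge0// => j _; exact: powR_ge0.
- rewrite lee_fin le_eqVlt; apply/orP; left; apply/eqP; apply: eq_bigr => j iA.
  by rewrite (negbTE iA).
have E j : i \in A j -> (\int[mu]_r (h j (upd x i r))%:E)%E =
    iint [seq i <- i :: l | i \in A j] (g j) x.
  by move=> iA; rewrite /= iA; apply: eq_integral => r _; rewrite hE.
apply: le_trans (hoelder_multi _ _ _ _ _) _ => //.
- by apply: q1; exact: mem_head.
- by move=> j iA; rewrite E//; have := goo j 0%N x; rewrite drop0.
rewrite lee_fin le_eqVlt; apply/orP; left; apply/eqP; apply: eq_bigr => j iA.
by rewrite E.
Qed.

Local Open Scope ereal_scope.

Lemma iint_eq0 l F x : (forall y, (forall j, j \notin l -> tnth y j = tnth x j) -> F y = 0) ->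
  iint l F x = 0.
Proof.
elim: l x => [|i l IH] x h; first by apply: h.
apply: integral0_eq => r _; apply: IH => y yx; apply: h => j.
by rewrite inE negb_or => /andP[ji jl]; rewrite yx// tnth_upd (negbTE ji).
Qed.

Lemma iint_bounded l F (N c : R) : uniq l -> (0 <= N)%R -> (0 <= c)%R ->
  (forall x, 0 <= F x <= N%:E) ->
  (forall x i, i \in l -> (c < `|tnth x i|)%R -> F x = 0) ->
  forall x, iint l F x <= (N * (2 * c) ^+ size l)%:E.
Proof.
move=> + N0 c0 FN; elim: l => [_ _ x|i l IH /andP[il ul] Fz x].
  by rewrite expr0 mulr1; have /andP[] := FN x.
have F0 y : 0 <= F y by have /andP[] := FN y.
have {}IH := IH ul (fun y j jl => Fz y j (mem_behead (s := i :: l) jl)).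
set K := (N * (2 * c) ^+ size l)%R in IH.
have K0 : (0 <= K)%R by rewrite mulr_ge0// exprn_ge0// mulr_ge0.
apply: (@le_trans _ _ (\int[mu]_r (K%:E * (\1_(`[(- c)%R, c]%classic : set mR) r)%:E))).
  apply: le_integral_ge0 => r; first exact: iint_ge0.
  rewrite indicE; case: (boolP (r \in _)) => [_|].
    by rewrite mule1; exact: IH.
  rewrite notin_setE/= in_itv/= -ler_norml => /negP; rewrite -ltNge => cr.
  rewrite mule0 -[leLHS]/(iint l F (upd x i r)) iint_eq0// => y yx; apply: (Fz y i); first exact: mem_head.
  by rewrite yx// tnth_upd eqxx.
rewrite ge0_integralZl//; last first.
  by apply/measurable_EFinP; apply: measurable_indic; exact: measurable_itv.
rewrite integral_indic//.
rewrite setIT /= lebesgue_measure_itv/= lte_fin.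
rewrite exprS mulrCA [leRHS]EFinM -/K [leRHS]muleC; apply: lee_wpmul2l; first by rewrite lee_fin.
case: ifP => _; last by rewrite lee_fin mulr_ge0.
by rewrite opprK -EFinD lee_fin mulr_natl mulr2n.
Qed.

Section param.
Variable K : T * mR -> \bar R.
Hypotheses (mK : measurable_fun setT K) (K0 : forall w : T * mR, 0 <= K w).

Lemma measurable_iint_param l :
  measurable_fun setT (fun z : T * mR => iint l (fun x => K (x, z.2)) z.1).
Proof.
elim: l => [|i l IH] /=.
  by apply: eq_measurable_fun mK => -[].
apply: (measurable_fun_fubini_tonelli_F (m2 := mu)
  (fun w : (T * mR) * mR => iint l (fun x => K (x, w.1.2)) (upd w.1.1 i w.2))).
  apply: (@measurableT_comp _ _ _ _ _ _
    (fun z : T * mR => iint l (fun x => K (x, z.2)) z.1) _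
    (fun w : (T * mR) * mR => (upd w.1.1 i w.2, w.1.2))) => //.
  apply: measurable_fun_pair; last first.
    exact: (measurableT_comp measurable_snd measurable_fst).
  apply: (measurableT_comp (measurable_upd i)
     (g := fun w : (T * mR) * mR => (w.1.1, w.2))).
  apply: measurable_fun_pair; last exact: measurable_snd.
  exact: (measurableT_comp measurable_fst measurable_fst).
by move=> w; exact: iint_ge0.
Qed.

(** Tonelli's theorem, for an iterated integral and one more parameter. *)
Lemma iint_integral l x :
  iint l (fun x => \int[mu]_s K (x, s)) x = \int[mu]_s iint l (fun x => K (x, s)) x.
Proof.
elim: l x => //= i l IH x; rewrite /int1; under eq_integral do rewrite IH.
apply: (fubini_tonelli (m1 := mu) (m2 := mu)
  (fun w : mR * mR => iint l (fun x => K (x, w.2)) (upd x i w.1))).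
  apply: (@measurableT_comp _ _ _ _ _ _
    (fun z : T * mR => iint l (fun x => K (x, z.2)) z.1) _
    (fun w : mR * mR => (upd x i w.1, w.2))); first exact: measurable_iint_param.
  apply: measurable_fun_pair; last exact: measurable_snd.
  exact: (measurableT_comp (measurable_upd2 x i) measurable_fst).
by move=> w; exact: iint_ge0.
Qed.

Lemma measurable_iint_param2 l x :
  measurable_fun setT (fun s : mR => iint l (fun x => K (x, s)) x).
Proof.
apply: (@measurableT_comp _ _ _ _ _ _
    (fun z : T * mR => iint l (fun x => K (x, z.2)) z.1) _ (pair x)) => //.
exact: measurable_iint_param.
Qed.
End param.

End hoelder_finner.

(** * The inequality for coordinate marginals *)

Section zeroing.
Context {R : realType} {n : nat}.
Local Notation mR := (measurableTypeR R).
Local Notation T := (n.-tuple mR).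
Implicit Types (x y : T) (i : 'I_n) (F G : T -> \bar R) (A B : {set 'I_n}).
Local Open Scope ereal_scope.

Definition origin : T := [tuple 0%R | _ < n].
Definition zero_on B x : T := [tuple (if j \in B then 0%R else tnth x j) | j < n].

Lemma zero_on_origin B : zero_on B origin = origin.
Proof. by apply: eq_from_tnth => j; rewrite !tnth_mktuple; case: ifP. Qed.

Lemma zero_on_upd_in B x i r : i \in B -> zero_on B (upd x i r) = zero_on B x.
Proof.
move=> iB; apply: eq_from_tnth => j; rewrite !tnth_mktuple.
by case: (eqVneq j i) => [->|//]; rewrite iB.
Qed.

Lemma zero_on_dilate B x (a : R) : zero_on B (dilate a x) = dilate a (zero_on B x).
Proof.
by apply: eq_from_tnth => j; rewrite !tnth_mktuple; case: ifP; rewrite ?mulr0.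
Qed.

Lemma comb_origin (t : R) x : comb t x origin = dilate t x.
Proof. by apply: eq_from_tnth => j; rewrite !tnth_mktuple mulr0 addr0. Qed.

Lemma dilate_origin (t : R) : dilate t origin = origin.
Proof. by apply: eq_from_tnth => j; rewrite !tnth_mktuple mulr0. Qed.

Lemma measurable_zero_on B : measurable_fun setT (zero_on B).
Proof.
apply/measurable_fun_tnthP => j.
rewrite (_ : _ \o _ = fun x => if j \in B then 0%R else tnth x j); last first.
  by apply/funext => x /=; rewrite tnth_mktuple.
by case: (j \in B); [exact: measurable_cst|exact: measurable_tnth].
Qed.

Lemma le_zero_on (S B : {set 'I_n}) F : (forall i, i \in S -> zdec i F) -> B \subset S ->
  forall x, F x <= F (zero_on B x).
Proof.
move=> zF BS x.
pose zl l := foldr (fun i y => upd y i 0%R) x l.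
have zlE l j : tnth (zl l) j = if j \in l then 0%R else tnth x j.
  by elim: l => //= i l IH; rewrite tnth_upd inE; case: eqP.
have -> : zero_on B x = zl (enum B).
  by apply: eq_from_tnth => j; rewrite zlE tnth_mktuple mem_enum.
have : {subset enum B <= S} by move=> i; rewrite mem_enum => /(fintype.subsetP BS).
elim: (enum B) => //= i l IH lS.
apply: (@le_trans _ _ (F (zl l))).
  by apply: IH => j jl; apply: lS; rewrite inE jl orbT.
by apply: zF; apply: lS; exact: mem_head.
Qed.

Lemma dsyms_le_cst l G (N : R) : (forall x, G x <= N%:E) -> forall x, dsyms l G x <= N%:E.
Proof.
move=> GN; elim: l => //= i l IH x; apply: ge_ereal_sup => _ [a _ <-].
by rewrite ge_min IH.
Qed.

(** Difference sets of subsets of [-c, c] lie in [-2c, 2c]. *)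
Lemma dsyms_support l G (c : R) : uniq l -> (0 <= c)%R ->
  (forall x, 0 < G x -> forall i, (`|tnth x i| <= c)%R) ->
  forall x, 0 < dsyms l G x -> forall i, (`|tnth x i| <= if i \in l then 2 * c else c)%R.
Proof.
move=> + c0 Gc; elim: l => // k l IH /andP[kl ul] x /= /dsym_gt[a h1 h2] i.
rewrite inE; case: (eqVneq i k) => [->|ik] /=.
  have := IH ul _ h1 k; have := IH ul _ h2 k.
  rewrite (negbTE kl) !tnth_upd eqxx => h3 h4.
  have -> : tnth x k = ((a + tnth x k) - a)%R by rewrite addrC addKr.
  by apply: le_trans (ler_normB _ _) _; rewrite mulr_natl mulr2n lerD.
by have := IH ul _ h1 i; rewrite tnth_upd (negbTE ik).
Qed.

(** Where the symmetrized coordinates vanish, the supremum in the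
    symmetrization runs over all values of these coordinates. *)
Lemma le_dsyms_zero l G x y : uniq l -> (forall j, j \notin l -> tnth x j = tnth y j) ->
  (forall j, j \in l -> tnth x j = 0%R) -> G y <= dsyms l G x.
Proof.
elim: l x => [|i l IH] x /=.
  move=> _ xy _; rewrite (_ : x = y)//; apply: eq_from_tnth => j; exact: xy.
move=> /andP[il ul] xy x0.
apply: (@le_trans _ _ (dsyms l G (upd x i (tnth y i)))).
  apply: IH => // j jl; rewrite tnth_upd; have [ji|ji] := eqVneq j i.
  - by rewrite ji.
  - by apply: xy; rewrite inE negb_or ji.
  - by rewrite -ji jl in il.
  - by apply: x0; rewrite inE jl orbT.
apply: ereal_sup_ubound; exists (tnth y i) => //.
by rewrite (x0 i) ?mem_head// addr0 minxx.
Qed.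

Lemma perm_filter_enum (A S : {set 'I_n}) : A \subset S ->
  perm_eq [seq i <- enum S | i \in A] (enum A).
Proof.
move=> AS; apply: uniq_perm; [exact/filter_uniq/enum_uniq|exact: enum_uniq|move=> i].
by rewrite mem_filter !mem_enum; case: (boolP (i \in A)) => // /(fintype.subsetP AS).
Qed.

(** Monotonicity of iterated integrals with two different base points; the
    functions are only compared at points reached by the integration. *)
Lemma iint_le_rel l F G x y : (forall z, 0 <= F z) ->
  (forall z w, (forall j, j \notin l -> tnth z j = tnth x j) ->
     (forall j, j \notin l -> tnth w j = tnth y j) ->
     (forall j, j \in l -> tnth z j = tnth w j) -> F z <= G w) ->
  iint l F x <= iint l G y.
Proof.
move=> F0; elim: l x y => [|i l IH] x y h.
  by apply: h.
apply: le_integral_ge0 => r; first exact: iint_ge0.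
apply: IH => z w zx wy zw; apply: h.
- move=> j; rewrite inE negb_or => /andP[ji jl].
  by rewrite zx// tnth_upd (negbTE ji).
- move=> j; rewrite inE negb_or => /andP[ji jl].
  by rewrite wy// tnth_upd (negbTE ji).
- move=> j; rewrite inE; case: (boolP (j \in l)) => [jl _|jl]; first exact: zw.
  by rewrite orbF => /eqP ji; rewrite zx// wy// ji !tnth_upd eqxx.
Qed.

Lemma iint_eq_rel l F G x y :
  (forall z w, (forall j, j \notin l -> tnth z j = tnth x j) ->
     (forall j, j \notin l -> tnth w j = tnth y j) ->
     (forall j, j \in l -> tnth z j = tnth w j) -> F z = G w) ->
  iint l F x = iint l G y.
Proof.
elim: l x y => [|i l IH] x y h; first exact: h.
apply: eq_integral => r _; apply: IH => z w zx wy zw; apply: h.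
- move=> j; rewrite inE negb_or => /andP[ji jl].
  by rewrite zx// tnth_upd (negbTE ji).
- move=> j; rewrite inE negb_or => /andP[ji jl].
  by rewrite wy// tnth_upd (negbTE ji).
- move=> j; rewrite inE; case: (boolP (j \in l)) => [jl _|jl]; first exact: zw.
  by rewrite orbF => /eqP ji; rewrite zx// wy// ji !tnth_upd eqxx.
Qed.

End zeroing.

Section core.
Context {R : realType} {n : nat}.
Local Notation mR := (measurableTypeR R).
Local Notation mu := (@lebesgue_measure R).
Local Notation T := (n.-tuple mR).
Implicit Types (x y : T) (i : 'I_n) (F : T -> \bar R) (A B : {set 'I_n}).
Variables (S : {set 'I_n}) (G : T -> \bar R) (N c : R).
Hypotheses (N0 : 0 <= N) (c0 : 0 <= c) (rG : reg G).
Hypothesis GN : forall x, (G x <= N%:E)%E.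
Hypothesis Gc : forall x, (0 < G x)%E -> forall i, `|tnth x i| <= c.
Local Open Scope ereal_scope.

(** The integral of the projection of [G] along the coordinates in [S :\: A].
    *)
Definition marg A := iint (enum (A :|: ~: S)) (msup (S :\: A) G) origin.

(** The symmetrization of [G], integrated over the directions outside [S]: it
    depends on the coordinates in [S] only, is log-concave, and is largest at
    the origin. *)
Definition symG := iint (enum (~: S)) (dsyms (enum S) G).
Definition sect A x := symG (zero_on (S :\: A) x).
(** The integral of [symG] over the coordinate subspace of [A]. *)
Definition isect A := iint (enum A) (sect A) origin.

Let rD : reg (dsyms (enum S) G). Proof. exact: reg_dsyms. Qed.
Let nD : nnm (dsyms (enum S) G). Proof. exact: reg_nnm. Qed.

Lemma nnm_symG : nnm symG. Proof. exact: nnm_iint. Qed.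

Lemma lcv_symG : lcv symG.
Proof. by have [_ lD _] := rD; exact: lcv_iint. Qed.

Lemma symG_agree x y : (forall i, i \in S -> tnth x i = tnth y i) -> symG x = symG y.
Proof.
move=> xy; apply: iint_agree => j; rewrite mem_enum inE negbK; exact: xy.
Qed.

Lemma zdec_symG i : i \in S -> zdec i symG.
Proof.
move=> iS; apply: zdec_iint => //; first by rewrite mem_enum inE iS.
by apply: zdec_dsyms => //; rewrite mem_enum.
Qed.

Lemma symG_support x i : i \in S -> (2 * c < `|tnth x i|)%R -> symG x = 0.
Proof.
move=> iS xi; apply: iint_eq0 => y yx; apply/eqP; rewrite eq_le nD.2 andbT leNgt.
apply/negP => /(dsyms_support (enum_uniq _) c0 Gc)/(_ i).
by rewrite mem_enum iS yx ?mem_enum ?inE ?iS// leNgt xi.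
Qed.

Lemma symG_origin_ub x : symG x <= symG origin.
Proof.
apply: le_trans (le_zero_on zdec_symG (fintype.subxx S) x) _.
by rewrite (@symG_agree _ origin)// => i iS; rewrite !tnth_mktuple iS.
Qed.

Lemma symG_origin_fin : symG origin < +oo.
Proof.
apply: (le_lt_trans (iint_bounded (N := N) (c := c) (enum_uniq _) N0 c0 _ _ _)); last exact: ltry.
  by move=> x; rewrite nD.2 dsyms_le_cst.
move=> x i; rewrite mem_enum inE => iS xi; apply/eqP; rewrite eq_le nD.2 andbT leNgt.
apply/negP => /(dsyms_support (enum_uniq _) c0 Gc)/(_ i).
by rewrite mem_enum (negbTE iS) leNgt xi.
Qed.

Lemma nnm_sect A : nnm (sect A).
Proof.
split=> [|x]; last exact: nnm_symG.2.
exact: (measurableT_comp nnm_symG.1 (measurable_zero_on (S :\: A))).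
Qed.

Lemma sect_support A x i : A \subset S -> i \in A -> (2 * c < `|tnth x i|)%R ->
  sect A x = 0.
Proof.
move=> AS iA xi; apply: (symG_support (i := i)); first exact: (fintype.subsetP AS).
by rewrite tnth_mktuple inE iA.
Qed.

Lemma isect_fin A : A \subset S -> isect A < +oo.
Proof.
move=> AS; have B0 : (0 <= fine (symG origin))%R by rewrite fine_ge0// nnm_symG.2.
have c20 : (0 <= 2 * c)%R by rewrite mulr_ge0.
apply: (le_lt_trans (iint_bounded (N := fine (symG origin)) (c := (2 * c)%R) (enum_uniq _) B0 c20 _ _ _)); last exact: ltry.
  move=> x; rewrite (nnm_sect A).2 fineK; first exact: symG_origin_ub.
  by rewrite ge0_fin_numE ?symG_origin_fin// nnm_symG.2.
by move=> x i; rewrite mem_enum => iA; exact: sect_support.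
Qed.

Lemma isect_ge0 A : 0 <= isect A.
Proof. by apply: iint_ge0; exact: (nnm_sect A).2. Qed.

Lemma isect0 : isect finset.set0 = symG origin.
Proof. by rewrite /isect enum_set0 /= /sect zero_on_origin. Qed.

Lemma marg0_le : marg finset.set0 <= isect finset.set0.
Proof.
rewrite isect0 /marg finset.set0U finset.setD0; apply: iint_le_rel.
  by move=> z; apply: msup_ge0; have [] := rG.
move=> z w zo wo zw; apply: ge_ereal_sup => _ [y zy <-].
apply: le_dsyms_zero; first exact: enum_uniq.
  move=> j; rewrite mem_enum => jS; rewrite -zw; first exact: zy.
  by rewrite mem_enum inE.
by move=> j; rewrite mem_enum => jS; rewrite wo ?tnth_mktuple// mem_enum inE jS.
Qed.

Lemma iint_enumU (A : {set 'I_n}) F : A \subset S -> nnm F ->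
  iint (enum (A :|: ~: S)) F = iint (enum (~: S)) (iint (enum A) F).
Proof.
move=> AS nF; rewrite -iint_cat; apply: perm_iint => //.
apply: uniq_perm; first exact: enum_uniq.
  rewrite cat_uniq !enum_uniq andbT /=; apply/hasPn => i; rewrite !mem_enum inE => iA.
  by rewrite negbK; exact: (fintype.subsetP AS).
by move=> i; rewrite mem_cat !mem_enum !inE orbC.
Qed.

(** Each of the symmetrizations doubles the integral. *)
Lemma isectT : isect S = (2 ^+ #|S|)%:E * marg S.
Proof.
have nG := reg_nnm rG.
have -> : marg S = iint (enum (~: S)) (iint (enum S) G) origin.
  rewrite /marg finset.setDv; rewrite -iint_enumU//; congr iint.
  apply/funext => x; apply/eqP; rewrite eq_le; apply/andP; split.
    apply: ge_ereal_sup => _ [y xy <-]; rewrite (_ : x = y)//.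
    by apply: eq_from_tnth => j; apply: xy; rewrite inE.
  exact: msup_ge.
rewrite /isect (_ : sect S = symG); last first.
  apply/funext => x; apply: symG_agree => i iS; rewrite tnth_mktuple.
  by rewrite finset.setDv inE.
rewrite /symG -iint_cat (perm_iint (l' := enum (~: S) ++ enum S))//; last by rewrite perm_catC.
rewrite iint_cat iint_dsyms// iintZl//.
- by rewrite -cardE.
- exact: nnm_iint.
Qed.

(** On the subspace of [A], the symmetrizations along [S :\: A] stay below a
    supremum by [dsyms_le_msup], and those along [A] double the integral. *)
Lemma isect_le A : A \subset S -> isect A <= (2 ^+ #|A|)%:E * marg A.
Proof.
move=> AS; have rM : reg (msup (S :\: A) G) by exact: reg_msup.
pose l := [seq i <- enum S | i \notin S :\: A].
have lE : perm_eq l (enum A).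
  apply: uniq_perm; [exact/filter_uniq/enum_uniq|exact: enum_uniq|move=> i].
  rewrite mem_filter !mem_enum !inE negb_and negbK.
  have := fintype.subsetP AS i; case: (i \in A); case: (i \in S) => //=.
  by move=> /(_ isT).
have sl : size l = #|A| by rewrite (perm_size lE) -cardE.
have -> : (2 ^+ #|A|)%:E * marg A =
    iint (enum A) (iint (enum (~: S)) (dsyms l (msup (S :\: A) G))) origin.
  have rl : reg (dsyms l (msup (S :\: A) G)) by exact: reg_dsyms.
  rewrite -iint_cat (perm_iint (l' := enum (~: S) ++ enum A))//; last first.
  - by rewrite perm_catC.
  - exact: reg_nnm.
  rewrite iint_cat (perm_iint (l := enum A) (l' := l)); last first.
  - by rewrite perm_sym.
  - exact: reg_nnm.
  rewrite iint_dsyms// sl iintZl//; last by apply: nnm_iint; exact: reg_nnm.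
  rewrite (perm_iint (l := l) (l' := enum A))//; last exact: reg_nnm.
  by rewrite /marg iint_enumU//; exact: reg_nnm.
apply: le_iint => [x|x]; first exact: (nnm_sect A).2.
apply: iint_le_rel; first exact: nD.2.
move=> z w zo wo zw; apply: dsyms_le_msup.
- exact: enum_uniq.
- by apply: msup_ge0; have [] := rG.
- by move=> y1 y2 y12; apply: msup_ge => j jA; rewrite y12.
- move=> j jA; have [jS|jS] := boolP (j \in ~: S).
    by apply: zw; rewrite mem_enum.
  rewrite zo ?mem_enum// wo ?mem_enum// tnth_mktuple (negbTE jA)//.
move=> i; rewrite mem_enum => iS iA.
by rewrite zo ?tnth_mktuple ?iA// mem_enum inE iS.
Qed.

Section levels.
Variables (m : nat) (C : 'I_m -> {set 'I_n}) (q : 'I_m -> R).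
Hypotheses (CS : forall j, C j \subset S) (q0 : forall j, (0 < q j)%R).
Hypothesis cover : forall i, i \in S -> (\sum_j q j * (i \in C j)%:R = 1)%R.
Hypothesis B0 : 0 < symG origin.

Let B : R := fine (symG origin).
Let BE : symG origin = B%:E.
Proof. by rewrite /B fineK// ge0_fin_numE ?symG_origin_fin// nnm_symG.2. Qed.
Let Bgt0 : (0 < B)%R.
Proof. by rewrite -lte_fin -BE. Qed.

(** The indicator of the section by the subspace of [A] of the level set of
    [symG] at height e^-s B. *)
Definition lvl A (s : R) x : \bar R := ((expR (- s) * B)%:E < sect A x)%E%:R%:E.

Let lvl01 A s x : 0 <= lvl A s x <= 1.
Proof. by rewrite /lvl; case: (_ < _) => /=; rewrite !lee_fin ?ler01 ?lexx. Qed.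
Let lvl_ge0 A s x : 0 <= lvl A s x. Proof. by have /andP[] := lvl01 A s x. Qed.

Let mlvl A : measurable_fun setT (fun z : T * mR => lvl A z.2 z.1).
Proof.
apply/measurable_EFinP; rewrite (_ : (fun _ => _) =
   \1_([set z : T * mR | (expR (- z.2) * B)%:E < sect A z.1])); last first.
  apply/funext => z; rewrite /= indicE; congr (_%:R); congr nat_of_bool.
  by apply/idP/idP => [h|]; [rewrite mem_set|rewrite inE].
apply: measurable_indic; rewrite -[X in measurable X]setTI; apply: measurable_lte => //.
  apply/measurable_EFinP; apply: measurable_funM; last exact: measurable_cst.
  exact: (measurableT_comp (@measurable_expRN R) measurable_snd).
exact: (measurableT_comp (nnm_sect A).1 measurable_fst).
Qed.

Let nnm_lvl A s : nnm (lvl A s).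
Proof.
split=> [|x]; last exact: lvl_ge0.
exact: (measurableT_comp (mlvl A) (pair2_measurable s)).
Qed.

Let lvl_support A s x i : A \subset S -> i \in A -> (2 * c < `|tnth x i|)%R ->
  lvl A s x = 0.
Proof.
move=> AS iA xi; rewrite /lvl (sect_support AS iA xi) lte_fin ltNge.
by rewrite mulr_ge0 ?expR_ge0 ?ltW.
Qed.

Let iint_lvl_fin A s l x : A \subset S -> uniq l -> {subset l <= A} ->
  iint l (lvl A s) x < +oo.
Proof.
move=> AS ul lA.
have c20 : (0 <= 2 * c)%R by rewrite mulr_ge0.
apply: (le_lt_trans (iint_bounded (N := 1) (c := (2 * c)%R) ul ler01 c20 _ _ _)); last exact: ltry.
  exact: lvl01.
by move=> y i il; apply: lvl_support => //; exact: lA.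
Qed.

Definition lvol A (s : R) : R := fine (iint (enum A) (lvl A s) origin).

Let lvolE A s : A \subset S -> (lvol A s)%:E = iint (enum A) (lvl A s) origin.
Proof.
move=> AS; rewrite fineK// ge0_fin_numE; last exact: (nnm_iint _ (nnm_lvl A s)).2.
by apply: iint_lvl_fin => //; [exact: enum_uniq|move=> i; rewrite mem_enum].
Qed.

Let lvol_ge0 A s : (0 <= lvol A s)%R.
Proof. by rewrite fine_ge0//; exact: (nnm_iint _ (nnm_lvl A s)).2. Qed.

Let measurable_lvol A : measurable_fun setT (lvol A : mR -> mR).
Proof.
apply: (measurableT_comp (fine_measurable measurableT)).
by apply: (measurable_iint_param2 (mlvl A)) => z; exact: lvl_ge0.
Qed.

Let lvol_mono A s s' : A \subset S -> (s <= s')%R -> (lvol A s <= lvol A s')%R.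
Proof.
move=> AS ss'; rewrite -lee_fin !lvolE//; apply: le_iint => x //.
rewrite /lvl lee_fin ler_nat; case: (ltP _ (sect A x)) => //= h.
rewrite (_ : _ < _)//; apply: le_lt_trans h; rewrite lee_fin ler_pM2r//.
by rewrite ler_expR lerN2.
Qed.

(** Log-concavity between [x] and the origin, where the value is B. *)
Let symG_dilate (th s : R) x : (0 < th < 1)%R -> (expR (- s) * B)%:E < symG x ->
  (expR (- (th * s)) * B)%:E < symG (dilate th x).
Proof.
move=> th01 /exists_between[a' aa' ax]; have [th0 th1] := andP th01.
pose a0 : R := (expR (- s) * B)%R.
have a00 : (0 < a0)%R by rewrite mulr_gt0 ?expR_gt0.
have [a aa0 aa1] : exists2 a : R, (a0 < a)%R & (a < a')%R.
  by exists ((a0 + a') / 2)%R; rewrite /a0; lra.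
have ap : (0 < a)%R by exact: lt_trans aa0.
have a'p : (0 < a')%R by exact: lt_trans aa1.
have u1 : (0 < 1 - th)%R by rewrite subr_gt0.
(* the value at the origin is lowered to B r with r < 1, to be a strict lower
   bound; r is chosen so that the gap between a and a' pays for it *)
pose r : R := ((a / a') `^ (th / (1 - th)))%R.
have r0 : (0 < r)%R by apply: powR_gt0; rewrite divr_gt0.
have r1 : (r < 1)%R.
  have e1 : (1 `^ (th / (1 - th)) = 1 :> R)%R by rewrite powR1.
  rewrite -[ltRHS]e1; apply: gt0_ltr_powR; rewrite ?divr_gt0// ?nnegrE ?divr_ge0 ?ltW//.
  by rewrite ltr_pdivrMr// mul1r.
have := @lcv_symG th x origin a' (B * r)%R th01 a'p (mulr_gt0 Bgt0 r0) ax _.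
rewrite BE lte_fin gtr_pMr// => /(_ r1); rewrite comb_origin; apply: lt_le_trans.
rewrite lte_fin.
have -> : (a' `^ th * (B * r) `^ (1 - th) = a `^ th * B `^ (1 - th))%R.
  rewrite powRM ?(ltW Bgt0) ?(ltW r0)// /r -powRrM divfK ?gt_eqF//.
  rewrite mulrCA mulrC; congr (_ * _)%R.
  by rewrite -powRM ?divr_ge0 ?ltW// mulrC divfK ?gt_eqF.
have -> : (expR (- (th * s)) * B = a0 `^ th * B `^ (1 - th))%R.
  rewrite /a0 powRM ?expR_ge0 ?(ltW Bgt0)// -mulrA powR_conv ?ltW// -expRM.
  by rewrite mulNr [(s * th)%R]mulrC.
rewrite ltr_pM2r ?powR_gt0//; apply: gt0_ltr_powR; rewrite ?nnegrE ?ltW//.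
Qed.

(** The level set for [th * s] contains the image of the level set for [s]
    under the dilation by [th]. *)
Let lvol_dilate A s th : A \subset S -> (0 < th < 1)%R ->
  (th ^+ #|A| * lvol A s <= lvol A (th * s))%R.
Proof.
move=> AS th01; have [th0 _] := andP th01.
rewrite -lee_fin EFinM !lvolE//.
rewrite -[in leRHS](dilate_origin th) -(iint_dilate _ th0 (nnm_lvl A (th * s)%R)) -cardE.
apply: lee_wpmul2l; first by rewrite lee_fin exprn_ge0// ltW.
apply: le_iint => x //=; rewrite /lvl lee_fin ler_nat.
case: (ltP _ (sect A x)) => //= h; rewrite (_ : _ < _)//.
by rewrite /sect zero_on_dilate; apply: symG_dilate.
Qed.

Let lvol_set0 s : (0 < s)%R -> lvol finset.set0 s = 1%R.
Proof.
move=> s0; rewrite /lvol enum_set0 /= /lvl /sect zero_on_origin BE lte_fin.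
by rewrite gtr_pMl// expR_lt1 oppr_lt0 s0.
Qed.

(** The layer-cake formula at heights e^-s B. *)
Lemma isect_lvol A : A \subset S ->
  isect A = B%:E * \int[mu]_s ((wexp s)%:E * (lvol A s)%:E).
Proof.
move=> AS.
have mw : measurable_fun setT (fun z : T * mR => (wexp z.2)%:E * lvl A z.2 z.1).
  apply: emeasurable_funM => //; apply/measurable_EFinP.
  exact: (measurableT_comp (@measurable_wexp R) measurable_snd).
have w0 (z : T * mR) : 0 <= (wexp z.2)%:E * lvl A z.2 z.1.
  by rewrite mule_ge0 ?lee_fin ?wexp_ge0.
have -> : isect A = iint (enum A) (fun x => B%:E * \int[mu]_s ((wexp s)%:E * lvl A s x)) origin.
  congr (iint _ _ _); apply/funext => x.
  have xB : sect A x <= B%:E by rewrite -BE; exact: symG_origin_ub.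
  have x0 : 0 <= sect A x by exact: (nnm_sect A).2.
  have xE : sect A x = (fine (sect A x))%:E.
    by rewrite fineK// ge0_fin_numE// (le_lt_trans xB)// ltry.
  have u01 : 0 <= (fine (sect A x) / B)%:E <= 1.
    apply/andP; split; rewrite lee_fin; first exact: divr_ge0 (fine_ge0 x0) (ltW Bgt0).
    by rewrite ler_pdivrMr// mul1r -lee_fin -xE.
  transitivity (B%:E * (fine (sect A x) / B)%:E).
    by rewrite -EFinM mulrC divfK ?gt_eqF.
  rewrite -(integral_wexp_tail u01); congr (_ * _); apply: eq_integral => s _.
  by rewrite /lvl xE !lte_fin ltr_pdivlMr.
rewrite iintZl ?lee_fin ?(ltW Bgt0)//; last first.
  split=> [|x]; last by apply: integral_ge0 => s _; exact: (w0 (x, s)).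
  exact: (measurable_fun_fubini_tonelli_F (m2 := mu) (fun z : T * mR => (wexp z.2)%:E * lvl A z.2 z.1)).
rewrite (iint_integral mw w0); congr (_ * _); apply: eq_integral => s _.
by rewrite /= lvolE// (iintZl _ (nnm_lvl A s))// lee_fin wexp_ge0.
Qed.

(** Setting coordinates to 0 increases [symG], so the level set for [S] lies
    in each of the cylinders over the level sets for the [C j]; Finner's
    inequality applies to the indicators of these cylinders. *)
Let lvol_finner s : (lvol S s <= \prod_j lvol (C j) s `^ q j)%R.
Proof.
rewrite -lee_fin lvolE ?fintype.subxx//.
have perm j := perm_filter_enum (CS j).
have fin j l x : uniq l -> {subset l <= C j} -> iint l (lvl (C j) s) x < +oo.
  by move=> ul lC; exact: iint_lvl_fin.
have cov i : i \in enum S -> (\sum_(j | i \in C j) q j = 1)%R.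
  rewrite mem_enum => /cover <-; rewrite big_mkcond; apply: eq_bigr => j _.
  by case: (i \in C j); rewrite ?mulr1 ?mulr0.
have ind j i : i \in enum S -> i \notin C j -> indep i (lvl (C j) s).
  rewrite mem_enum => iS iC x r.
  by rewrite /lvl /sect zero_on_upd_in// inE iS iC.
have fin' j k x : iint [seq i <- drop k (enum S) | i \in C j] (lvl (C j) s) x < +oo.
  apply: fin; first exact/filter_uniq/drop_uniq/enum_uniq.
  by move=> i; rewrite mem_filter => /andP[].
have := finner (enum_uniq S) (fun j => ltW (q0 j)) cov (fun j => nnm_lvl (C j) s) ind fin' origin.
move=> h; apply: le_trans _ (le_trans h _); last first.
  rewrite lee_fin le_eqVlt; apply/orP; left; apply/eqP; apply: eq_bigr => j _.
  by rewrite (perm_iint (nnm_lvl (C j) s) (perm j)).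
apply: le_iint => x //; rewrite /lvl; case: (ltP _ (sect S x)) => /= h1; last first.
  by rewrite lee_fin prodr_ge0// => j _; exact: powR_ge0.
rewrite lee_fin big1// => j _; rewrite (_ : _ < _) ?powR1//.
apply: lt_le_trans h1 _; rewrite /sect finset.setDv.
rewrite (_ : zero_on finset.set0 x = x); last first.
  by apply: eq_from_tnth => i; rewrite tnth_mktuple inE.
apply: (le_zero_on zdec_symG); exact: subsetDl.
Qed.

(** The volumes for the [C j] are normalized by numbers slightly larger than
    their integrals. With weights q_j |C_j| / d the inequality of means bounds
    the product in [lvol_finner] by a sum of powers d / |C_j| of the volumes,
    and [berwald] bounds the integral of each of them by d!. *)
Lemma isect_ineq : (0 < #|S|)%N ->
  (fine (isect S) / (B * (#|S|)`!%:R) <=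
   \prod_j (fine (isect (C j)) / (B * (#|C j|)`!%:R)) `^ q j)%R.
Proof.
move=> d0; set d := #|S| in d0 *.
have fR k : (0 < k`!%:R :> R)%R by rewrite ltr0n fact_gt0.
pose W A : \bar R := \int[mu]_s ((wexp s)%:E * (lvol A s)%:E).
have W0 A : 0 <= W A.
  by apply: integral_ge0 => s _; rewrite -EFinM lee_fin mulr_ge0// wexp_ge0.
have KW A : A \subset S -> (fine (isect A))%:E = B%:E * W A.
  move=> AS; rewrite -isect_lvol// fineK// ge0_fin_numE ?isect_fin//.
  exact: isect_ge0.
have WE A : A \subset S -> W A = (fine (isect A) / B)%:E.
  move=> AS; rewrite mulrC EFinM KW// muleA -EFinM mulVf ?gt_eqF// mul1e.
  by [].
have K0 A : (0 <= fine (isect A))%R by rewrite fine_ge0// isect_ge0.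
apply: powR_limit => [j|j|c' cc'].
- exact: ltW.
- by rewrite divr_ge0// mulr_ge0// ltW.
have c'0 j : (0 < c' j)%R.
  by apply: le_lt_trans (cc' j); rewrite divr_ge0// mulr_ge0// ltW.
pose P := fun j => (0 < #|C j|)%N.
(* the weights of the arithmetic mean; empty sets C j have weight 0 and are
   kept apart, as their factors are at most 1 *)
pose al j : R := (q j * #|C j|%:R / d%:R)%R.
have dR : (0 < d%:R :> R)%R by rewrite ltr0n.
have al0 j : (0 <= al j)%R by rewrite divr_ge0 ?mulr_ge0// ltW.
have al1 : (\sum_(j | P j) al j = 1)%R.
  transitivity (\sum_j al j)%R.
    rewrite [RHS](bigID P)/= [X in (_ + X)%R]big1 ?addr0// => j.
    by rewrite /P -eqn0Ngt /al => /eqP ->; rewrite mulr0 mul0r.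
  rewrite -mulr_suml; apply: (canLR (mulfK (lt0r_neq0 dR))); rewrite mul1r.
  transitivity (\sum_j \sum_(i in S) q j * (i \in C j)%:R)%R.
    apply: eq_bigr => j _; rewrite -mulr_sumr; congr (_ * _)%R.
    rewrite -natr_sum -big_mkcondr /= sum1_card; congr (_%:R)%R; apply: eq_card => i.
    rewrite [RHS]unfold_in; case: (boolP (i \in C j)) => iC; rewrite ?andbF ?andbT//.
    by rewrite (fintype.subsetP (CS j)).
  by rewrite exchange_big/= (eq_bigr (fun=> 1%R))// sumr_const.
pose psi j s : R := (lvol (C j) s / c' j)%R.
have psi0 j s : (0 <= psi j s)%R by rewrite divr_ge0// ltW.
pose Cp : R := (\prod_j c' j `^ q j)%R.
have Cp0 : (0 <= Cp)%R by apply: prodr_ge0 => j _; exact: powR_ge0.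
have mpsi j : measurable_fun setT (psi j : mR -> mR).
  by apply: measurable_funM => //; exact: measurable_lvol.
pose b j : R := (d%:R / #|C j|%:R)%R.
have mpsib j : measurable_fun setT (fun s : mR => (psi j s `^ b j)%R : mR).
  exact: (measurableT_comp (@measurable_powR R (b j)) (mpsi j)).
have pw s : (0 < s)%R ->
    (lvol S s <= Cp * \sum_(j | P j) al j * psi j s `^ b j)%R.
  move=> s0; apply: le_trans (lvol_finner s) _.
  have -> : (\prod_j lvol (C j) s `^ q j = Cp * \prod_j psi j s `^ q j)%R.
    rewrite -big_split/=; apply: eq_bigr => j _.
    rewrite -powRM ?(ltW (c'0 j))//; congr (_ `^ _)%R.
    by rewrite /psi mulrC divfK// gt_eqF.
  rewrite ler_wpM2l// (bigID P)/=; apply: (@le_trans _ _ (\prod_(j | P j) psi j s `^ q j)%R).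
    rewrite ler_piMr//; first by apply: prodr_ge0 => j _; exact: powR_ge0.
    apply: prodr_ile1 => j; rewrite /P -eqn0Ngt cards_eq0 => /eqP Cj0.
    have e1 : (1 `^ q j = 1 :> R)%R by rewrite powR1.
    rewrite powR_ge0/= -[leRHS]e1; apply: ge0_ler_powR; rewrite ?nnegrE ?(ltW (q0 j))//.
    rewrite /psi Cj0 lvol_set0// ler_pdivrMr// mul1r; apply: ltW.
    apply: le_lt_trans (cc' j); rewrite Cj0 cards0 fact0 mulr1 isect0 -/B divff//.
    by rewrite gt_eqF.
  rewrite (eq_bigr (fun j => (psi j s `^ b j) `^ al j)%R); last first.
    move=> j; rewrite {1}/P => Pj; rewrite -powRrM; congr (_ `^ _)%R.
    by rewrite /b /al; field; rewrite !pnatr_eq0 -!lt0n d0 Pj.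
  by apply: amgm => // j _; exact: powR_ge0.
have bw j : P j -> \int[mu]_s ((wexp s)%:E * (psi j s `^ b j)%R%:E) <= d`!%:R%:E.
  move=> Pj; apply: berwald => //.
  - exact: subset_leq_card.
  - by move=> s s' s0 ss'; rewrite ler_pM2r ?invr_gt0// lvol_mono.
  - move=> s th s0 th0 th1; rewrite mulrA ler_pM2r ?invr_gt0// lvol_dilate// th0//.
  have -> : \int[mu]_s ((wexp s)%:E * (psi j s)%:E) = (c' j)^-1%:E * W (C j).
    rewrite -ge0_integralZl//; last 3 first.
    - by under eq_fun do rewrite -EFinM; apply/measurable_EFinP;
        apply: measurable_funM; [exact: measurable_wexp|exact: measurable_lvol].
    - by move=> s _; rewrite -EFinM lee_fin mulr_ge0// wexp_ge0.
    - by rewrite lee_fin invr_ge0 ltW.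
    by apply: eq_integral => s _; rewrite -!EFinM /psi; congr (_%:E); ring.
  rewrite WE// -EFinM lte_fin ltr_pdivrMl//.
  have := cc' j; rewrite ltr_pdivrMr ?mulr_gt0// ltr_pdivrMr//.
  by rewrite mulrA mulrAC.
have mb j : measurable_fun setT (fun s : mR => (wexp s)%:E * (psi j s `^ b j)%R%:E).
  under eq_fun do rewrite -EFinM; apply/measurable_EFinP.
  exact: (measurable_funM (@measurable_wexp R) (mpsib j)).
have b0 j s : 0 <= (wexp s)%:E * (psi j s `^ b j)%R%:E.
  by rewrite -EFinM lee_fin mulr_ge0 ?wexp_ge0 ?powR_ge0.
have ab0 j s : 0 <= (al j)%:E * ((wexp s)%:E * (psi j s `^ b j)%R%:E).
  by apply: mule_ge0; [rewrite lee_fin|exact: b0].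
have : W S <= (Cp * d`!%:R)%:E.
  apply: (@le_trans _ _ (\int[mu]_s (Cp%:E *
     \sum_(j <- [seq j <- index_enum 'I_m | P j])
        (al j)%:E * ((wexp s)%:E * (psi j s `^ b j)%R%:E)))).
    apply: le_integral_ge0 => s.
      by rewrite -EFinM lee_fin mulr_ge0// wexp_ge0.
    rewrite big_filter; under [X in _ <= _ * X]eq_bigr do rewrite -!EFinM.
    rewrite sumEFin -!EFinM lee_fin /wexp; have [s0|s0] := ltP 0%R s; last first.
      rewrite !mul0r mulr_ge0// sumr_ge0// => j _.
      by rewrite mul0r mulr0.
    rewrite mul1r; under eq_bigr do rewrite mulrCA.
    rewrite -mulr_sumr mulrCA ler_pM2l ?expR_gt0//.
    by under eq_bigr do rewrite mul1r || idtac; exact: pw.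
  rewrite ge0_integralZl ?lee_fin//; last 2 first.
  - apply: emeasurable_sum => j; apply: emeasurable_funM => //; exact: measurable_cst.
  - by move=> s _; apply: sume_ge0 => j _; exact: ab0.
  rewrite EFinM; apply: lee_wpmul2l; first by rewrite lee_fin.
  rewrite ge0_integral_sum//; last first.
    by move=> j; apply: emeasurable_funM => //; exact: measurable_cst.
  have -> : (d`!%:R : R)%:E = \sum_(j | P j) (al j)%:E * d`!%:R%:E.
    by rewrite -ge0_sume_distrl ?sumEFin ?al1 ?mul1e// => j _; rewrite lee_fin.
  rewrite big_filter.
  apply: lee_sum => j Pj; rewrite ge0_integralZl ?lee_fin//.
  by apply: lee_wpmul2l; rewrite ?lee_fin ?bw.
rewrite WE ?fintype.subxx// lee_fin; move=> h.
by rewrite invfM mulrA ler_pdivrMr.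
Qed.

End levels.

Lemma marg_ge0 A : 0 <= marg A.
Proof. by apply: iint_ge0; apply: msup_ge0; have [] := rG. Qed.

Lemma marg_fin A : A \subset S -> marg A < +oo.
Proof.
move=> AS; apply: (le_lt_trans (iint_bounded (N := N) (c := c) (enum_uniq _) N0 c0 _ _ _)); last exact: ltry.
  move=> x; rewrite msup_ge0/=; last by have [] := rG.
  by apply: ge_ereal_sup => _ [y _ <-].
move=> x i; rewrite mem_enum => iA cx; apply/eqP; rewrite eq_le; apply/andP; split; last first.
  by apply: msup_ge0; have [] := rG.
apply: ge_ereal_sup => _ [y xy <-]; rewrite leNgt; apply/negP => /Gc /(_ i).
rewrite leNgt => /negP; apply; rewrite -xy//.
by move: iA; rewrite !inE => /orP[->|/negbTE ->]//=; rewrite andbF.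
Qed.

(** The powers of 2 in [isectT] and [isect_le] cancel, since the numbers q_j
    |C_j| add up to |S|; the maximum of [symG] takes the place of [marg
    finset.set0]. *)
Theorem marg_ineq m (C : 'I_m -> {set 'I_n}) (q : 'I_m -> R) :
  (forall j, C j \subset S) -> (forall j, (0 < q j)%R) ->
  (forall i, i \in S -> (\sum_j q j * (i \in C j)%:R = 1)%R) -> (0 < #|S|)%N ->
  marg finset.set0 `^ (\sum_j q j - 1) * marg S <=
  ((#|S|)`!%:R / \prod_j (#|C j|)`!%:R `^ q j)%R%:E * \prod_j marg (C j) `^ q j.
Proof.
move=> CS q0 cover d0; set d := #|S| in d0 *; set p := (\sum_j q j)%R.
have fR k : (0 < k`!%:R :> R)%R by rewrite ltr0n fact_gt0.
have mE A : A \subset S -> marg A = (fine (marg A))%:E.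
  by move=> AS; rewrite fineK// ge0_fin_numE ?marg_ge0// marg_fin.
have m0 A : (0 <= fine (marg A))%R by rewrite fine_ge0// marg_ge0.
have RHS0 : 0 <= ((#|S|)`!%:R / \prod_j (#|C j|)`!%:R `^ q j)%R%:E * \prod_j marg (C j) `^ q j.
  apply: mule_ge0; last by apply: prode_ge0 => j _; exact: poweR_ge0.
  by rewrite lee_fin divr_ge0// ?prodr_ge0// => j _; exact: powR_ge0.
have [B0|] := ltP 0 (symG origin); last first.
  move=> B0; suff -> : marg S = 0 by rewrite mule0.
  have : isect S = 0.
    apply: iint_eq0 => y _; apply/eqP; rewrite eq_le (nnm_sect S).2 andbT.
    exact: (le_trans (symG_origin_ub _)).
  rewrite isectT => /eqP; rewrite mule_eq0 eqe gt_eqF ?exprn_gt0//= => /eqP //.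
have p1 : (1 <= p)%R.
  have /card_gt0P[i iS] := d0; rewrite -(cover i iS); apply: ler_sum => j _.
  by case: (i \in C j); rewrite ?mulr1// mulr0 ltW.
have := isect_ineq CS q0 cover B0 d0.
set B := fine (symG origin) => h.
have Bgt0 : (0 < B)%R by rewrite fine_gt0// B0 symG_origin_fin.
have BE : symG origin = B%:E by rewrite fineK// ge0_fin_numE ?symG_origin_fin// ltW.
have J0B : (fine (marg finset.set0) <= B)%R.
  by rewrite -lee_fin -mE ?finset.sub0set// -BE -isect0; exact: marg0_le.
have KS : fine (isect S) = (2 ^+ d * fine (marg S))%R.
  by rewrite isectT (mE S)// fineM.
have Kj j : (fine (isect (C j)) <= 2 ^+ #|C j| * fine (marg (C j)))%R.
  rewrite -lee_fin EFinM -mE// fineK ?isect_le//.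
  by rewrite ge0_fin_numE ?isect_ge0// isect_fin.
have sumd : (\sum_j #|C j|%:R * q j = d%:R)%R.
  transitivity (\sum_j \sum_(i in S) q j * (i \in C j)%:R)%R.
    apply: eq_bigr => j _; rewrite -mulr_sumr mulrC; congr (_ * _)%R.
    rewrite -natr_sum -big_mkcondr /= sum1_card; congr (_%:R)%R; apply: eq_card => i.
    rewrite [RHS]unfold_in; case: (boolP (i \in C j)) => iC; rewrite ?andbF ?andbT//.
    by rewrite (fintype.subsetP (CS j)).
  by rewrite exchange_big/= (eq_bigr (fun=> 1%R))// sumr_const.
rewrite (mE S)// mE ?finset.sub0set//.
rewrite [X in _ <= _ * X](eq_bigr (fun j => ((fine (marg (C j)) `^ q j)%R%:E))); last first.
  by move=> j _; rewrite (mE (C j)).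
rewrite prodEFin poweR_EFin -!EFinM lee_fin.
apply: (@le_trans _ _ (B `^ (p - 1) * fine (marg S))%R).
  rewrite ler_wpM2r//; apply: ge0_ler_powR; rewrite ?nnegrE ?subr_ge0//.
  exact: ltW.
have h2 : (fine (isect S) / (B * d`!%:R) <=
   2 ^+ d * \prod_j (fine (marg (C j)) / (B * (#|C j|)`!%:R)) `^ q j)%R.
  apply: (le_trans h).
  have -> : (2 ^+ d = \prod_j (2 ^+ #|C j|) `^ q j :> R)%R.
    under eq_bigr do rewrite -powR_mulrn// -powRrM.
    by rewrite -powR_sumr// sumd powR_mulrn.
  rewrite -big_split/=; apply: ler_prod => j _; rewrite powR_ge0/=.
  rewrite -powRM ?exprn_ge0 ?divr_ge0 ?mulr_ge0 ?(ltW Bgt0)//.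
  apply: ge0_ler_powR; rewrite ?nnegrE ?(ltW (q0 j))//.
  - by rewrite divr_ge0 ?fine_ge0 ?isect_ge0// mulr_ge0// ltW.
  - by rewrite mulr_ge0 ?divr_ge0 ?mulr_ge0 ?(ltW Bgt0) ?exprn_ge0.
  - by rewrite mulrA ler_pM2r// invr_gt0 mulr_gt0.
have : (fine (marg S) / (B * d`!%:R) <=
   \prod_j (fine (marg (C j)) / (B * (#|C j|)`!%:R)) `^ q j)%R.
  by move: h2; rewrite KS -mulrA ler_pM2l// exprn_gt0.
have -> : (\prod_j (fine (marg (C j)) / (B * (#|C j|)`!%:R)) `^ q j =
   (\prod_j fine (marg (C j)) `^ q j) / (B `^ p * \prod_j (#|C j|)`!%:R `^ q j))%R.
  rewrite /p powR_sumr// -big_split/= -prodf_div/=; apply: eq_bigr => j _.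
  rewrite powRM ?invr_ge0 ?mulr_ge0 ?(ltW Bgt0)//; congr (_ * _)%R.
  by rewrite -powR_inv1 ?mulr_ge0 ?(ltW Bgt0)// -powRrM mulN1r powRN powRM// ltW.
have pB : (B `^ p = B `^ (p - 1) * B)%R.
  by rewrite -{3}(powRr1 (ltW Bgt0)) -powRD ?subrK// (gt_eqF Bgt0) implybT.
have F0 : (0 < \prod_j (#|C j|)`!%:R `^ q j :> R)%R.
  by apply: prodr_gt0 => j _; rewrite powR_gt0.
have Bp0 : (0 < B `^ (p - 1))%R by rewrite powR_gt0.
rewrite pB => h3.
have -> : (d`!%:R / \prod_j (#|C j|)`!%:R `^ q j * \prod_j fine (marg (C j)) `^ q j =
   ((\prod_j fine (marg (C j)) `^ q j) / (B `^ (p - 1) * B * \prod_j (#|C j|)`!%:R `^ q j))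
   * (B * d`!%:R) * B `^ (p - 1))%R.
  by field; rewrite !gt_eqF.
by rewrite mulrC ler_pM2r// -ler_pdivrMr// mulr_gt0.
Qed.

End core.

(** * Lebesgue measure in coordinates and linear changes of variables *)

Section lebesgue_iterated.
Context {R : realType}.
Local Notation mR := (measurableTypeR R).
Local Notation mu := (@lebesgue_measure R).
Local Open Scope ereal_scope.

(** The identity is measurable from the completed sigma-algebra to the product
    one, and both measures agree on the latter. *)
Lemma integral_lebesgue k (g : k.-tuple mR -> \bar R) : nnm g ->
  \int[lebesgue k]_t g t = \int[product_lebesgue k]_t g t.
Proof.
move=> [mg g0].
pose phi (t : caratheodory_type ((@product_lebesgue R k)^*)%mu) : k.-tuple mR := t.
have mphi : measurable_fun setT phi.
  move=> _ A mA; rewrite setTI; apply: sub_caratheodory.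
  exact: sub_sigma_algebra.
transitivity (\int[image_measure (lebesgue k) mphi]_t g t).
  by rewrite ge0_integral_pushforward// => x _; exact: g0.
apply: eq_measure_integral => A mA _.
exact: measurable_mu_extE.
Qed.

Definition coords n k (l : k.-tuple 'I_n) (x : n.-tuple mR) : k.-tuple mR :=
  map_tuple (tnth x) l.

Lemma measurable_consp2 k (r : mR) :
  measurable_fun setT (fun t : k.-tuple mR => consp (r, t)).
Proof.
by apply: measurableT_comp; [exact: measurable_consp|exact: measurable_pair1].
Qed.

Lemma integral_product_lebesgueS k (g : k.+1.-tuple mR -> \bar R) : nnm g ->
  \int[product_lebesgue k.+1]_t g t =
  \int[mu]_r \int[product_lebesgue k]_t g (consp (r, t)).
Proof.
move=> [mg g0].
transitivity (\int[mu \x product_lebesgue k]_z g (consp z)).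
  pose m : {measure set (mR * k.-tuple mR) -> \bar R} := (mu \x product_lebesgue k).
  have := ge0_integral_pushforward (@measurable_consp R k) m
    measurableT mg (fun y _ => g0 y).
  rewrite preimage_setT => h.
  transitivity (\int[pushforward m (@consp R k)]_y g y); last exact: h.
  by apply: eq_measure_integral => [|A mA _]; first exact: measurable_consp.
rewrite (fubini_tonelli1 (fun z : mR * k.-tuple mR => g (consp z)))//.
by apply: measurableT_comp => //; exact: measurable_consp.
Qed.

(** A product integral in dimension [k] as an iterated integral inside
    dimension [n], where the coordinates outside [l] are spectators. *)
Lemma integral_coords n k (l : k.-tuple 'I_n) (g : k.-tuple mR -> \bar R) x :
  uniq l -> nnm g ->
  \int[product_lebesgue k]_t g t = iint l (g \o coords l) x.
Proof.
elim: k l g x => [|k IH] l g x ul ng.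
  rewrite (tuple0 l) /= integral_dirac//; last exact: ng.1.
  by rewrite diracT mul1e; congr g; apply: eq_from_tnth => -[].
case/tupleP: l ul => i l; move=> /andP[il ul].
rewrite integral_product_lebesgueS//=.
apply: eq_integral => r _.
rewrite (IH l _ (upd x i r))//; last first.
  split; last by move=> t; exact: ng.2.
  by apply: measurableT_comp; [exact: ng.1|exact: measurable_consp2].
apply: iint_eq_rel => z w zx wx zw; rewrite /= (_ : coords _ w = consp (r, coords l z))//.
rewrite /coords/= (_ : z = w).
  by apply: val_inj => /=; congr cons; rewrite wx// tnth_upd eqxx.
apply: eq_from_tnth => j; have [jl|jl] := boolP (j \in (l : seq _)); first exact: zw.
by rewrite zx// wx.
Qed.

End lebesgue_iterated.

Section change_of_variables.
Context {R : realType} {n : nat}.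
Local Notation mR := (measurableTypeR R).
Local Notation mu := (@lebesgue_measure R).
Local Notation T := (n.-tuple mR).
Implicit Types (x y : T) (i j : 'I_n) (F G g : T -> \bar R) (l : seq 'I_n) (M N : 'M[R]_n).

Definition of_row (u : 'rV[R]_n) : T := [tuple u 0 j | j < n].

Lemma row_ofK : cancel (@row_of R n) of_row.
Proof. by move=> x; apply: eq_from_tnth => j; rewrite tnth_mktuple mxE. Qed.

Lemma of_rowK : cancel of_row (@row_of R n).
Proof. by move=> u; apply/rowP => j; rewrite mxE tnth_mktuple. Qed.

(** Row vectors are multiplied by [M] on the right, as in the parametrization
    of subspaces by an orthonormal basis. *)
Definition act M x : T := of_row (row_of x *m M).

Lemma row_of_act M x : row_of (act M x) = row_of x *m M.
Proof. exact: of_rowK. Qed.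

Lemma act1 x : act 1%:M x = x.
Proof. by rewrite /act mulmx1 row_ofK. Qed.

Lemma actM M N x : act (M *m N) x = act N (act M x).
Proof. by rewrite /act mulmxA row_of_act. Qed.

Lemma tnth_act M x j : tnth (act M x) j = \sum_i tnth x i * M i j.
Proof. by rewrite tnth_mktuple mxE; apply: eq_bigr => i _; rewrite mxE. Qed.

Lemma measurable_act M : measurable_fun setT (act M).
Proof.
apply/measurable_fun_tnthP => j.
rewrite (_ : _ \o _ = fun x => \sum_i tnth x i * M i j); last first.
  by apply/funext => x /=; rewrite tnth_act.
apply: measurable_sum => i; apply: measurable_funM => //.
exact: measurable_tnth.
Qed.

Lemma row_of_upd x i r : row_of (upd x i r) = row_of x + (r - tnth x i) *: delta_mx 0 i.
Proof.
apply/rowP => j; rewrite !mxE tnth_upd eqxx/=; case: eqP => [->|_] /=.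
  by rewrite mulr1 addrC subrK.
by rewrite mulr0 addr0.
Qed.

Definition indeps (A : {set 'I_n}) g := forall i, i \in A -> indep i g.

Lemma indeps_agree (A : {set 'I_n}) g x y : indeps A g ->
  (forall j, j \notin A -> tnth x j = tnth y j) -> g x = g y.
Proof.
move=> gA xy; pose z l := foldr (fun i z => upd z i (tnth y i)) x l.
have gz l : {subset l <= A} -> g (z l) = g x.
  elim: l => //= i l IH lA; rewrite gA; last by apply: lA; exact: mem_head.
  by apply: IH => j jl; apply: lA; rewrite inE jl orbT.
rewrite -(gz (enum A)); last by move=> j; rewrite mem_enum.
congr g; apply: eq_from_tnth => j.
have zE l : tnth (z l) j = if j \in l then tnth y j else tnth x j.
  elim: l => //= i l IH; rewrite tnth_upd inE; case: eqP => //= -> //.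
rewrite zE mem_enum; case: (boolP (j \in A)) => // jA; exact: xy.
Qed.

(** If the rows of [M] in [A] are unit vectors, the coordinates in [A] of a
    point influence only the same coordinates of its image. *)
Lemma indeps_act (A : {set 'I_n}) M g : (forall i, i \in A -> row i M = delta_mx 0 i) ->
  indeps A g -> indeps A (g \o act M).
Proof.
move=> AM gA i iA x r /=.
have -> : act M (upd x i r) = upd (act M x) i (tnth (act M x) i + (r - tnth x i)).
  apply: (can_inj row_ofK); rewrite row_of_upd !row_of_act row_of_upd mulmxDl.
  by rewrite -scalemxAl -rowE AM// [in RHS]addrAC subrr add0r.
exact: gA.
Qed.

Lemma iint_translate l g (c : T) x : nnm g ->
  iint l (fun y => g [tuple tnth y j + tnth c j | j < n]) x =
  iint l g [tuple tnth x j + tnth c j | j < n].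
Proof.
move=> ng; elim: l x => //= i l IH x; rewrite /int1.
set x' : T := [tuple tnth x j + tnth c j | j < n]%R.
have nl := nnm_iint l ng.
rewrite -[RHS](@integral_affine _ 1 (tnth c i)) ?oner_eq0//; last 2 first.
- exact: nnm_upd.
- by move=> r; exact: nl.2.
rewrite normr1 mul1e; apply: eq_integral => r _; rewrite IH; congr (iint l g _).
apply: eq_from_tnth => j; rewrite !(tnth_mktuple, tnth_upd) mul1r.
by case: eqP => [->|].
Qed.

Definition replace_row i (v : 'rV[R]_n) : 'M[R]_n :=
  \matrix_(k, j) if k == i then v 0 j else (k == j)%:R.

Lemma row_replace_row i v k :
  row k (replace_row i v) = if k == i then v else delta_mx 0 k.
Proof.
apply/rowP => j; rewrite !mxE; case: eqP => // _.
by rewrite mxE eqxx eq_sym.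
Qed.

Lemma act_replace_row i v x :
  act (replace_row i v) x =
  [tuple tnth x j + tnth x i * (v 0 j - (i == j)%:R) | j < n]%R.
Proof.
apply: eq_from_tnth => j; rewrite tnth_act tnth_mktuple.
rewrite (bigD1 i)//= mxE eqxx mulrBr addrCA; congr (_ + _)%R.
rewrite (eq_bigr (fun k => tnth x k * (k == j)%:R)%R); last first.
  by move=> k /negbTE ki; rewrite mxE ki.
case: (eqVneq i j) => [<-|ij].
  rewrite mulr1 subrr; apply: big1 => k /negbTE ->; exact: mulr0.
rewrite mulr0 subr0 (bigD1 j)//= ?eqxx ?mulr1 1?eq_sym// big1 ?addr0// => k /andP[_ /negbTE ->].
exact: mulr0.
Qed.

Lemma det_replace_row i v : (\det (replace_row i v) = v 0 i)%R.
Proof.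
rewrite (expand_det_row _ i) (bigD1 i)//= big1 ?addr0; last first.
  move=> j ji; rewrite /cofactor; set N := row' _ _.
  have [k kE] : exists k, lift i k = j.
    by case: (unliftP i j) ji => [k -> _|->]; [exists k|rewrite eqxx].
  rewrite (expand_det_row _ k) big1 ?mulr0// => k' _.
  rewrite {1}/N !mxE kE eq_sym (negbTE (neq_lift _ _)). by rewrite eq_sym (negbTE ji) mul0r.
rewrite /cofactor mxE eqxx (_ : row' _ _ = 1%:M).
  by rewrite det1 mulr1 -signr_odd addnn odd_double expr0 mulr1.
apply/matrixP => a b; rewrite !mxE eq_sym (negbTE (neq_lift _ _)).
by rewrite (inj_eq lift_inj).
Qed.

(** A pivot step: a nonzero pivot in row [i] lets [replace_row i v] be
    factored out; the other factor has a unit vector as row [i] and keeps the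
    unit rows of [M]. *)
Lemma mul_replace_row i v M : row i M = v -> (v 0 i != 0)%R ->
  exists2 M', M = M' *m replace_row i v & row i M' = delta_mx 0 i /\
   forall k, row k M = delta_mx 0 k -> k != i -> row k M' = delta_mx 0 k.
Proof.
move=> iM v0.
have U : replace_row i v \in unitmx by rewrite unitmxE det_replace_row unitfE.
have rU k : row k (M *m invmx (replace_row i v)) = row k M *m invmx (replace_row i v).
  by rewrite row_mul.
have rK k : delta_mx 0 k = row k (replace_row i v) *m invmx (replace_row i v).
  by rewrite -row_mul mulmxV// row1.
exists (M *m invmx (replace_row i v)); first by rewrite mulmxKV.
split; first by rewrite rU (rK i) row_replace_row eqxx iM.
by move=> k kM ki; rewrite rU (rK k) row_replace_row (negbTE ki) kM.
Qed.

(** On the coordinates other than [i] the matrix acts as a translation that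
    depends on [x_i], and on [x_i] itself as a dilation. *)
Lemma change_replace_row (A : {set 'I_n}) i (v : 'rV[R]_n) g : i \notin A -> (v 0 i != 0)%R ->
  nnm g -> indeps A g -> forall x,
  (`|v 0 i|%R%:E * iint (enum (~: A)) (g \o act (replace_row i v)) x = iint (enum (~: A)) g x)%E.
Proof.
move=> iA v0 ng gA x; set U := replace_row i v.
have ngU : nnm (g \o act U).
  split; last by move=> y; exact: ng.2.
  by apply: measurableT_comp; [exact: ng.1|exact: measurable_act].
pose l := rem i (enum (~: A)).
have pl : perm_eq (enum (~: A)) (i :: l) by apply: perm_to_rem; rewrite mem_enum inE.
have li : i \notin l by rewrite mem_rem_uniq ?enum_uniq// inE eqxx.
have lA j : j \notin l -> j != i -> j \in A.
  move=> jl ji; move: jl; rewrite mem_rem_uniq ?enum_uniq// inE ji mem_enum inE.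
  by rewrite negbK.
have nl := nnm_iint l ng.
rewrite !(perm_iint _ pl)//= /int1.
rewrite -[RHS](@integral_affine _ (v 0 i) 0)//; last 2 first.
- exact: nnm_upd.
- by move=> r; exact: nl.2.
congr (_ * _)%E; apply: eq_integral => r _; rewrite addr0.
pose c : T := [tuple r * (v 0 j - (i == j)%:R) | j < n]%R.
transitivity (iint l (fun y => g [tuple tnth y j + tnth c j | j < n]%R) (upd x i r)).
  have h y : tnth y i = r -> act U y = [tuple tnth y j + tnth c j | j < n]%R.
    move=> yi; rewrite act_replace_row; apply: eq_from_tnth => j.
    by rewrite !tnth_mktuple yi.
  apply: iint_eq_rel => z w zx wx zw.
  rewrite /= h; last by rewrite zx// tnth_upd eqxx.
  rewrite (_ : z = w)//; apply: eq_from_tnth => j.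
  by have [jl|jl] := boolP (j \in l); [exact: zw|rewrite zx// wx].
rewrite iint_translate//.
apply: iint_eq_rel => z w zx wx zw; apply: (indeps_agree gA) => j jA.
have [jl|jl] := boolP (j \in l); first exact: zw.
have ji : j = i by apply/eqP; apply: contraNT jA => ji; exact: lA.
by rewrite zx// wx// ji !tnth_mktuple !eqxx mulrBr mulr1 addrC subrK mulrC.
Qed.

(** The coordinates in [A] are not integrated, [g] ignores them and [M] fixes
    the corresponding basis vectors; [A] empty is the usual change of
    variables. Gaussian elimination, by induction on the number of rows that
    are not unit vectors: each step multiplies by a matrix [replace_row] with
    [i] outside [A]. *)
Theorem change_of_variables (A : {set 'I_n}) M g :
  (forall i, i \in A -> row i M = delta_mx 0 i) -> M \in unitmx ->
  nnm g -> indeps A g -> forall x,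
  (`|\det M|%R%:E * iint (enum (~: A)) (g \o act M) x = iint (enum (~: A)) g x)%E.
Proof.
move=> AM uM ng gA.
have ngU N : nnm (g \o act N).
  split; last by move=> y; exact: ng.2.
  by apply: measurableT_comp; [exact: ng.1|exact: measurable_act].
have [B] : exists2 B : {set 'I_n}, A \subset B & forall i, i \in B -> row i M = delta_mx 0 i.
  by exists A.
have [k] := ubnP #|~: B|; elim: k M B uM {AM} g ng gA ngU => // k IH M B uM g ng gA ngU kB AB BM x.
have [BT|] := eqVneq (~: B)%SET finset.set0.
  have -> : M = 1%:M.
    apply/row_matrixP => i; rewrite row1 BM//.
    by have := finset.in_set0 i; rewrite -BT inE => /negbFE.
  rewrite det1 normr1 mul1e; congr (iint _ _ x); apply/funext => y /=.
  by rewrite act1.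
move=> /set0Pn[i]; rewrite inE => iB.
have iA : i \notin A by apply: contra iB; exact: (fintype.subsetP AB).
have stepB M' : row i M' = delta_mx 0 i -> (forall j, j \in B -> row j M' = delta_mx 0 j) ->
    M' \in unitmx -> forall g, nnm g -> indeps A g -> forall x,
    (`|\det M'|%R%:E * iint (enum (~: A)) (g \o act M') x = iint (enum (~: A)) g x)%E.
  move=> iM' BM' uM' g' ng' gA' x'; apply: (IH M' (i |: B)%SET uM') => //.
  - move=> N; split; last by move=> y; exact: ng'.2.
    by apply: measurableT_comp; [exact: ng'.1|exact: measurable_act].
  - rewrite finset.setCU finset.setIC -finset.setDE; move: kB.
    by rewrite (cardsD1 i) inE iB add1n ltnS.
  - by apply: fintype.subset_trans AB _; exact: finset.subsetUr.
  - by move=> j; rewrite !inE => /orP[/eqP ->//|]; exact: BM'.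
have step N : N \in unitmx -> (forall j, j \in B -> row j N = delta_mx 0 j) -> (N i i != 0)%R ->
   forall g, nnm g -> indeps A g -> forall x,
    (`|\det N|%R%:E * iint (enum (~: A)) (g \o act N) x = iint (enum (~: A)) g x)%E.
  move=> uN BN Nii g' ng' gA' x'.
  have v0 : (row i N 0 i != 0)%R by rewrite mxE.
  have [N' NE [iN' BN']] := mul_replace_row erefl v0.
  set U := replace_row i _ in NE.
  have uN' : N' \in unitmx by move: uN; rewrite NE unitmx_mul => /andP[].
  have ngU' : nnm (g' \o act U).
    split; last by move=> y; exact: ng'.2.
    by apply: measurableT_comp; [exact: ng'.1|exact: measurable_act].
  have gAU : indeps A (g' \o act U).
    apply: indeps_act => // j jA; rewrite row_replace_row.
    by case: eqP => // ji; rewrite -ji jA in iA.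
  rewrite {1}NE det_mulmx det_replace_row normrM mulrC EFinM -muleA.
  rewrite (_ : g' \o act N = (g' \o act U) \o act N'); last first.
    by apply/funext => y; rewrite /= {1}NE actM.
  rewrite (stepB N')//; last first.
    move=> j jB; apply: BN'; first exact: BN.
    by apply: contraNneq iB => <-.
  exact: change_replace_row.
have [Mii|] := eqVneq (M i i) 0%R; last by move=> Mii; exact: step.
have [j jB Mij] : exists2 j, j \notin B & (M i j != 0)%R.
  apply: contrapT => hN.
  have : (row i M = \sum_(j in B) M i j *: row j M)%R.
    rewrite (row_sum_delta (row i M)) (bigID (mem B))/= [X in (_ + X)%R]big1 ?addr0.
      by apply: eq_bigr => j jB; rewrite (BM j)// mxE.
    move=> j jB; rewrite mxE; have [->|Mij] := eqVneq (M i j) 0%R; first exact: scale0r.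
    by exfalso; apply: hN; exists j.
  move=> /(congr1 (fun u => u *m invmx M)); rewrite -row_mul mulmxV// mulmx_suml row1.
  move=> /rowP /(_ i); rewrite mxE !eqxx summxE big1; first by move/eqP; rewrite oner_eq0.
  move=> j jB; rewrite -scalemxAl -row_mul mulmxV// !mxE.
  by case: eqP => [ji|]; rewrite ?mulr0//; rewrite -ji jB in iB.
have ij : i != j by apply: contraNneq Mij => <-; rewrite Mii.
have jA : j \notin A by apply: contra jB; exact: (fintype.subsetP AB).
(* add column [j] to column [i], so that the pivot becomes nonzero *)
pose v : 'rV[R]_n := (delta_mx 0 j - delta_mx 0 i)%R.
pose v' : 'rV[R]_n := (delta_mx 0 j + delta_mx 0 i)%R.
have vj : (v 0 j = 1)%R by rewrite !mxE !eqxx eq_sym (negbTE ij) subr0.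
have vj' : (v' 0 j = 1)%R by rewrite !mxE !eqxx eq_sym (negbTE ij) addr0.
pose U := replace_row j v; pose U' := replace_row j v'.
have UU' : U' *m U = 1%:M.
  apply/row_matrixP => a; rewrite row_mul row_replace_row row1.
  case: (eqVneq a j) => [->|aj].
    rewrite mulmxDl -!rowE !row_replace_row eqxx (negbTE ij).
    by rewrite addrNK.
  by rewrite -rowE row_replace_row (negbTE aj).
have ME : M = (M *m U') *m U by rewrite -mulmxA UU' mulmx1.
have uU' : U' \in unitmx by rewrite unitmxE det_replace_row vj' unitr1.
have ngU2 : nnm (g \o act U) by exact: ngU.
have gAU : indeps A (g \o act U).
  apply: indeps_act => // a aA; rewrite row_replace_row.
  by case: eqP => // aj; rewrite -aj aA in jA.
have -> : g \o act M = (g \o act U) \o act (M *m U').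
  by apply/funext => y; rewrite /= {1}ME actM.
have -> : (\det M = \det (M *m U'))%R by rewrite det_mulmx det_replace_row vj' mulr1.
rewrite step//.
- have := change_replace_row (v := v) jA _ ng gA x.
  by rewrite vj normr1 mul1e; apply; rewrite oner_eq0.
- by rewrite unitmx_mul uM.
- move=> a aB; rewrite row_mul BM// -rowE row_replace_row.
  by case: eqP => // aj; rewrite -aj aB in jB.
- suff -> : ((M *m U') i i = M i i + M i j)%R by rewrite Mii add0r.
  rewrite mxE (bigD1 j)//= (bigD1 i)//= big1 ?addr0.
    by rewrite !mxE !eqxx (negbTE ij) /= add0r !mulr1 addrC.
  by move=> a /andP[aj ai]; rewrite !mxE (negbTE aj) (negbTE ai) mulr0.
Qed.

End change_of_variables.

(** * Truncation, regularization and integrands that are not measurable *)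

Section suprema.
Context {R : realType} {n : nat}.
Local Notation mR := (measurableTypeR R).
Local Notation mu := (@lebesgue_measure R).
Local Notation T := (n.-tuple mR).
Implicit Types (x y : T) (F G : T -> \bar R) (Fs : nat -> T -> \bar R).
Local Open Scope ereal_scope.

(** Monotone convergence in one coordinate at a time. *)
Lemma iint_sup Fs l : (forall k, nnm (Fs k)) ->
  (forall x, nondecreasing_seq (fun k => Fs k x)) ->
  iint l (fun x => ereal_sup (range (fun k => Fs k x))) =
  fun x => ereal_sup (range (fun k => iint l (Fs k) x)).
Proof.
move=> nF ndF; elim: l => //= i l ->; apply/funext => x; rewrite /int1.
have nd y : nondecreasing_seq (fun k => iint l (Fs k) y).
  by move=> a b ab; apply: le_iint => z; [exact: (nF _).2|exact: ndF].
have nl k : nnm (iint l (Fs k)) by exact: nnm_iint.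
transitivity (\int[mu]_r limn (fun k => iint l (Fs k) (upd x i r))).
  by apply: eq_integral => r _; apply/esym/cvg_lim => //; exact: ereal_nondecreasing_cvgn.
rewrite monotone_convergence//.
- apply/cvg_lim => //; apply: ereal_nondecreasing_cvgn => a b ab.
  by apply: le_integral_ge0 => r; [exact: (nl _).2|exact: nd].
- by move=> k; exact: nnm_upd.
- by move=> k r _; exact: (nl _).2.
Qed.

Lemma msup_sup (A : {set 'I_n}) Fs x :
  msup A (fun x => ereal_sup (range (fun k => Fs k x))) x =
  ereal_sup (range (fun k => msup A (Fs k) x)).
Proof.
apply/eqP; rewrite eq_le; apply/andP; split.
  apply: ge_ereal_sup => _ [y xy <-]; apply: ge_ereal_sup => _ [k _ <-].
  by apply: le_trans (msup_ge (Fs k) xy) _; apply: ereal_sup_ubound; exists k.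
apply: ge_ereal_sup => _ [k _ <-]; apply: ge_ereal_sup => _ [y xy <-].
apply: le_trans (msup_ge _ xy); apply: ereal_sup_ubound; by exists k.
Qed.

Definition inbox (N : R) x := [forall j, (`|tnth x j| < N)%R].
(** Cut off at height [N] and outside a box of size [N]; strict inequalities
    in the box keep lower semicontinuity. *)
Definition trunc (N : R) G x : \bar R := if inbox N x then mine (G x) N%:E else 0.

Lemma inbox_comb N (t : R) x y : (0 < t < 1)%R -> inbox N x -> inbox N y -> inbox N (comb t x y).
Proof.
move=> /andP[t0 t1] /forallP xN /forallP yN; apply/forallP => j; rewrite tnth_mktuple.
have t1' : (0 < 1 - t)%R by rewrite subr_gt0.
apply: le_lt_trans (ler_normD _ _) _; rewrite !normrM (gtr0_norm t0) (gtr0_norm t1').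
have -> : (N = t * N + (1 - t) * N)%R by ring.
by rewrite ltrD// ltr_pM2l.
Qed.

Lemma reg_trunc (N : R) G : (0 <= N)%R -> reg G -> reg (trunc N G).
Proof.
move=> N0 [G0 lG sG]; split.
- by move=> x; rewrite /trunc; case: ifP => // _; rewrite le_min G0 lee_fin.
- move=> t x y a b t01 a0 b0; rewrite /trunc; case: ifPn => [xN|_]; last first.
    by rewrite lte_fin ltNge (ltW a0).
  rewrite lt_min lte_fin => /andP[ax aN]; case: ifPn => [yN|_]; last first.
    by rewrite lte_fin ltNge (ltW b0).
  rewrite lt_min lte_fin => /andP[bx bN]; rewrite (inbox_comb t01)// le_min lG//=.
  by rewrite lee_fin -[leRHS](powR_conv t N0) ltW// ltr_geom// ltW.
- move=> x c; rewrite /trunc; case: ifPn => [xN|xN] cx; last first.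
    exists 1%R => // y _; apply: (lt_le_trans cx); case: ifP => // _.
    by rewrite le_min G0 lee_fin.
  move: cx; rewrite lt_min lte_fin => /andP[/sG[e e0 eG] cN].
  pose d := \big[Num.min/e]_(j < n) (N - `|tnth x j|)%R.
  have d0 : (0 < d)%R.
    rewrite /d; elim/big_rec: _ => // j z _ z0; rewrite lt_min z0 andbT subr_gt0.
    by have /forallP := xN.
  have de : (d <= e)%R by rewrite /d; apply: bigmin_le_id.
  have dj j : (d <= N - `|tnth x j|)%R by rewrite /d; apply: bigmin_le_cond.
  exists d => // y xy; rewrite (_ : inbox N y); last first.
    apply/forallP => j; have := dj j; have := xy j.
    have := ler_distD (tnth x j) 0%R (tnth y j); rewrite sub0r normrN sub0r normrN; lra.
  rewrite lt_min lte_fin cN andbT; apply: eG => j; exact: lt_le_trans de.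
Qed.

Lemma trunc_ub N G x : (0 <= N)%R -> trunc N G x <= N%:E.
Proof.
by move=> N0; rewrite /trunc; case: ifP => _; rewrite ?lee_fin// ge_min lexx orbT.
Qed.

Lemma trunc_support N G x : 0 < trunc N G x -> forall i, (`|tnth x i| <= N)%R.
Proof. by rewrite /trunc; case: ifPn => [/forallP xN _ i|]; [exact: ltW|rewrite ltxx]. Qed.

Lemma trunc_nd G x : (forall x, 0 <= G x) -> nondecreasing_seq (fun k => trunc k%:R G x).
Proof.
move=> G0 a b ab; rewrite /trunc; have abR : (a%:R <= b%:R :> R)%R by rewrite ler_nat.
case: (boolP (inbox a%:R x)) => [/forallP xa|_].
  rewrite (_ : inbox b%:R x); last by apply/forallP => j; exact: lt_le_trans abR.
  by rewrite le_min ge_min lexx/= ge_min lee_fin abR orbT.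
by case: ifP => // _; rewrite le_min G0/= lee_fin.
Qed.

Lemma trunc_sup G x : (forall x, 0 <= G x) -> ereal_sup (range (fun k => trunc k%:R G x)) = G x.
Proof.
move=> G0; apply/eqP; rewrite eq_le; apply/andP; split.
  apply: ge_ereal_sup => _ [k _ <-]; rewrite /trunc; case: ifP => // _.
  by rewrite ge_min lexx.
apply: lee_approx => c cG.
pose K := Num.trunc (\big[Num.max/c]_(j < n) `|tnth x j|)%R.
have cK : (c < K.+1%:R)%R.
  by apply: le_lt_trans (truncnS_gt _); exact: bigmax_ge_id.
have xK : inbox K.+1%:R x.
  apply/forallP => j; apply: le_lt_trans (truncnS_gt _); exact: le_bigmax_cond.
apply: (@le_trans _ _ (trunc K.+1%:R G x)); last by apply: ereal_sup_ubound; exists K.+1.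
by rewrite /trunc xK le_min (ltW cG) lee_fin ltW.
Qed.

Lemma lee_prod_nneg (I : Type) (r : seq I) (P : pred I) (u v : I -> \bar R) :
  (forall i, 0 <= u i) -> (forall i, u i <= v i) ->
  \prod_(i <- r | P i) u i <= \prod_(i <- r | P i) v i.
Proof.
move=> u0 uv; suff /andP[] : 0 <= \prod_(i <- r | P i) u i <= \prod_(i <- r | P i) v i by [].
elim/big_rec2: _ => [|i x y _ /andP[y0 yx]]; first by rewrite lexx lee_fin ler01.
by rewrite mule_ge0//= lee_pmul.
Qed.

(** Passage to the limit along bounded truncations with bounded support. The
    exact marginals on the left are suprema over the truncations; those on the
    right only increase. *)
Theorem marg_ineq_reg (S : {set 'I_n}) m (C : 'I_m -> {set 'I_n}) (q : 'I_m -> R) G :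
  (forall j, C j \subset S) -> (forall j, (0 < q j)%R) ->
  (forall i, i \in S -> (\sum_j q j * (i \in C j)%:R = 1)%R) -> (0 < #|S|)%N ->
  reg G -> marg S G S < +oo ->
  marg S G finset.set0 `^ (\sum_j q j - 1) * marg S G S <=
  ((#|S|)`!%:R / \prod_j (#|C j|)`!%:R `^ q j)%R%:E * \prod_j marg S G (C j) `^ q j.
Proof.
move=> CS q0 cover d0 rG; have [G0 _ _] := rG.
have rGk k : reg (trunc k%:R G) by apply: reg_trunc.
have ndG x : nondecreasing_seq (fun k => trunc k%:R G x) by exact: trunc_nd.
have mge0 A F : (forall x, 0 <= F x) -> 0 <= marg S F A.
  by move=> F0; apply: iint_ge0; exact: msup_ge0.
have margE A : marg S G A = ereal_sup (range (fun k => marg S (trunc k%:R G) A)).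
  rewrite /marg; have := @iint_sup (fun k => msup (S :\: A) (trunc k%:R G)) (enum (A :|: ~: S)).
  move=> /(_ _ _)/(congr1 (fun h => h (origin : T))) <-.
  - congr (iint _ _ _); apply/funext => x; rewrite -msup_sup; congr (msup _ _ x).
    by apply/funext => y; rewrite trunc_sup.
  - by move=> k; apply: reg_nnm; exact: reg_msup.
  - move=> x a b ab; apply: ge_ereal_sup => _ [y xy <-].
    by apply: le_trans (msup_ge _ xy); exact: ndG.
have marg_nd A : nondecreasing_seq (fun k => marg S (trunc k%:R G) A).
  move=> a b ab; apply: le_iint => x; first by apply: msup_ge0; have [] := rGk a.
  apply: ge_ereal_sup => _ [y xy <-].
  by apply: le_trans (msup_ge _ xy); exact: ndG.
set p := (\sum_j q j)%R; set Z := (X in _ -> _ <= X) => bfin.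
have p1 : (0 <= p - 1)%R.
  have /card_gt0P[i iS] := d0; rewrite subr_ge0 -(cover i iS); apply: ler_sum => j _.
  by case: (i \in C j); rewrite ?mulr1// mulr0 ltW.
have mono (x y : \bar R) : 0 <= x -> x <= y -> x `^ (p - 1) <= y `^ (p - 1).
  by move=> x0 xy; apply: gt0_ler_poweR => //; rewrite in_itv/= leey andbT// (le_trans x0).
have ineq k : marg S (trunc k%:R G) finset.set0 `^ (p - 1) * marg S (trunc k%:R G) S <= Z.
  have N0 : (0 <= k%:R :> R)%R by [].
  apply: le_trans (marg_ineq N0 N0 (rGk k) _ _ CS q0 cover d0) _.
  - by move=> x; exact: trunc_ub.
  - by move=> x; exact: trunc_support.
  apply: lee_wpmul2l.
    by rewrite lee_fin divr_ge0// prodr_ge0// => j _; exact: powR_ge0.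
  apply: lee_prod_nneg => j; first exact: poweR_ge0.
  apply: gt0_ler_poweR; first exact: ltW.
  - by rewrite in_itv/= leey andbT; apply: mge0; have [] := rGk k.
  - by rewrite in_itv/= leey andbT; apply: mge0.
  - by rewrite (margE (C j)); apply: ereal_sup_ubound; exists k.
have Z0 : 0 <= Z.
  apply: le_trans (ineq 0%N); apply: mule_ge0; first exact: poweR_ge0.
  by apply: mge0; have [] := rGk 0%N.
have ineq2 k : marg S (trunc k%:R G) finset.set0 `^ (p - 1) * marg S G S <= Z.
  have afin : marg S (trunc k%:R G) finset.set0 \is a fin_num.
    rewrite ge0_fin_numE; last by apply: mge0; have [] := rGk k.
    have N0 : (0 <= k%:R :> R)%R by [].
    apply: (marg_fin N0 N0 (rGk k)); last exact: finset.sub0set.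
    - by move=> x; exact: trunc_ub.
    - by move=> x; exact: trunc_support.
  have : 0 <= marg S (trunc k%:R G) finset.set0 `^ (p - 1) by exact: poweR_ge0.
  have := fin_num_poweR (p - 1) afin.
  set al := _ `^ _; move=> /fineK <-; rewrite lee_fin le_eqVlt => /orP[/eqP <-|al0].
    by rewrite mul0e.
  rewrite -lee_pdivlMl// (margE S); apply: ge_ereal_sup => _ [l _ <-].
  rewrite lee_pdivlMl//; apply: le_trans (ineq (maxn k l)).
  apply: lee_pmul; rewrite ?lee_fin ?(ltW al0)//; first by apply: mge0; have [] := rGk l.
    rewrite fineK ?fin_num_poweR//; apply: mono; first by apply: mge0; have [] := rGk k.
    exact/marg_nd/leq_maxl.
  exact/marg_nd/leq_maxr.
have b0 : 0 <= marg S G S by exact: mge0.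
have bfin' : marg S G S \is a fin_num by rewrite ge0_fin_numE.
move: b0 ineq2; rewrite -(fineK bfin').
set be := fine _; rewrite lee_fin le_eqVlt => /orP[/eqP <-|be0] ineq2; first by rewrite mule0.
rewrite muleC -lee_pdivlMl//.
have {}ineq2 k : marg S (trunc k%:R G) finset.set0 `^ (p - 1) <= be^-1%:E * Z.
  by rewrite lee_pdivlMl// muleC.
move: ineq2; have : 0 <= be^-1%:E * Z by rewrite mule_ge0// lee_fin invr_ge0 ltW.
case: (be^-1%:E * Z) => [y||//] y0 ineq2; last exact: leey.
move: p1 ineq2; rewrite le_eqVlt => /orP[/eqP <-|p1] ineq2.
  by have := ineq2 0%N; rewrite !poweRe0.
have aub : marg S G finset.set0 <= (y `^ (p - 1)^-1)%:E.
  rewrite (margE finset.set0); apply: ge_ereal_sup => _ [k _ <-].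
  have a0 : 0 <= marg S (trunc k%:R G) finset.set0 by apply: mge0; have [] := rGk k.
  have -> : marg S (trunc k%:R G) finset.set0 =
      (marg S (trunc k%:R G) finset.set0 `^ (p - 1)) `^ (p - 1)^-1.
    by rewrite -poweRrM mulfV ?gt_eqF// poweRe1.
  rewrite -poweR_EFin; apply: gt0_ler_poweR; rewrite ?invr_ge0 ?(ltW p1)//.
  - by rewrite in_itv/= leey andbT poweR_ge0.
  - by rewrite in_itv/= leey andbT.
apply: le_trans (mono _ _ (mge0 _ _ G0) aub) _.
rewrite poweR_EFin lee_fin -powRrM mulVf ?gt_eqF// powRr1//.
Qed.

End suprema.

Section regularization.
Context {R : realType} {n : nat}.
Local Notation mR := (measurableTypeR R).
Local Notation T := (n.-tuple mR).
Implicit Types (x y : T) (F G : T -> \bar R).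
Local Open Scope ereal_scope.

Definition near_box (e : R) x y := forall j, (`|tnth x j - tnth y j| < e)%R.

(** The largest lower semicontinuous minorant. *)
Definition lscreg F x : \bar R :=
  ereal_sup [set c%:E | c in [set c : R | exists2 e : R, (0 < e)%R &
    forall y, near_box e x y -> c%:E <= F y]].

Lemma lscreg_gt F x (c : R) : c%:E < lscreg F x ->
  exists2 e : R, (0 < e)%R & forall y, near_box e x y -> c%:E < F y.
Proof.
move=> /ereal_sup_gt[_ [b [e e0 eF] <-]] cb; exists e => // y /eF.
exact: lt_le_trans.
Qed.

Lemma lscreg_ge F x (c e : R) : (0 < e)%R -> (forall y, near_box e x y -> c%:E <= F y) ->
  c%:E <= lscreg F x.
Proof. by move=> e0 eF; apply: ereal_sup_ubound; exists c => //; exists e. Qed.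

Lemma lscreg_le F x : lscreg F x <= F x.
Proof.
apply: ge_ereal_sup => _ [c [e e0 eF] <-]; apply: eF => j.
by rewrite subrr normr0.
Qed.

Lemma reg_lscreg F : (forall x, 0 <= F x) -> lcv F -> reg (lscreg F).
Proof.
move=> F0 lF; split.
- by move=> x; apply: (@lscreg_ge _ _ 0%R 1%R) => // y _; exact: F0.
- move=> t x y a b t01 a0 b0 /lscreg_gt[e e0 ea] /lscreg_gt[e' e'0 eb].
  apply: (@lscreg_ge _ _ _ (Num.min e e')); first by rewrite lt_min e0.
  move=> z zxy; pose u : T := [tuple tnth z j - tnth (comb t x y) j | j < n]%R.
  have uj j : (`|tnth u j| < e)%R /\ (`|tnth u j| < e')%R.
    have := zxy j; rewrite lt_min [tnth u j]tnth_mktuple distrC.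
    by move=> /andP[].
  have -> : z = comb t [tuple tnth x j + tnth u j | j < n]%R [tuple tnth y j + tnth u j | j < n]%R.
    by apply: eq_from_tnth => j; rewrite !tnth_mktuple; ring.
  apply: lF => //.
    by apply: ea => j; rewrite tnth_mktuple opprD addNKr normrN; have [] := uj j.
  by apply: eb => j; rewrite tnth_mktuple opprD addNKr normrN; have [] := uj j.
- move=> x c /ereal_sup_gt[_ [b [e e0 eF] <-]] cb.
  exists (e / 2)%R; first by rewrite divr_gt0.
  move=> y xy; apply: (lt_le_trans cb); apply: (@lscreg_ge _ _ _ (e / 2)%R).
    by rewrite divr_gt0.
  move=> z yz; apply: eF => j; apply: le_lt_trans (ler_distD (tnth y j) _ _) _.
  by rewrite [e]splitr; apply: ltrD; [exact: xy|exact: yz].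
Qed.

(** A point at which [F] is bounded below by [c] on a box lifts lower bounds of
    [F] to its regularization, up to a geometric mean with [c]. *)
Lemma lscreg_comb F x x0 (t a c e : R) : lcv F -> (0 < t < 1)%R -> (0 < a)%R -> (0 < c)%R ->
  (0 < e)%R -> (forall y, near_box e x0 y -> c%:E < F y) -> a%:E < F x ->
  (a `^ t * c `^ (1 - t))%:E <= lscreg F (comb t x x0).
Proof.
move=> lF t01 a0 c0 e0 ec ax; have [t0 t1] := andP t01.
have t1' : (0 < 1 - t)%R by rewrite subr_gt0.
apply: (@lscreg_ge _ _ _ ((1 - t) * e)%R); first by rewrite mulr_gt0.
move=> z zc.
pose y : T := [tuple (tnth z j - t * tnth x j) / (1 - t) | j < n]%R.
have -> : z = comb t x y.
  by apply: eq_from_tnth => j; rewrite !tnth_mktuple; field; rewrite gt_eqF.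
apply: lF => //; apply: ec => j; rewrite tnth_mktuple.
have := zc j; rewrite tnth_mktuple => h.
rewrite -(ltr_pM2l t1') -{1}(gtr0_norm t1') -normrM.
by apply: le_lt_trans h; rewrite le_eqVlt; apply/orP; left; apply/eqP; congr `|_|%R;
  field; rewrite gt_eqF.
Qed.

End regularization.

Section lower_integral.
Context {R : realType}.
Local Notation mR := (measurableTypeR R).
Local Open Scope ereal_scope.

Lemma coords_ord_tuple n : coords (ord_tuple n) = @id (n.-tuple mR).
Proof.
by apply/funext => x; apply: eq_from_tnth => j; rewrite tnth_map tnth_ord_tuple.
Qed.

Lemma integral_product_lebesgue n (g : n.-tuple mR -> \bar R) x : nnm g ->
  \int[product_lebesgue n]_t g t = iint (enum 'I_n) g x.
Proof.
move=> ng; rewrite (@integral_coords _ n n (ord_tuple n) g x)//; last exact: enum_uniq.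
by rewrite coords_ord_tuple.
Qed.

(** A contraction with center [y0] is a translation followed by a dilation. *)
Lemma integral_comb n (g : n.-tuple mR -> \bar R) y0 (t : R) : (0 < t)%R -> nnm g ->
  (t ^+ n)%:E * \int[product_lebesgue n]_y g (comb t y y0) =
  \int[product_lebesgue n]_y g y.
Proof.
move=> t0 ng; pose c := dilate (1 - t)%R y0.
pose h (y : n.-tuple mR) := g [tuple tnth y j + tnth c j | j < n]%R.
have mc : measurable_fun setT (fun y : n.-tuple mR => [tuple tnth y j + tnth c j | j < n]%R : n.-tuple mR).
  apply/measurable_fun_tnthP => j.
  rewrite (_ : _ \o _ = fun y => (tnth y j + tnth c j)%R); last first.
    by apply/funext => y /=; rewrite tnth_mktuple.
  by apply: measurable_funD => //; exact: measurable_tnth.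
have mt : measurable_fun setT (@dilate R n t).
  apply/measurable_fun_tnthP => j.
  rewrite (_ : _ \o _ = fun y => (t * tnth y j)%R); last first.
    by apply/funext => y /=; rewrite tnth_mktuple.
  by apply: measurable_funM => //; exact: measurable_tnth.
have nh : nnm h by split => [|y]; [exact: measurableT_comp ng.1 mc|exact: ng.2].
have hE : (fun y => g (comb t y y0)) = h \o dilate t.
  apply/funext => y /=; congr g; apply: eq_from_tnth => j; rewrite !tnth_mktuple//.
have nht : nnm (h \o dilate t).
  by split => [|y]; [exact: measurableT_comp nh.1 mt|exact: nh.2].
rewrite hE !(integral_product_lebesgue origin)//.
have {1}-> : n = size (enum 'I_n) by rewrite size_enum_ord.
rewrite iint_dilate// iint_translate//; apply: iint_agree => j.
by rewrite mem_enum.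
Qed.

(** The integral of a nonnegative function that need not be measurable is the
    supremum of the integrals of the simple functions below it, and no change of
    variables applies to those; the contraction [comb t _ y0] with [t -> 1] is
    applied to the measurable majorant [g] instead. *)
Lemma integral_lebesgue_ub k (h g : k.-tuple mR -> \bar R) (y0 : k.-tuple mR) (c : R) :
  (0 < c)%R -> (forall y, 0 <= h y) -> nnm g ->
  (forall (t : R) y (a : R), (0 < t < 1)%R -> (0 < a)%R -> a%:E < h y ->
     (a `^ t * c `^ (1 - t))%:E <= g (comb t y y0)) ->
  \int[lebesgue k]_y h y <= \int[product_lebesgue k]_y g y.
Proof.
move=> c0 h0 ng hg; rewrite ge0_integralTE//; apply: ge_ereal_sup => _ [s sh <-].
rewrite -integralT_nnsfun; set X := integral _ _ _; set Z := integral _ _ _.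
have [K K0 sK] : exists2 K : R, (0 < K)%R & forall y, (s y <= K)%R.
  have [K [_ /= bdK]] := simple_bounded s.
  exists (`|K| + 1)%R; first exact: ltr_pwDr.
  move=> x; apply: le_trans (ler_norm _) _; apply: bdK => //.
  by rewrite ltr_pwDr// ler_norm.
(* for a value a of s, a^t c^(1-t) = a (c/a)^(1-t) is at least a rho^(1-t):
   the loss is uniform because s is bounded by K *)
pose rho := Num.min 1%R (c / K)%R.
have rho0 : (0 < rho)%R by rewrite lt_min ltr01 divr_gt0.
have rho1 : (rho <= 1)%R by rewrite ge_min lexx.
have step t : (0 < t < 1)%R -> (rho `^ (1 - t) * t ^+ k)%:E * X <= Z.
  move=> t01; have [t0 t1] := andP t01.
  have ngt : nnm (fun y => g (comb t y y0)).
    split=> [|y]; last exact: ng.2.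
    apply: measurableT_comp; first exact: ng.1.
    apply/measurable_fun_tnthP => j.
    rewrite (_ : _ \o _ = fun y => (t * tnth y j + (1 - t) * tnth y0 j)%R); last first.
      by apply/funext => y /=; rewrite tnth_mktuple.
    apply: measurable_funD => //; apply: measurable_funM => //; exact: measurable_tnth.
  rewrite /Z -(integral_comb y0 t0 ng) mulrC EFinM -muleA; apply: lee_wpmul2l.
    by rewrite lee_fin exprn_ge0// ltW.
  rewrite -(integral_lebesgue ngt).
  have -> : (rho `^ (1 - t))%:E * X = \int[lebesgue k]_y ((rho `^ (1 - t))%:E * (s y)%:E).
    apply/esym/ge0_integralZl.
    - exact: measurableT.
    - apply/measurable_EFinP; exact: measurable_funPT.
    - by move=> y _; rewrite lee_fin; exact: fun_ge0.
    - by rewrite lee_fin powR_ge0.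
  apply: le_integral_ge0 => y.
    by rewrite mule_ge0// lee_fin ?powR_ge0//; exact: fun_ge0.
  have := sh y; have : (0 <= s y)%R by exact: fun_ge0.
  rewrite le_eqVlt => /orP[/eqP <- _|sy0 shy]; first by rewrite mule0; exact: ng.2.
  apply: lee_approx => a; rewrite -EFinM lte_fin => as_.
  have [a0|a0] := leP a 0%R; first by apply: le_trans (ng.2 _); rewrite lee_fin.
  have rt0 : (0 < rho `^ (1 - t))%R by rewrite powR_gt0.
  have a'0 : (0 < a / rho `^ (1 - t))%R by rewrite divr_gt0.
  have a's : (a / rho `^ (1 - t) < s y)%R by rewrite ltr_pdivrMr// mulrC.
  apply: le_trans (hg t y _ t01 a'0 _); last by apply: lt_le_trans shy; rewrite lte_fin.
  rewrite lee_fin; set a' := (_ / _)%R in a'0 a's *.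
  have -> : a = (rho `^ (1 - t) * a')%R by rewrite /a' mulrC divfK ?gt_eqF.
  rewrite -{1}(powR_conv t (ltW a'0)) mulrCA ler_pM2l ?powR_gt0//.
  rewrite -powRM ?(ltW rho0) ?(ltW a'0)//; apply: ge0_ler_powR; rewrite ?nnegrE ?subr_ge0 ?(ltW t1) ?(ltW c0)//.
    by rewrite mulr_ge0// ltW.
  apply: (@le_trans _ _ (c / K * K)%R); last by rewrite divfK// gt_eqF.
  apply: ler_pM; rewrite ?(ltW rho0) ?(ltW a'0)//; first by rewrite ge_min lexx orbT.
  by apply: le_trans (sK y); exact: ltW.
apply: lee_approx => a aX.
have Z0 : 0 <= Z by apply: integral_ge0 => y _; exact: ng.2.
have [a0|a0] := leP a 0%R; first by apply: le_trans Z0; rewrite lee_fin.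
have {}step t : (0 < t < 1)%R -> (rho `^ (1 - t) * t ^+ k * a)%:E <= Z.
  move=> t01; apply: le_trans (step _ t01); rewrite EFinM; apply: lee_wpmul2l (ltW aX).
  by rewrite lee_fin mulr_ge0 ?powR_ge0 ?exprn_ge0//; have /andP[/ltW] := t01.
move: Z0 step; case: Z => [z||//]; last by move=> _ _; exact: leey.
rewrite !lee_fin => z0 step; rewrite leNgt; apply/negP => za.
pose L := (k%:R * a + z * rho^-1)%R.
have L0 : (0 <= L)%R by rewrite addr_ge0 ?mulr_ge0 ?invr_ge0// ltW.
(* t = 1 - e is close enough to 1: the losses t^k and rho^(1-t) are at least 1
   - k e and 1 / (1 + e / rho) *)
pose e := Num.min (1 / 2)%R ((a - z) / (2 * (L + 1)))%R.
have az : (0 < a - z)%R by rewrite subr_gt0.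
have e0 : (0 < e)%R by rewrite lt_min divr_gt0//= divr_gt0// mulr_gt0// ltr_wpDl.
have e1 : (e < 1)%R by rewrite gt_min; apply/orP; left; lra.
have t01 : (0 < 1 - e < 1)%R by rewrite subr_gt0 e1/= gtrBl.
have := step _ t01; rewrite lee_fin opprB addrC subrK => hz.
have bern : (1 - k%:R * e <= (1 - e) ^+ k)%R.
  have e1' : (0 <= 1 - e)%R by rewrite subr_ge0 ltW.
  elim: (k) => [|j IH]; first by rewrite mul0r subr0 expr0.
  rewrite exprS; apply: (@le_trans _ _ ((1 - e) * (1 - j%:R * e))%R); last first.
    by rewrite ler_wpM2l.
  have : (0 <= j%:R * e * e)%R by rewrite !mulr_ge0// ltW.
  rewrite -natr1; lra.
have rhoe : (1 <= rho `^ e * (e * rho^-1 + 1))%R.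
  have e01 : (0 <= e <= 1)%R by rewrite !ltW.
  have rV0 : (0 <= rho^-1)%R by rewrite invr_ge0 ltW.
  have := amgm2 e01 rV0 (ler01 : (0 <= 1 :> R)%R).
  have -> : (1 `^ (1 - e) = 1 :> R)%R by rewrite powR1.
  rewrite !mulr1 => h1.
  have rr : (rho `^ e * rho^-1 `^ e = 1)%R.
    by rewrite -powRM ?(ltW rho0)// mulfV ?gt_eqF// powR1.
  rewrite -[leLHS]rr ler_pM2l ?powR_gt0//; apply: (le_trans h1).
  by rewrite lerD2l gerBl ltW.
have h2 : (a * (1 - k%:R * e) <= z * (e * rho^-1 + 1))%R.
  have b0 : (0 <= (1 - e) ^+ k)%R by rewrite exprn_ge0// subr_ge0 ltW.
  apply: (@le_trans _ _ (a * (1 - e) ^+ k)%R); first by rewrite ler_pM2l.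
  apply: (@le_trans _ _ ((rho `^ e * (1 - e) ^+ k * a) * (e * rho^-1 + 1))%R); last first.
    by rewrite ler_wpM2r// addr_ge0// mulr_ge0 ?invr_ge0 ?(ltW e0) ?(ltW rho0).
  rewrite -[leLHS]mulr1 [leRHS](_ : _ = a * (1 - e) ^+ k * (rho `^ e * (e * rho^-1 + 1)))%R.
    by rewrite ler_wpM2l// mulr_ge0// ltW.
  by ring.
have h3 : (e * (L + 1) <= (a - z) / 2)%R.
  apply: (@le_trans _ _ ((a - z) / (2 * (L + 1)) * (L + 1))%R).
    by apply: ler_wpM2r; [rewrite addr_ge0|rewrite /e ge_min lexx orbT].
  by rewrite le_eqVlt; apply/orP; left; apply/eqP; field; rewrite gt_eqF// ltr_wpDl.
have h4 : (e * L = a * (k%:R * e) + z * (e * rho^-1))%R by rewrite /L; ring.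
by move: h2; rewrite mulrBr mulrDr !mulr1 => h2; move: h3; rewrite mulrDr h4 mulr1; lra.
Qed.

End lower_integral.

(** * Frames, Gram determinants and volumes of parallelepipeds *)

Section orthogonality.
Context {R : realType} {n : nat}.
Implicit Types (F : {vspace 'rV[R]_n}) (x y : 'rV[R]_n) (w : 'I_n -> 'rV[R]_n) (A B : {set 'I_n}).

Lemma orthocomp_cap F : (F :&: orthocomp F)%VS = 0%VS.
Proof.
apply/eqP; rewrite -subv0; apply/subvP => x; rewrite memv_cap => /andP[xF /mem_orthocomp xo].
rewrite memv0; apply: contraT => x0; have := dotr_gt0 x0.
by rewrite xo// ltxx.
Qed.

(** Subtracting from [x] its projection [x *m E^T *m E] gives a vector
    orthogonal to [F]. *)
Lemma orthocomp_add F : (F + orthocomp F)%VS = fullv.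
Proof.
apply/eqP; rewrite eqEsubv subvf; apply/subvP => x _.
have [EE EP] := orthonormal_basisP F; set E := orthonormal_basis F in EE EP *.
rewrite -[x](subrK (x *m E^T *m E)) addrC; apply: memv_add.
  by apply/EP; eexists.
apply/mem_orthocomp => y /EP[t ->]; apply/eqP.
suff : (x - x *m E^T *m E) *m (t *m E)^T = 0.
  move/matrixP => /(_ 0 0); rewrite dotrE mxE mulr1n mxE => /eqP.
  by [].
by rewrite trmx_mul mulmxA mulmxBl -[x *m E^T *m E *m E^T]mulmxA EE mulmx1 subrr mul0mx.
Qed.

Lemma dim_orthocomp F : (\dim F + \dim (orthocomp F))%N = n.
Proof.
by rewrite -(dimv_disjoint_sum (orthocomp_cap F)) orthocomp_add dimvf; exact: mul1n.
Qed.

Lemma mem_orthocomp_wspan w A x :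
  x \in orthocomp (wspan w A) <-> forall k, k \in A -> dotr x (w k) = 0.
Proof.
split=> [/mem_orthocomp xo k kA|xo].
  by apply: xo; apply: memv_span; apply: map_f; rewrite mem_enum.
suff /subvP sub : (wspan w A <= orthocomp <[x]>)%VS.
  by apply/mem_orthocomp => y /sub /mem_orthocomp /(_ x (memv_line x)); rewrite dotrC.
apply/span_subvP => _ /mapP[k + ->]; rewrite mem_enum => kA; apply/mem_orthocomp => _ /vlineP[a ->].
by rewrite dotrZ dotrC xo// mulr0.
Qed.

Definition rows w : 'M[R]_n := \matrix_i w i.
(** The coordinate projection onto [A]. *)
Definition dsel A : 'M[R]_n := diag_mx (\row_i (i \in A)%:R).

Lemma row_rows w k : row k (rows w) = w k. Proof. exact: rowK. Qed.

Lemma dselE A m (M : 'M[R]_(n, m)) i j : (dsel A *m M) i j = (i \in A)%:R * M i j.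
Proof. by rewrite mul_diag_mx !mxE. Qed.

Lemma mul_dselE A m (M : 'M[R]_(m, n)) i j : (M *m dsel A) i j = M i j * (j \in A)%:R.
Proof. by rewrite mul_mx_diag !mxE. Qed.

Lemma row_dsel A m (M : 'M[R]_(n, m)) i :
  row i (dsel A *m M) = if i \in A then row i M else 0.
Proof.
by apply/rowP => j; rewrite mxE dselE; case: ifP; rewrite ?mul1r ?mul0r mxE.
Qed.

Lemma tr_dsel A : (dsel A)^T = dsel A.
Proof. by rewrite tr_diag_mx. Qed.

Lemma dselM A B : dsel A *m dsel B = dsel (A :&: B).
Proof.
apply/matrixP => i j; rewrite dselE !mxE !inE; case: (eqVneq i j) => [->|_] /=.
  by rewrite -natrM mulnb.
by rewrite !mulr0n mulr0.
Qed.

Lemma dselC A : dsel A + dsel (~: A) = 1%:M.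
Proof.
apply/matrixP => i j; rewrite !mxE !inE; case: (eqVneq i j) => [->|_] /=; last by rewrite !mulr0n addr0.
by rewrite !mulr1n; case: (j \in A); rewrite ?addr0 ?add0r.
Qed.

Lemma dsel0 : dsel finset.set0 = 0.
Proof. by apply/matrixP => i j; rewrite !mxE inE /= mul0rn. Qed.

Lemma dselK A : dsel A *m dsel A = dsel A. Proof. by rewrite dselM finset.setIid. Qed.

Lemma dselCr A : dsel A *m dsel (~: A) = 0. Proof. by rewrite dselM finset.setICr dsel0. Qed.
Lemma dselCl A : dsel (~: A) *m dsel A = 0. Proof. by rewrite dselM finset.setIC finset.setICr dsel0. Qed.

Lemma sum_wspan w A (c : 'rV[R]_n) : \sum_(k in A) c 0 k *: w k = c *m dsel A *m rows w.
Proof.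
rewrite -mulmxA mulmx_sum_row [RHS](bigID (mem A))/= [X in _ + X]big1 ?addr0.
  by apply: eq_bigr => k kA; rewrite row_dsel kA row_rows.
by move=> k /negbTE kA; rewrite row_dsel kA scaler0.
Qed.

Lemma mem_wspan w A x : x \in wspan w A <-> exists c, x = c *m dsel A *m rows w.
Proof.
split=> [|[c ->]].
  rewrite /wspan; have -> : [seq w k | k in A] = map_tuple w (enum_tuple A) by [].
  move/coord_span => ->; set X := map_tuple _ _.
  exists (\row_k \sum_(i < #|A|) (tnth (enum_tuple A) i == k)%:R * coord X i x).
  rewrite -sum_wspan.
  transitivity (\sum_i \sum_(k in A)
      ((tnth (enum_tuple A) i == k)%:R * coord X i x) *: w k).
    apply: eq_bigr => i _; set k0 := tnth _ i.
    have k0A : k0 \in A by rewrite -mem_enum; exact: mem_tnth.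
    rewrite (bigD1 k0)//= eqxx mul1r big1 ?addr0.
      by rewrite -tnth_nth tnth_map.
    by move=> k /andP[_ kk]; rewrite eq_sym (negbTE kk) mul0r scale0r.
  by rewrite exchange_big/=; apply: eq_bigr => k _; rewrite mxE scaler_suml.
rewrite -sum_wspan; apply: memv_suml => k kA; apply: memvZ; apply: memv_span.
by apply: map_f; rewrite mem_enum.
Qed.

Lemma basis_rows w : basis_of fullv [seq w i | i : 'I_n] -> rows w \in unitmx.
Proof.
move=> /basis_free; have -> : [seq w i | i : 'I_n] = map_tuple w (ord_tuple n) by [].
move=> /freeP fr; rewrite -row_free_unit; apply: inj_row_free => u uW.
apply/rowP => i; rewrite mxE; apply: fr i.
rewrite -[RHS]uW mulmx_sum_row; apply: eq_bigr => i _.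
by rewrite row_rows -(tnth_nth 0 (map_tuple w (ord_tuple n))) tnth_map tnth_ord_tuple.
Qed.

Lemma dim_wspan w A : rows w \in unitmx -> \dim (wspan w A) = #|A|.
Proof.
move=> uW.
have fr : free [seq w i | i : 'I_n].
  have -> : [seq w i | i : 'I_n] = map_tuple w (ord_tuple n) by [].
  apply/freeP => k h i.
  have kW : (\row_i k i) *m rows w = 0.
    rewrite mulmx_sum_row -[RHS]h; apply: eq_bigr => j _.
    by rewrite mxE row_rows -(tnth_nth 0 (map_tuple w (ord_tuple n))) tnth_map tnth_ord_tuple.
  have : \row_i k i = 0 by rewrite -[LHS](mulmxK uW) kW mul0mx.
  by move/rowP => /(_ i); rewrite !mxE.
have fA : free ([seq w k | k in A] ++ [seq w k | k in ~: A]).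
  rewrite (perm_free (Y := [seq w i | i : 'I_n]))// -map_cat; apply: perm_map.
  apply: uniq_perm; [|exact: enum_uniq|].
    rewrite cat_uniq !enum_uniq andbT; apply/hasPn => k.
    by rewrite !mem_enum inE.
  by move=> k; rewrite mem_cat !mem_enum !inE orbN.
by have := catl_free fA; rewrite /free => /eqP ->; rewrite size_image.
Qed.

End orthogonality.

Section frames.
Context {R : realType} {n : nat}.
Local Notation mR := (measurableTypeR R).
Implicit Types (F : {vspace 'rV[R]_n}) (w : 'I_n -> 'rV[R]_n) (A B : {set 'I_n}).

(** The Gram matrix of the vectors indexed by [A], padded with 1 on the
    diagonal so that its size does not depend on [A]. *)
Definition gram w A : 'M[R]_n :=
  dsel A *m (rows w *m (rows w)^T) *m dsel A + dsel (~: A).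

(** The matrix of [coords l], up to transposition. *)
Definition sel k (l : k.-tuple 'I_n) : 'M[R]_(k, n) := \matrix_(i, j) (tnth l i == j)%:R.

Lemma row_of_coords k (l : k.-tuple 'I_n) (x : n.-tuple mR) :
  row_of (coords l x) = row_of x *m (sel l)^T.
Proof.
apply/rowP => i; rewrite !mxE tnth_map (bigD1 (tnth l i))//= !mxE eqxx mulr1 big1 ?addr0//.
by move=> j ji; rewrite !mxE eq_sym (negbTE ji) mulr0.
Qed.

Lemma sel_tr k (l : k.-tuple 'I_n) : uniq l -> sel l *m (sel l)^T = 1%:M.
Proof.
move=> ul; apply/matrixP => i j; rewrite !mxE (bigD1 (tnth l i))//= !mxE eqxx mul1r big1.
  by rewrite addr0 eq_sym (inj_eq (tuple_uniqP _ ul)).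
by move=> a ai; rewrite !mxE eq_sym (negbTE ai) mul0r.
Qed.

Lemma tr_sel k (l : k.-tuple 'I_n) B : uniq l -> (forall j, (j \in l) = (j \in B)) ->
  (sel l)^T *m sel l = dsel B.
Proof.
move=> ul lB; apply/matrixP => i j; rewrite !mxE.
have [il|il] := boolP (i \in l).
  have /tnthP[a ia] := il.
  rewrite (bigD1 a)//= !mxE -ia eqxx mul1r big1 ?addr0.
    by rewrite -lB il mulr1n; case: eqP => // ->.
  move=> b ba; rewrite !mxE ia (inj_eq (tuple_uniqP _ ul)) (negbTE ba) mul0r//.
rewrite big1; first by rewrite -lB (negbTE il) mul0rn.
move=> a _; rewrite !mxE; case: eqP => [ai|]; last by rewrite mul0r.
by rewrite -ai mem_tnth in il.
Qed.

Lemma dsel_sel k (l : k.-tuple 'I_n) B : (forall j, (j \in l) = (j \in B)) ->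
  dsel (~: B) *m (sel l)^T = 0.
Proof.
move=> lB; apply/matrixP => i j; rewrite dselE !mxE !inE -lB.
by case: eqP => [<-|]; rewrite ?mulr0// mem_tnth/= mul0r.
Qed.

Lemma enum_tuple_of k B : #|B| = k ->
  exists2 l : k.-tuple 'I_n, uniq l & forall j, (j \in l) = (j \in B).
Proof.
by move=> <-; exists (enum_tuple B) => [|j]; [exact: enum_uniq|rewrite mem_enum].
Qed.

(** The rows of [w] in [A] completed by an orthonormal basis of the orthogonal
    complement of their span. *)
Lemma frame_exists w A (F := orthocomp (wspan w A)) : rows w \in unitmx ->
  exists X : 'M[R]_n, exists l : (\dim F).-tuple 'I_n,
  [/\ uniq l /\ (forall j, (j \in l) = (j \in ~: A)), X \in unitmx,
      dsel A *m X = dsel A *m rows w, X *m X^T = gram w A &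
      (sel l)^T *m orthonormal_basis F = dsel (~: A) *m X].
Proof.
move=> uW; have dF : #|~: A| = \dim F.
  apply/eqP; rewrite -(eqn_add2l #|A|) cardsC card_ord -(dim_wspan A uW).
  by rewrite dim_orthocomp.
have [l ul lA] := enum_tuple_of dF; have [EE EP] := orthonormal_basisP F.
set E := orthonormal_basis F in EE EP *; set W := rows w.
have WE : dsel A *m W *m E^T = 0.
  apply/row_matrixP => k; rewrite row0 !row_mul -row_mul row_dsel.
  case: ifP => kA; last by rewrite mul0mx.
  rewrite row_rows; apply/rowP => i; rewrite [RHS]mxE.
  have iF : row i E \in F by apply/EP; exists (delta_mx 0 i); rewrite -rowE.
  have /mem_orthocomp_wspan /(_ k kA) := iF.
  rewrite /dotr => h; rewrite mxE -[RHS]h; apply: eq_bigr => j _.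
  by rewrite !mxE mulrC.
have EW : E *m W^T *m dsel A = 0.
  by apply: trmx_inj; rewrite trmx0 !trmx_mul trmxK tr_dsel mulmxA.
have lA' : dsel A *m (sel l)^T = 0 by rewrite -{1}(finset.setCK A); exact: dsel_sel.
have Al : sel l *m dsel A = 0 by apply: trmx_inj; rewrite trmx0 trmx_mul tr_dsel.
have lCA : (sel l)^T *m sel l = dsel (~: A) by exact: tr_sel.
pose X := dsel A *m W + (sel l)^T *m E.
have AX : dsel A *m X = dsel A *m W.
  by rewrite mulmxDr !mulmxA dselK lA' mul0mx addr0.
have CX : (sel l)^T *m E = dsel (~: A) *m X.
  rewrite mulmxDr !mulmxA dselCl mul0mx add0r -lCA -[_ *m sel l *m _]mulmxA sel_tr//.
  by rewrite mulmx1.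
exists X, l; split => //.
- rewrite -row_free_unit; apply: inj_row_free => u uX.
  have ul0 : u *m (sel l)^T = 0.
    have := congr1 (fun v => v *m E^T) uX.
    rewrite mul0mx -mulmxA (_ : X *m E^T = (sel l)^T)//.
    by rewrite mulmxDl WE add0r -mulmxA EE mulmx1.
  have : u *m X = u *m dsel A *m W by rewrite mulmxDr !mulmxA ul0 mul0mx addr0.
  rewrite uX => /esym uA.
  have {}uA : u *m dsel A = 0 by rewrite -[LHS](mulmxK uW) uA mul0mx.
  rewrite -[u]mulmx1 -(dselC A) mulmxDr uA add0r -lCA mulmxA ul0 mul0mx//.
- rewrite linearD/= mulmxDl !mulmxDr !trmx_mul trmxK tr_dsel.
  have -> : dsel A *m W *m (E^T *m sel l) = 0 by rewrite mulmxA WE mul0mx.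
  have -> : (sel l)^T *m E *m (W^T *m dsel A) = 0.
    by rewrite -mulmxA [E *m _]mulmxA EW mulmx0.
  rewrite addr0 add0r -[_ *m E *m _]mulmxA [E *m _]mulmxA EE mul1mx lCA.
  by rewrite /gram !mulmxA.
Qed.

Lemma det_gram_frame w A (X : 'M[R]_n) : X *m X^T = gram w A -> \det (gram w A) = \det X ^+ 2.
Proof. by move=> <-; rewrite det_mulmx det_tr expr2. Qed.

End frames.

Section wedge.
Context {R : realType} {n : nat}.
Local Notation mR := (measurableTypeR R).
Local Notation T := (n.-tuple mR).
Implicit Types (w : 'I_n -> 'rV[R]_n) (A B : {set 'I_n}).

Lemma parallelepipedP w A (X : 'M[R]_n) x : X \in unitmx -> dsel A *m X = dsel A *m rows w ->
  x \in wspan w A ->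
  parallelepiped w A x <-> forall k, k \in A -> 0 <= (x *m invmx X) 0 k <= 1.
Proof.
move=> uX AX /mem_wspan[c ->]; rewrite -mulmxA -AX mulmxA mulmxK//; split.
  move=> [a a01]; rewrite (_ : \sum_(k in A) _ = \sum_(k in A) (\row_k a k) 0 k *: w k); last first.
    by apply: eq_bigr => k _; rewrite mxE.
  rewrite sum_wspan -[RHS]mulmxA -AX mulmxA => /(can_inj (mulmxK uX)) ca k kA.
  by rewrite ca mul_dselE kA mulr1 mxE.
move=> h; exists (fun k => (c *m dsel A) 0 k).
  move=> k; have [/h//|kA] := boolP (k \in A).
  by rewrite mul_dselE (negbTE kA) mulr0 lexx ler01.
by rewrite sum_wspan -[in RHS](mulmxA c) dselK -[in RHS]mulmxA -AX mulmxA.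
Qed.

Definition cube A (x : T) : \bar R := ([forall k in A, 0 <= tnth x k <= 1])%:R%:E.

Lemma nnm_cube A : nnm (cube A).
Proof.
split; last by move=> x; rewrite lee_fin ler0n.
apply/measurable_EFinP; pose P : set T := \big[setI/setT]_(k in A) [set x | 0 <= tnth x k <= 1].
have mP : measurable P.
  apply: big_ind => //; first by move=> U V; exact: measurableI.
  move=> k _; rewrite (_ : mkset _ = setT `&` (fun x : T => tnth x k) @^-1` `[0, 1]).
    by apply: measurable_tnth => //; exact: measurable_itv.
  by rewrite setTI; apply/seteqP; split => x; rewrite /= in_itv.
rewrite (_ : (fun x => _) = \1_P); first exact: measurable_indic.
apply/funext => x; rewrite indicE; congr (_%:R); congr nat_of_bool.
apply/idP/idP.
  move=> /forall_inP h; rewrite inE /P; elim/big_rec: _ => // k U kA Ux.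
  by split => //=; exact: h.
rewrite inE /P => h; apply/forall_inP => k kA; move: h; rewrite (bigD1 k)//=.
by move=> [].
Qed.

Lemma indeps_cube A : indeps (~: A) (cube A).
Proof.
move=> k; rewrite inE => kA x r; congr (_%:R%:E); congr nat_of_bool.
apply: eq_forallb_in => j jA; rewrite tnth_upd.
by case: eqP => // jk; rewrite -jk jA in kA.
Qed.

Lemma iint_cube A (l : seq 'I_n) x : uniq l -> (forall j, j \in l -> j \in A) ->
  (forall j, j \in A -> j \notin l -> 0 <= tnth x j <= 1) ->
  iint l (cube A) x = 1%E.
Proof.
elim: l x => [|i l IH] x /=.
  move=> _ _ h; rewrite /cube (_ : [forall k in A, _]); first by [].
  by apply/forall_inP => k kA; exact: h.
move=> /andP[il ul] lA h; rewrite /int1.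
transitivity (\int[@lebesgue_measure R]_r ((\1_(`[0%R, 1%R]%classic : set mR) r)%:E))%E.
  apply: eq_integral => r _; rewrite indicE; have [|] := boolP (r \in _).
    rewrite inE/= in_itv/= => r01; rewrite IH//.
      by move=> j jl; apply: lA; rewrite inE jl orbT.
    move=> j jA jl; rewrite tnth_upd; case: eqP => [//|/eqP ji].
    by apply: h => //; rewrite inE negb_or ji.
  rewrite notin_setE/= in_itv/= => r01; apply: iint_eq0 => y yx.
  rewrite /cube (_ : [forall k in A, _] = false)//; apply/negP => /forall_inP /(_ i).
  rewrite yx// tnth_upd eqxx => h'; apply: r01; apply: h'; apply: lA.
  exact: mem_head.
rewrite integral_indic//.
rewrite setIT /= lebesgue_measure_itv/= lte_fin ltr01 -EFinD subr0//.
Qed.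

(** An orthonormal basis of the span, completed by the orthonormal rows of the
    frame [X], is an orthogonal matrix [Y], and the matrix [Y *m invmx X] maps
    the parallelepiped to a unit cube; its volume is therefore |det X|, whose
    square is the Gram determinant. *)
Theorem wedge_normE w A : rows w \in unitmx ->
  0 < wedge_norm w A /\ wedge_norm w A ^+ 2 = \det (gram w A).
Proof.
move=> uW; have [X [lF [[ulF lFA] uX AX XX lFX]]] := frame_exists A uW.
suff -> : wedge_norm w A = `|\det X|.
  rewrite normr_gt0 -unitfE -unitmxE uX -normrX ger0_norm ?sqr_ge0//.
  by rewrite (det_gram_frame XX).
rewrite /wedge_norm dim_wspan// eqxx; set H := wspan w A.
have [l ul lA] : exists2 l : (\dim H).-tuple 'I_n, uniq l & forall j, (j \in l) = (j \in A).
  by apply: enum_tuple_of; rewrite dim_wspan.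
have [EE EP] := orthonormal_basisP H; set E := orthonormal_basis H in EE EP *.
have EX : E *m (dsel (~: A) *m X)^T = 0.
  rewrite -lFX trmx_mul trmxK mulmxA.
  have [EFE EFP] := orthonormal_basisP (orthocomp H).
  set EF := orthonormal_basis (orthocomp H) in EFE EFP *.
  suff -> : E *m EF^T = 0 by rewrite mul0mx.
  apply/matrixP => i j; rewrite !mxE.
  have iH : row i E \in H by apply/EP; exists (delta_mx 0 i); rewrite -rowE.
  have jF : row j EF \in orthocomp H by apply/EFP; exists (delta_mx 0 j); rewrite -rowE.
  have /mem_orthocomp/(_ _ iH) := jF; rewrite /dotr => h; rewrite -[RHS]h.
  by apply: eq_bigr => a _; rewrite !mxE mulrC.
have XCC : dsel (~: A) *m X *m (dsel (~: A) *m X)^T = dsel (~: A).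
  rewrite trmx_mul tr_dsel mulmxA -[_ *m X *m X^T]mulmxA XX /gram mulmxDr mulmxDl.
  by rewrite !mulmxA dselCl !mul0mx add0r !dselK.
have lAC : dsel (~: A) *m (sel l)^T = 0 :> 'M[R]_(_, _) by exact: dsel_sel.
have lAt : (sel l)^T *m sel l = dsel A :> 'M[R]_n by exact: tr_sel.
pose Y := (sel l)^T *m E + dsel (~: A) *m X.
have YY : Y *m Y^T = 1%:M.
  rewrite linearD/= mulmxDl !mulmxDr XCC.
  have -> : (sel l)^T *m E *m (dsel (~: A) *m X)^T = 0 by rewrite -mulmxA EX mulmx0.
  have -> : dsel (~: A) *m X *m ((sel l)^T *m E)^T = 0.
    apply: trmx_inj; rewrite trmx0 trmx_mul trmxK -mulmxA EX mulmx0//.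
  rewrite addr0 add0r trmx_mul trmxK -mulmxA [E *m _]mulmxA EE mul1mx lAt.
  exact: dselC.
have dY : `|\det Y| = 1.
  have : `|\det Y| ^+ 2 = 1 by rewrite expr2 -normrM -[in X in `|_ * X|]det_tr -det_mulmx YY det1 normr1.
  by move/eqP; rewrite sqrf_eq1 => /orP[/eqP//|/eqP h]; have := normr_ge0 (\det Y); rewrite h oppr_ge0 ler10.
pose N := Y *m invmx X.
have uY : Y \in unitmx by have [] := mulmx1_unit YY.
have Nrow i : i \in ~: A -> row i N = delta_mx 0 i.
  move=> iA.
  have -> : row i N = row i (dsel (~: A) *m N) by rewrite row_dsel iA.
  rewrite /N mulmxA /Y mulmxDr !mulmxA lAC mul0mx add0r dselK mulmxK//.
  by rewrite -[dsel _]mulmx1 row_dsel iA row1.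
have uN : N \in unitmx by rewrite unitmx_mul uY unitmx_inv.
have dN : `|\det N| * `|\det X| = 1.
  by rewrite -normrM det_mulmx det_inv mulrVK ?dY// -unitmxE.
have := change_of_variables Nrow uN (nnm_cube A) (@indeps_cube A) origin.
rewrite finset.setCK iint_cube ?enum_uniq//; last 2 first.
- by move=> j; rewrite mem_enum.
- by move=> j jA; rewrite mem_enum jA.
pose Q t := [forall k in A, 0 <= (row_of t *m E *m invmx X) 0 k <= 1].
have QE : [set t | parallelepiped w A (@subspace_point _ _ H t)] = [set t | Q t].
  have tH t : row_of t *m E \in wspan w A by apply/EP; exists (row_of t).
  apply/seteqP; split => t /=.
    by move=> /(parallelepipedP uX AX (tH t)) h; apply/forall_inP.
  by move=> /forall_inP h; apply/(parallelepipedP uX AX (tH t)).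
have NQ : cube A \o act N = (fun t => (Q t)%:R%:E) \o coords l.
  apply/funext => x /=; congr (_%:R%:E); congr nat_of_bool.
  apply: eq_forallb_in => k kA; rewrite row_of_coords -[tnth _ k]/(tnth (act N x) k).
  have -> : tnth (act N x) k = (row_of (act N x)) 0 k by rewrite mxE.
  rewrite row_of_act /N mulmxA /Y mulmxDr mulmxDl mxE.
  have -> : (row_of x *m (dsel (~: A) *m X) *m invmx X) 0 k = 0.
    by rewrite mulmxA mulmxK// mul_dselE inE kA mulr0.
  by rewrite addr0 mulmxA.
have mQ : measurable [set t : (\dim H).-tuple mR | Q t].
  pose P k : set ((\dim H).-tuple mR) := [set t | 0 <= (row_of t *m E *m invmx X) 0 k <= 1].
  rewrite (_ : mkset _ = \big[setI/setT]_(k in A) P k).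
    apply: big_ind => //; first by move=> U V; exact: measurableI.
    move=> k _.
    have sE (t : (\dim H).-tuple mR) : \sum_j row_of t 0 j * (E *m invmx X) j k =
        \sum_i tnth t i * (E *m invmx X) i k.
      by apply: eq_bigr => j _; rewrite [row_of t 0 j]mxE.
    rewrite (_ : P k = setT `&` (fun t : (\dim H).-tuple mR =>
       \sum_i tnth t i * (E *m invmx X) i k) @^-1` `[0, 1]).
      have mf : measurable_fun setT (fun t : (\dim H).-tuple mR =>
          \sum_i tnth t i * (E *m invmx X) i k : mR).
        by apply: measurable_sum => i; apply: measurable_funM => //; exact: measurable_tnth.
      by apply: mf => //; exact: measurable_itv.
    rewrite setTI; apply/seteqP; split => t; rewrite /P /= in_itv/= -mulmxA mxE.
      by rewrite sE.
    by rewrite sE.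
  apply/seteqP; split => t /=.
    by move=> /forall_inP h; elim/big_rec: _ => // k U kA Ut; split => //; exact: h.
  move=> h; apply/forall_inP => k kA; move: h; rewrite (bigD1 k)//=; by case.
have nQ : nnm (fun t : (\dim H).-tuple mR => (Q t)%:R%:E).
  split; last by move=> t; rewrite lee_fin ler0n.
  rewrite (_ : (fun t => _) = EFin \o \1_[set t | Q t]).
    by apply/measurable_EFinP; exact: measurable_indic.
  apply/funext => t; rewrite /= indicE; congr (_%:R%:E); congr nat_of_bool.
  by apply/idP/idP; rewrite inE.
rewrite NQ (perm_iint (l' := l)); last 2 first.
- by rewrite -NQ; split => [|x]; [apply: measurableT_comp; [exact: (nnm_cube A).1|exact: measurable_act]|exact: (nnm_cube A).2].
- by apply: uniq_perm => //; [exact: enum_uniq|move=> j; rewrite mem_enum lA].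
rewrite -integral_coords//.
have -> : (\int[product_lebesgue (\dim H)]_t (Q t)%:R%:E = subspace_measure H (parallelepiped w A))%E.
  rewrite /subspace_measure QE.
  have -> : lebesgue (\dim H) [set t | Q t] = product_lebesgue (\dim H) [set t | Q t].
    exact: measurable_mu_extE.
  rewrite -[RHS]mul1e -integral_cst// integral_mkcond; apply: eq_integral => t _.
  by rewrite patchE; case: ifPn; [rewrite inE => /= ->|rewrite notin_setE => /negP/negbTE /= ->].
move=> h; have : `|\det N| != 0 by apply: contra_eq_neq dN => ->; rewrite mul0r eq_sym oner_eq0.
set V := subspace_measure _ _ in h *; move=> N0.
have V0 : (0 <= V)%E by rewrite /V /subspace_measure; exact: measure_ge0.
have Vfin : V \is a fin_num.
  by move: h V0; case: (V) => //= ; rewrite gt0_muley// lte_fin lt_def N0 normr_ge0.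
move: h; rewrite -(fineK Vfin) -EFinM => -[h].
by apply: (mulfI N0); rewrite h dN.
Qed.

End wedge.

(** * Dual frames *)

Section dual_frame.
Context {R : realType} {n : nat}.
Implicit Types (F : {vspace 'rV[R]_n}) (w b : 'I_n -> 'rV[R]_n) (A S : {set 'I_n}).

(** The square-zero matrix N in this determinant is conjugate to -N, by the
    involution that changes the signs of the coordinates outside [A], and (1 +
    N) (1 - N) = 1. *)
Lemma det_nilpotent A (Z : 'M[R]_n) : \det (1%:M + dsel A *m Z *m dsel (~: A)) ^+ 2 = 1.
Proof.
set N := dsel A *m Z *m dsel (~: A); set s := dsel A - dsel (~: A) : 'M[R]_n.
have ss : s *m s = 1%:M.
  by rewrite /s mulmxBl !mulmxBr !dselK dselCr dselCl subr0 sub0r opprK dselC.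
have sN : s *m (1%:M + N) *m s = 1%:M - N.
  rewrite mulmxDr mulmxDl mulmx1 ss; congr (_ + _).
  have -> : s *m N = N by rewrite /s mulmxBl /N !mulmxA dselK dselCl !mul0mx subr0.
  by rewrite /s mulmxBr /N -!mulmxA dselK dselCl !mulmx0 sub0r.
have dd : \det (1%:M - N) = \det (1%:M + N).
  rewrite -sN !det_mulmx mulrAC -det_mulmx ss det1 mul1r//.
have NN : N *m N = 0 by rewrite /N -!mulmxA [dsel (~: A) *m (dsel A *m _)]mulmxA dselCl mul0mx !mulmx0.
by rewrite expr2 -{2}dd -det_mulmx mulmxBr mulmx1 mulmxDl mul1mx NN addr0 addrK det1.
Qed.

(** Jacobi's identity for complementary minors; squared, because
    [det_nilpotent] determines its determinant up to sign. *)
Lemma det_dsel_inv A (K : 'M[R]_n) : K \in unitmx ->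
  (\det (dsel A *m invmx K *m dsel A + dsel (~: A)) * \det K) ^+ 2 =
  \det (dsel (~: A) *m K *m dsel (~: A) + dsel A) ^+ 2.
Proof.
move=> uK; set D := dsel A; set D' := dsel (~: A).
have DD' : D + D' = 1%:M by exact: dselC.
have e1 : (1%:M + D *m invmx K *m D') *m (D *m invmx K *m D + D') = D *m invmx K + D'.
  rewrite mulmxDl mul1mx mulmxDr -!mulmxA [D' *m (D *m _)]mulmxA dselCl mul0mx !mulmx0 add0r.
  by rewrite dselK addrAC -mulmxDr -mulmxDr DD' mulmx1.
have e2 : (1%:M + D' *m K *m D) *m (D' *m K *m D' + D) = D + D' *m K.
  rewrite mulmxDl mul1mx mulmxDr -!mulmxA [D *m (D' *m _)]mulmxA dselCr mul0mx !mulmx0 add0r.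
  by rewrite dselK addrAC -mulmxDr -mulmxDr [D' + D]addrC DD' mulmx1 addrC.
have e3 : (D *m invmx K + D') *m K = D + D' *m K by rewrite mulmxDl mulmxKV.
have := congr1 (fun M => \det M ^+ 2) e3.
rewrite det_mulmx -e1 -e2 !det_mulmx !exprMn det_nilpotent mul1r => ->.
have := det_nilpotent (~: A) K; rewrite finset.setCK => ->.
by rewrite mul1r.
Qed.

Lemma orthocompK F : orthocomp (orthocomp F) = F.
Proof.
apply/esym/eqP; rewrite eqEdim; apply/andP; split.
  apply/subvP => x xF; apply/mem_orthocomp => y /mem_orthocomp yo.
  by rewrite dotrC yo.
by rewrite -(leq_add2l (\dim (orthocomp F))) dim_orthocomp addnC dim_orthocomp.
Qed.

(** Replacing the vectors indexed by [S] by their dual basis inside the span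
    exchanges the subspaces [orthocomp (wspan _ (S :\: A))] with
    [wspan _ A + orthocomp (wspan _ S)], which turns the first two inequalities
    into the last two. *)
Lemma dual_frame w S : rows w \in unitmx -> exists b : 'I_n -> 'rV[R]_n,
  rows b \in unitmx /\ forall A, A \subset S ->
    wedge_norm b (S :\: A) = wedge_norm w A / wedge_norm w S /\
    orthocomp (wspan b (S :\: A)) = (wspan w A + orthocomp (wspan w S))%VS.
Proof.
move=> uW; have [X [l [[ul lS] uX SX XX lX]]] := frame_exists S uW.
pose b i := row i (invmx X)^T.
have Bb : rows b = (invmx X)^T by apply/row_matrixP => i; rewrite rowK.
have uB : rows b \in unitmx by rewrite Bb unitmx_tr unitmx_inv.
exists b; split=> // A AS.
have [vS0 vS] := wedge_normE S uW; have [vA0 vA] := wedge_normE A uW.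
have [vb0 vb] := wedge_normE (S :\: A) uB.
have CA : ~: (S :\: A) = A :|: ~: S.
  by rewrite finset.setCD finset.setUC.
split.
  set T := (S :\: A) in CA vb0 vb *.
  have uK : gram w S \in unitmx by rewrite -XX unitmx_mul unitmx_tr uX.
  have iK : invmx (gram w S) = rows b *m (rows b)^T.
    rewrite Bb trmxK; apply: (can_inj (mulKmx uK)).
    rewrite mulmxV// -XX mulmxA -[X *m X^T *m _]mulmxA -trmx_mul mulVmx// trmx1.
    by rewrite mulmx1 mulmxV.
  have := det_dsel_inv T uK.
  rewrite iK -/(gram b T).
  have -> : dsel (~: T) *m gram w S *m dsel (~: T) + dsel T = gram w A.
    have TS : ~: T :&: S = A.
      apply/setP => i; rewrite CA !inE; have := fintype.subsetP AS i.
      by case: (i \in A); case: (i \in S) => //= /(_ isT).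
    have ST : S :&: ~: T = A by rewrite finset.setIC.
    have TC : ~: T :&: ~: S = ~: S.
      by rewrite CA; apply/setP => i; rewrite !inE; case: (i \in S); rewrite ?andbF ?orbT.
    rewrite /gram mulmxDr mulmxDl !mulmxA dselM TS.
    rewrite -[_ *m dsel S *m dsel (~: T)]mulmxA dselM ST.
    rewrite dselM TC dselM finset.setIC TC.
    rewrite -addrA; congr (_ + _).
    apply/matrixP => i j; rewrite !mxE !inE; have := fintype.subsetP AS i.
    rewrite -mulrnDl -natrD => h; congr (_%:R *+ _); move: h.
    by case: (i \in A); case: (i \in S) => //= /(_ isT).
  rewrite -vb -vS -vA => /eqP; rewrite -exprMn !eqrXn2 ?mulr_ge0 ?sqr_ge0 ?exprn_ge0 ?mulr_ge0 ?(ltW vb0) ?(ltW vS0) ?(ltW vA0)//.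
  by move=> /eqP <-; rewrite mulfK// gt_eqF.
have xb x k : dotr x (b k) = (x *m invmx X) 0 k.
  by rewrite mxE; apply: eq_bigr => j _; rewrite !mxE.
have AX : dsel A *m X = dsel A *m rows w.
  by rewrite -[in LHS](finset.setIidPl AS) -dselM -mulmxA SX mulmxA dselM (finset.setIidPl AS).
have [EE EP] := orthonormal_basisP (orthocomp (wspan w S)).
apply/eqP; rewrite eqEsubv; apply/andP; split; apply/subvP => x.
  move=> /mem_orthocomp_wspan xT.
  have -> : x = x *m invmx X *m X by rewrite mulmxKV.
  set c := x *m invmx X.
  have -> : c = c *m dsel A + c *m dsel (~: S).
    apply/rowP => k; rewrite [RHS]mxE !mul_dselE inE; have := fintype.subsetP AS k.
    have [kA /(_ isT) ->|kA _] := boolP (k \in A); first by rewrite mulr1 mulr0 addr0.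
    have [kS|] := boolP (k \in S); last by rewrite mulr0 add0r mulr1.
    by rewrite !mulr0 addr0 -xb xT// inE kA.
  rewrite mulmxDl; apply: memv_add.
    by apply/mem_wspan; exists c; rewrite -mulmxA AX mulmxA.
  by apply/EP; exists (c *m (sel l)^T); rewrite -mulmxA -lX mulmxA.
move=> /memv_addP[_ /mem_wspan[c ->] [_ /EP[t ->] ->]].
apply/mem_orthocomp_wspan => k; rewrite inE => /andP[kA kS].
have -> : t *m orthonormal_basis (orthocomp (wspan w S)) = t *m sel l *m dsel (~: S) *m X.
  by rewrite -[RHS]mulmxA -lX mulmxA -[t *m _ *m _]mulmxA sel_tr// mulmx1.
rewrite xb mulmxDl -[c *m _ *m _]mulmxA -AX mulmxA !mulmxK// mxE !mul_dselE inE kS (negbTE kA).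
by rewrite !mulr0 addr0.
Qed.

End dual_frame.

(** * Log-concave functions in a frame *)

Section log_concave.
Context {R : realType} {n : nat}.
Local Notation mR := (measurableTypeR R).
Local Notation T := (n.-tuple mR).
Implicit Types (f : 'rV[R]_n -> R) (w : 'I_n -> 'rV[R]_n) (x y : 'rV[R]_n).

Lemma log_concave_ge0 f x : log_concave f -> 0 <= f x.
Proof. by move=> [v [_ _ fv]]; rewrite -lee_fin fv expeR_ge0. Qed.

Lemma log_concaveP f (t : R) x y : log_concave f -> 0 < t < 1 -> 0 < f x -> 0 < f y ->
  f x `^ t * f y `^ (1 - t) <= f (t *: x + (1 - t) *: y).
Proof.
move=> [v [vN vc fv]] t01 fx fy.
have vE z : 0 < f z -> v z = (- ln (f z))%:E.
  move=> fz; have := fv z; have := vN z; case: (v z) => [r| |]//= _.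
    by move=> [->]; rewrite expRK opprK.
  by move=> [fz0]; rewrite fz0 ltxx in fz.
have := vc x y t t01; rewrite (vE x)// (vE y)// -!EFinM -EFinD => h.
rewrite /powR !gt_eqF// -expRD -lee_fin fv -[leLHS]/(expeR (_)%:E) lee_expeR.
by rewrite leeNr; apply: (le_trans h); rewrite lee_fin; lra.
Qed.

Lemma log_concave_gt f (t : R) x y (c : R) : log_concave f -> 0 < t < 1 -> 0 < c ->
  c < f x -> c < f y -> c < f (t *: x + (1 - t) *: y).
Proof.
move=> lf t01 c0 cx cy; apply: lt_le_trans (log_concaveP lf t01 _ _).
- by rewrite -[ltLHS](powR_conv t (ltW c0)) ltr_geom// ltW.
- exact: lt_trans cx.
- exact: lt_trans cy.
Qed.

Definition in_frame f (W : 'M[R]_n) (t : T) : \bar R := (f (row_of t *m W))%:E.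

Lemma row_of_comb k (t : R) (x y : k.-tuple mR) :
  row_of (comb t x y) = t *: row_of x + (1 - t) *: row_of y.
Proof. by apply/rowP => j; rewrite !mxE tnth_mktuple. Qed.

Lemma lcv_in_frame f W : log_concave f -> lcv (in_frame f W).
Proof.
move=> lf t x y a b t01 a0 b0; rewrite /in_frame !lte_fin => ax bY.
rewrite lee_fin row_of_comb mulmxDl -!scalemxAl.
apply: le_trans (log_concaveP lf t01 (lt_trans a0 ax) (lt_trans b0 bY)).
by apply: ltW; apply: ltr_geom => //; exact: ltW.
Qed.

Definition bounded_below_on_box f :=
  exists x0 : 'rV[R]_n, exists c : R, exists e : R,
  [/\ 0 < c, 0 < e & forall y, (forall j, `|x0 0 j - y 0 j| < e) -> c < f y].

Lemma mulmx_small (M : 'M[R]_n) (e : R) : 0 < e -> exists2 d : R, 0 < d &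
  forall u : 'rV[R]_n, (forall j, `|u 0 j| < d) -> forall j, `|(u *m M) 0 j| < e.
Proof.
move=> e0; pose K := \sum_i \sum_j `|M i j|.
have K0 : 0 <= K by apply: sumr_ge0 => i _; exact: sumr_ge0.
have K1 : 0 < K + 1 by rewrite ltr_wpDl.
exists (e / (K + 1)); first by rewrite divr_gt0.
move=> u ud j; rewrite mxE; apply: le_lt_trans (ler_norm_sum _ _ _) _.
apply: (@le_lt_trans _ _ (e / (K + 1) * K)).
  rewrite mulr_sumr; apply: ler_sum => i _; rewrite normrM; apply: ler_pM => //.
    exact: ltW.
  by rewrite (bigD1 j)//= lerDl; exact: sumr_ge0.
by rewrite mulrAC ltr_pdivrMr// ltr_pM2l// ltrDl.
Qed.

Lemma box_in_frame f w : rows w \in unitmx -> bounded_below_on_box f ->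
  exists x0 : T, exists c : R, exists e : R,
  [/\ 0 < c, 0 < e & forall y : T, near_box e x0 y -> (c%:E < in_frame f (rows w) y)%E].
Proof.
move=> uW [x0 [c [e [c0 e0 ef]]]].
have [d d0 dW] := mulmx_small (rows w) e0.
exists (of_row (x0 *m invmx (rows w))), c, d; split=> // y yd.
rewrite lte_fin; apply: ef => j.
have -> : x0 0 j - (row_of y *m rows w) 0 j =
    ((x0 *m invmx (rows w) - row_of y) *m rows w) 0 j.
  by rewrite mulmxBl mulmxKV// [RHS]mxE [X in _ = _ + X]mxE.
by apply: dW => i; have := yd i; rewrite tnth_mktuple !mxE.
Qed.

(** Jensen's inequality for superlevel sets, one vertex at a time. *)
Lemma convex_comb_mem f (c : R) x0 (X : 'M[R]_n) (l : seq 'I_n) (s : 'I_n -> R) :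
  log_concave f -> 0 < c -> c < f x0 -> (forall i, c < f (x0 + row i X)) ->
  (forall i, 0 <= s i) -> \sum_(i <- l) s i <= 1 ->
  c < f (x0 + \sum_(i <- l) s i *: row i X).
Proof.
move=> lf c0 cx0 cX; elim: l s => [|i l IH] s s0; first by rewrite !big_nil addr0.
rewrite !big_cons => s1.
have ss0 : 0 <= \sum_(j <- l) s j by exact: sumr_ge0.
have [si0|si0] := eqVneq (s i) 0.
  by rewrite si0 scale0r add0r; apply: IH => //; rewrite si0 add0r in s1.
have [si1|si1] := eqVneq (s i) 1.
  have z0 : \sum_(j <- l) s j == 0.
    by rewrite eq_le ss0 andbT; move: s1; rewrite si1; lra.
  rewrite si1 scale1r big_seq big1 ?addr0// => j jl.
  by have /allP /(_ j jl) /eqP -> := etrans (esym (psumr_eq0 _ (fun i _ => s0 i))) z0; rewrite scale0r.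
have t01 : 0 < s i < 1.
  rewrite lt_neqAle eq_sym si0 s0/= lt_neqAle si1/=.
  by apply: le_trans s1; rewrite lerDl.
have [t0 t1] := andP t01; have t1' : 0 < 1 - s i by rewrite subr_gt0.
have -> : x0 + (s i *: row i X + \sum_(j <- l) s j *: row j X) =
  s i *: (x0 + row i X) + (1 - s i) *: (x0 + \sum_(j <- l) (s j / (1 - s i)) *: row j X).
  rewrite !scalerDr addrACA -scalerDl (_ : s i + (1 - s i) = 1); last by ring.
  rewrite scale1r scaler_sumr; congr (x0 + (_ + _)); apply: eq_bigr => j _; rewrite scalerA mulrC divfK// gt_eqF//.
apply: log_concave_gt => //; apply: IH => [j|]; first by rewrite divr_ge0// ltW.
by rewrite -mulr_suml ler_pdivrMr// mul1r; move: s1; lra.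
Qed.

(** The box is centered at the point whose barycentric coordinates along the
    rows of [X] are all equal to h = 1 / (2 (n + 1)); perturbations of size at
    most h keep them nonnegative with a sum at most 1. *)
Lemma box_of_simplex f x0 (X : 'M[R]_n) : log_concave f -> X \in unitmx -> 0 < f x0 ->
  (forall i, 0 < f (x0 + row i X)) -> bounded_below_on_box f.
Proof.
move=> lf uX fx0 fX.
pose c := (\big[Num.min/f x0]_i f (x0 + row i X)) / 2.
have m0 : 0 < \big[Num.min/f x0]_i f (x0 + row i X).
  by elim/big_rec: _ => // i z _ z0; rewrite lt_min fX.
have c0 : 0 < c by rewrite divr_gt0.
have cm : c < \big[Num.min/f x0]_i f (x0 + row i X) by rewrite /c ltr_pdivrMr// mulr_natr mulr2n ltrDl.
have cx0 : c < f x0 by apply: (lt_le_trans cm); exact: bigmin_le_id.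
have cX i : c < f (x0 + row i X) by apply: (lt_le_trans cm); exact: bigmin_le_cond.
pose h : R := (n.+1%:R * 2)^-1.
have h0 : 0 < h by rewrite invr_gt0 mulr_gt0.
have [d d0 dX] := mulmx_small (invmx X) h0.
exists (x0 + const_mx h *m X), c, d; split=> // y yd.
pose s i := ((y - x0) *m invmx X) 0 i.
have -> : y = x0 + \sum_i s i *: row i X.
  transitivity (x0 + (y - x0) *m invmx X *m X); first by rewrite mulmxKV// addrC subrK.
  by rewrite mulmx_sum_row.
have sh i : `|h - s i| < h.
  have -> : h - s i = ((x0 + const_mx h *m X - y) *m invmx X) 0 i.
    have -> : x0 + const_mx h *m X - y = const_mx h *m X - (y - x0).
      by rewrite opprB addrCA addrA.
    rewrite mulmxBl mulmxK// [RHS]mxE; congr (_ + _); first by rewrite mxE.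
    by rewrite [RHS]mxE.
  by apply: dX => j; have := yd j; rewrite [X in _ -> `|X| < _]mxE [X in _ -> `|_ + X| < _]mxE.
apply: convex_comb_mem => // [i|].
  by have := sh i; rewrite ltr_norml => /andP[_]; lra.
apply: (@le_trans _ _ (\sum_(i < n) (2 * h))).
  by apply: ler_sum => i _; have := sh i; rewrite ltr_norml => /andP[]; lra.
rewrite sumr_const card_ord (_ : 2 * h = n.+1%:R^-1); last first.
  by rewrite /h invfM mulrC divfK.
by rewrite -[_ *+ n]mulr_natl ler_pdivrMr// mul1r ler_nat.
Qed.

(** A log-concave function either is bounded below on a box or vanishes off a
    hyperplane, since otherwise its support contains a nondegenerate simplex. *)
Lemma box_or_hyperplane f x0 : log_concave f -> 0 < f x0 ->
  bounded_below_on_box f \/ exists2 a : 'rV[R]_n, a != 0 &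
    forall x, 0 < f x -> dotr a x = dotr a x0.
Proof.
move=> lf fx0; apply: contrapT => /not_orP[nb nh].
(* as long as the support lies in no hyperplane, k independent vectors from x0
   to points of the support can be completed by another one *)
have step k : (k <= n)%N -> exists2 X : 'M[R]_(k, n), row_free X &
    forall i, 0 < f (x0 + row i X).
  elim: k => [_|k IH kn].
    by exists 0; [rewrite /row_free mxrank0|move=> []].
  have [X fX Xf] := IH (ltnW kn).
  have : kermx X^T != 0.
    rewrite kermx_eq0 /row_free mxrank_tr (eqP fX); by rewrite ltn_eqF.
  move=> /rowV0Pn[a /sub_kermxP aX a0].
  have [x fx ax] : exists2 x, 0 < f x & dotr a (x - x0) != 0.
    apply: contrapT => hN; apply: nh; exists a => // x fx.
    have [/eqP|] := eqVneq (dotr a (x - x0)) 0; last by move=> ax; exfalso; apply: hN; exists x.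
    by rewrite dotrD -scaleN1r dotrZ mulN1r subr_eq0 => /eqP.
  have Xa : X *m a^T = 0 by apply: trmx_inj; rewrite trmx_mul trmxK trmx0.
  exists (col_mx (x - x0) X : 'M[R]_(1 + k, n)) => /=.
    apply: (@inj_row_free _ (1 + k) n) => u; rewrite -[u](@hsubmxK _ 1 1 k) mul_row_col => u0.
    have := congr1 (fun v => v *m a^T) u0.
    rewrite mul0mx mulmxDl -!mulmxA Xa mulmx0 addr0 dotrE dotrC => /rowP /(_ 0).
    rewrite mul_mx_scalar !mxE => /eqP; rewrite mulf_eq0 (negbTE ax)/= => /eqP u1.
    have {}u1 : lsubmx (u : 'rV[R]_(1 + k)) = 0.
      by apply/rowP => b; rewrite [RHS]mxE ord1 -[RHS]u1 mxE.
    move: u0; rewrite u1 mul0mx add0r => u2.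
    have -> : rsubmx (u : 'rV[R]_(1 + k)) = 0 by apply: (row_free_inj fX); rewrite u2 mul0mx.
    by rewrite row_mx0.
  move=> i; case: (@splitP 1 k i) => b ib.
    have -> : row i (col_mx (x - x0) X) = x - x0.
      have -> : i = lshift k b by exact: val_inj.
      by apply/rowP => a'; rewrite [LHS]mxE [LHS](col_mxEu (x - x0) X) ord1.
    by rewrite addrC subrK.
  have -> : row i (col_mx (x - x0) X) = row b X.
    have -> : i = rshift 1 b by exact: val_inj.
    by apply/rowP => a'; rewrite [LHS]mxE [LHS](col_mxEd (x - x0) X) mxE.
  exact: Xf.
have [X fX Xf] := step n (leqnn n).
by apply: nb; apply: (@box_of_simplex f x0 X) => //; rewrite -row_free_unit.
Qed.

End log_concave.

Section integrals.
Context {R : realType} {n : nat}.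
Local Notation mR := (measurableTypeR R).
Local Notation T := (n.-tuple mR).
Implicit Types (f : 'rV[R]_n -> R) (w : 'I_n -> 'rV[R]_n) (A : {set 'I_n}).

(** A coordinate with a nonzero coefficient is determined by the others, so
    integrating over it first gives 0. *)
Lemma iint_hyperplane (a : 'rV[R]_n) (b : R) (P := fun t : T => dotr a (row_of t) == b) x :
  a != 0 -> nnm (fun t => (P t)%:R%:E) /\ iint (enum 'I_n) (fun t => (P t)%:R%:E) x = 0%E.
Proof.
move=> a0; have [i ai] : exists i, a 0 i != 0.
  by apply/existsP; apply: contraNT a0 => /existsPn h; apply/eqP/rowP => i; rewrite mxE; apply/eqP; have := h i; rewrite negbK.
have nP : nnm (fun t => (P t)%:R%:E).
  split; last by move=> t; rewrite lee_fin ler0n.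
  have mf : measurable_fun setT (fun t : T => \sum_j a 0 j * tnth t j : mR).
    by apply: measurable_sum => j; apply: measurable_funM => //; exact: measurable_tnth.
  rewrite (_ : (fun t => _) = EFin \o \1_(setT `&` (fun t : T => \sum_j a 0 j * tnth t j : mR) @^-1` [set b])).
    by apply/measurable_EFinP/measurable_indic; apply: mf.
  apply/funext => t; rewrite /= indicE setTI; congr (_%:R%:E); congr nat_of_bool.
  rewrite /P (_ : dotr a (row_of t) = \sum_j a 0 j * tnth t j); last first.
    by apply: eq_bigr => j _; rewrite mxE.
  by apply/eqP/idP => [h|]; rewrite inE.
split=> //.
have pl : perm_eq (enum 'I_n) (rem i (enum 'I_n) ++ [:: i]).
  by rewrite perm_sym perm_catC perm_sym; apply: perm_to_rem; rewrite mem_enum.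
rewrite (perm_iint nP pl) iint_cat; apply: iint_eq0 => y _ /=; rewrite /int1.
(* the only value of the coordinate i on the hyperplane *)
pose r0 := (b - \sum_(j | j != i) a 0 j * tnth y j) / a 0 i.
transitivity (\int[@lebesgue_measure R]_r (\1_[set r0 : mR] r)%:E)%E.
  apply: eq_integral => r _; rewrite indicE; congr (_%:R%:E); congr nat_of_bool.
  rewrite /P /dotr (bigD1 i)//= mxE tnth_upd eqxx.
  rewrite (eq_bigr (fun j => a 0 j * tnth y j)); last first.
    by move=> j /negbTE ji; rewrite mxE tnth_upd ji.
  apply/eqP/idP; rewrite inE /= /r0.
    by move=> <-; rewrite addrK mulrC mulKf.
  by move=> ->; rewrite mulrC divfK// subrK.
by rewrite integral_indic// setIT /=; exact: lebesgue_measure_set1.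
Qed.

(** The integrand is at most [+oo] times the indicator of a hyperplane. *)
Lemma norm1_degenerate f : log_concave f -> ~ bounded_below_on_box f -> norm1 f = 0%E.
Proof.
move=> lf nb; have [[x0 fx0]|nf] := pselect (exists x, 0 < f x); last first.
  apply: integral0_eq => t _; apply/eqP; rewrite eqe eq_le log_concave_ge0// andbT leNgt.
  by apply/negP => h; apply: nf; exists (row_of t).
have [//|[a a0 fa]] := box_or_hyperplane lf fx0.
have [nP IP] := iint_hyperplane (dotr a x0) origin a0.
set P := (fun t => _) in nP IP.
have nooP : nnm (fun t : T => +oo * P t)%E.
  split; last by move=> t; rewrite mule_ge0// nP.2.
  by apply: emeasurable_funM; [exact: measurable_cst|exact: nP.1].
apply/eqP; rewrite eq_le integral_ge0 ?andbT; last first.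
  by move=> t _; rewrite lee_fin log_concave_ge0.
apply: (@le_trans _ _ (\int[lebesgue n]_t (+oo * P t))%E).
  apply: le_integral_ge0 => t; first by rewrite lee_fin log_concave_ge0.
  have [ft|ft] := ltP 0 (f (row_of t)); last first.
    by apply: (@le_trans _ _ 0%E); [rewrite lee_fin|rewrite mule_ge0// nP.2].
  by rewrite /P fa// eqxx mule1 leey.
rewrite integral_lebesgue// (integral_product_lebesgue origin)// iintZl// IP mule0//.
Qed.

Lemma measurable_of_row k (B : 'M[R]_(k, n)) :
  measurable_fun setT (fun s : k.-tuple mR => of_row (row_of s *m B) : T).
Proof.
apply/measurable_fun_tnthP => j.
rewrite (_ : _ \o _ = fun s : k.-tuple mR => \sum_i tnth s i * B i j); last first.
  by apply/funext => s /=; rewrite tnth_mktuple mxE; apply: eq_bigr => i _; rewrite mxE.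
by apply: measurable_sum => i; apply: measurable_funM => //; exact: measurable_tnth.
Qed.

Section frame.
Variables (f : 'rV[R]_n -> R) (w : 'I_n -> 'rV[R]_n).
Hypotheses (lf : log_concave f) (uW : rows w \in unitmx).
Let W := rows w.

(** The Borel substitute for [f], in the coordinates of the frame [w]. *)
Definition frame_reg := lscreg (in_frame f (rows w)).

Lemma in_frame_ge0 t : (0 <= in_frame f W t)%E.
Proof. by rewrite lee_fin log_concave_ge0. Qed.

Lemma reg_frame_reg : reg frame_reg.
Proof. by apply: reg_lscreg; [exact: in_frame_ge0|exact: lcv_in_frame]. Qed.

(** The form in which [lscreg_comb] enters [integral_lebesgue_ub]. *)
Lemma frame_reg_comb : bounded_below_on_box f -> exists x0 : T, exists2 c : R, 0 < c &
  forall (t : R) (x : T) (a : R), 0 < t < 1 -> 0 < a -> (a%:E < in_frame f W x)%E ->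
    ((a `^ t * c `^ (1 - t))%:E <= frame_reg (comb t x x0))%E.
Proof.
move=> /(box_in_frame uW)[x0 [c [e [c0 e0 ef]]]]; exists x0, c => // t x a t01 a0 ax.
by apply: (lscreg_comb _ t01 a0 c0 e0 ef ax); exact: lcv_in_frame.
Qed.

Lemma iint_act_invW (g : T -> \bar R) : nnm g ->
  iint (enum 'I_n) (g \o act (invmx W)) origin = (`|\det W|%:E * iint (enum 'I_n) g origin)%E.
Proof.
move=> ng.
have e0 : enum (~: (finset.set0 : {set 'I_n})) = enum 'I_n by rewrite finset.setC0; apply: eq_enum => i; rewrite inE.
have uV : invmx W \in unitmx by rewrite unitmx_inv.
have h0 : forall i, i \in (finset.set0 : {set 'I_n}) -> row i (invmx W) = delta_mx 0 i.
  by move=> i; rewrite inE.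
have h1 : indeps finset.set0 g by move=> i; rewrite inE.
have := change_of_variables h0 uV ng h1 origin; rewrite e0 => <-.
rewrite muleA -EFinM -normrM det_inv mulrV ?normr1 ?mul1e// -unitmxE.
Qed.

(** The regularization is a Borel minorant, which gives the lower bound;
    [integral_lebesgue_ub] gives the upper bound. *)
Theorem norm1E : bounded_below_on_box f ->
  norm1 f = (`|\det W|%:E * iint (enum 'I_n) frame_reg origin)%E.
Proof.
move=> bf; have ng : nnm frame_reg by apply: reg_nnm; exact: reg_frame_reg.
have ngW : nnm (frame_reg \o act (invmx W)).
  split; last by move=> x; exact: ng.2.
  by apply: measurableT_comp; [exact: ng.1|exact: measurable_act].
rewrite -iint_act_invW// -(integral_product_lebesgue origin)//.
have fE t : (f (row_of t))%:E = in_frame f W (act (invmx W) t).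
  by rewrite /in_frame row_of_act mulmxKV.
apply/eqP; rewrite eq_le; apply/andP; split; last first.
  rewrite -integral_lebesgue//; apply: le_integral_ge0 => t; first exact: ngW.2.
  by rewrite fE; exact: lscreg_le.
have [x0 [c c0 h]] := frame_reg_comb bf.
apply: (@integral_lebesgue_ub _ _ _ _ (act W x0) c) => //.
  by move=> t; rewrite fE in_frame_ge0.
move=> t y a t01 a0; rewrite fE => ay /=.
have -> : act (invmx W) (comb t y (act W x0)) = comb t (act (invmx W) y) x0.
  apply: (can_inj (@row_ofK _ _)); rewrite row_of_act !row_of_comb mulmxDl -!scalemxAl.
  by rewrite !row_of_act mulmxK.
exact: h.
Qed.

Variable A : {set 'I_n}.
Let F := orthocomp (wspan w A).
Let E := orthonormal_basis F.
Let g (s : (\dim F).-tuple mR) := msup A frame_reg (of_row (row_of s *m (E *m invmx W))).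

Let rM : reg (msup A frame_reg). Proof. by apply: reg_msup; exact: reg_frame_reg. Qed.

Let ng : nnm g.
Proof.
split; last by move=> s; rewrite /g; have [] := rM.
by apply: measurableT_comp; [exact: (reg_nnm rM).1|exact: measurable_of_row].
Qed.

Let wedge_gt0 : 0 < wedge_norm w A. Proof. by have [] := wedge_normE A uW. Qed.

Let integral_g : (\int[product_lebesgue (\dim F)]_s g s =
  (`|\det W| / wedge_norm w A)%:E * iint (enum (~: A)) (msup A frame_reg) origin)%E.
Proof.
have [X [l [[ul lA] uX AX XX lX]]] := frame_exists A uW.
have dX : `|\det X| = wedge_norm w A.
  have [_ v2] := wedge_normE A uW.
  have : `|\det X| ^+ 2 = wedge_norm w A ^+ 2.
    by rewrite v2 (det_gram_frame XX) -normrX ger0_norm ?sqr_ge0.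
  by move/eqP; rewrite eqrXn2 ?(ltW wedge_gt0)// => /eqP.
rewrite (integral_coords origin ul ng).
(* x *m N is the vector of coordinates in the frame w of the point with
   coordinates x in the frame X *)
pose N := X *m invmx W.
have AN : dsel A *m N = dsel A by rewrite /N mulmxA AX mulmxK.
have -> : g \o coords l = msup A frame_reg \o act N.
  apply/funext => x /=; rewrite /g; apply: msup_agree => j jA.
  rewrite !tnth_mktuple row_of_coords mulmxA -[_ *m _ *m E]mulmxA lX.
  have -> : row_of x *m N = row_of x *m dsel A + row_of x *m (dsel (~: A) *m X) *m invmx W.
    rewrite -[in LHS](mul1mx N) -(dselC A) mulmxDl mulmxDr AN; congr (_ + _).
    by rewrite /N !mulmxA.
  by rewrite [RHS]mxE mul_dselE (negbTE jA) mulr0 add0r.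
have Nrow i : i \in A -> row i N = delta_mx 0 i.
  move=> iA; have -> : row i N = row i (dsel A *m N) by rewrite row_dsel iA.
  by rewrite AN -[dsel A]mulmx1 row_dsel iA row1.
have uN : N \in unitmx by rewrite unitmx_mul uX unitmx_inv.
have iM : indeps A (msup A frame_reg).
  move=> i iA x r; apply: msup_agree => j jA; rewrite tnth_upd.
  by case: eqP => // ji; rewrite ji iA in jA.
have nM := reg_nnm rM.
rewrite -(change_of_variables Nrow uN nM iM origin).
have W0 : `|\det W| != 0 by rewrite normr_eq0 -unitfE -unitmxE.
rewrite muleA -EFinM det_mulmx det_inv normrM dX normfV.
have -> : `|\det W| / wedge_norm w A * (wedge_norm w A / `|\det W|) = 1.
  by field; rewrite W0 gt_eqF.
rewrite mul1e (perm_iint (l' := l))//; last first.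
    by apply: uniq_perm => //; [exact: enum_uniq|move=> j; rewrite mem_enum lA].
  split; last by move=> x; exact: nM.2.
  by apply: measurableT_comp; [exact: nM.1|exact: measurable_act].
Qed.

Let fiber s : (g s <= proj_fun F f (row_of s *m E))%E.
Proof.
apply: ge_ereal_sup => _ [y xy <-]; apply: le_trans (lscreg_le _ _) _.
apply: ereal_sup_ubound; exists (row_of y *m W - row_of s *m E); last first.
  by rewrite addrC subrK.
rewrite /= orthocompK; apply/mem_wspan; exists (row_of y - row_of s *m (E *m invmx W)).
have -> : row_of y *m W - row_of s *m E = (row_of y - row_of s *m (E *m invmx W)) *m W.
  by rewrite mulmxBl [in RHS]mulmxA mulmxKV.
congr (_ *m _); apply/rowP => j; rewrite mul_dselE.
have [jA|jA] := boolP (j \in A); first by rewrite mulr1.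
have := xy j jA; rewrite tnth_mktuple => h.
by rewrite mulr0 [LHS]mxE [X in X + _]mxE -h [X in _ + X]mxE subrr.
Qed.

(** The projection of [frame_reg] is a Borel minorant of that of [f]. *)
Theorem norm1_proj_ge :
  ((`|\det W| / wedge_norm w A)%:E * iint (enum (~: A)) (msup A frame_reg) origin
    <= norm1_proj F f)%E.
Proof.
rewrite -integral_g -(integral_lebesgue ng); apply: le_integral_ge0 => s; first exact: ng.2.
exact: fiber.
Qed.

(** Contracting toward the center of a box commutes with projecting, so that
    [integral_lebesgue_ub] also applies to projections. *)
Theorem norm1_projE : bounded_below_on_box f ->
  norm1_proj F f =
  ((`|\det W| / wedge_norm w A)%:E * iint (enum (~: A)) (msup A frame_reg) origin)%E.
Proof.
move=> bf; apply/eqP; rewrite eq_le norm1_proj_ge andbT -integral_g.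
have [x0 [c c0 h]] := frame_reg_comb bf.
have [EE EP] := orthonormal_basisP F; rewrite -/E in EE EP.
(* the orthogonal projection of the center of the box to F, in the orthonormal
   basis *)
pose s0 : (\dim F).-tuple mR := of_row (row_of x0 *m W *m E^T).
apply: (@integral_lebesgue_ub _ _ _ _ s0 c) => //.
  by move=> s; apply: le_trans (ng.2 s) _; exact: fiber.
move=> t s a t01 a0 /ereal_sup_gt[_ [z zH <-]] az.
pose x := of_row ((row_of s *m E + z) *m invmx W).
have ax : (a%:E < in_frame f W x)%E by rewrite /in_frame of_rowK mulmxKV.
apply: le_trans (h t x a t01 a0 ax) _; apply: msup_ge => j jA.
rewrite tnth_mktuple row_of_comb of_rowK.
have zw : z \in wspan w A by rewrite -[wspan w A]orthocompK.
have z0w : row_of x0 *m W - row_of x0 *m W *m E^T *m E \in wspan w A.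
  rewrite -[wspan w A]orthocompK; apply/mem_orthocomp => y /EP[u ->]; apply/eqP.
  suff : (row_of x0 *m W - row_of x0 *m W *m E^T *m E) *m (u *m E)^T = 0.
    by move/matrixP => /(_ 0 0); rewrite dotrE mxE mulr1n mxE => /eqP.
  rewrite trmx_mul mulmxA mulmxBl -[row_of x0 *m W *m E^T *m E *m E^T]mulmxA EE mulmx1.
  by rewrite subrr mul0mx.
move: zw z0w => /mem_wspan[u zu] /mem_wspan[u0 zu0].
have x0E : row_of x0 = (row_of x0 *m W *m E^T *m E + u0 *m dsel A *m W) *m invmx W.
  by rewrite -zu0 addrC subrK mulmxK.
move: x0E; set e0 := row_of x0 *m W *m E^T => x0E.
have -> : comb t x x0 = of_row ((t *: row_of s + (1 - t) *: e0) *m (E *m invmx W)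
     + (t *: u + (1 - t) *: u0) *m dsel A).
  apply: (can_inj (@row_ofK _ _)); rewrite row_of_comb !of_rowK zu -/W x0E.
  have h1 (v v' : 'rV[R]_n) : (v + v' *m dsel A *m W) *m invmx W = v *m invmx W + v' *m dsel A.
    by rewrite mulmxDl mulmxK.
  by rewrite !h1 !scalerDr addrACA !mulmxDl -!scalemxAl !mulmxA.
by rewrite [RHS]tnth_mktuple [RHS]mxE mul_dselE (negbTE jA) mulr0 addr0.
Qed.

End frame.
End integrals.

(** * The four inequalities *)

Section first_inequality.
Context {R : realType} {n : nat}.
Implicit Types (f : 'rV[R]_n -> R) (w : 'I_n -> 'rV[R]_n) (S A : {set 'I_n}).
Local Open Scope ereal_scope.

Lemma poweR_prod (I : Type) (r : seq I) (x : I -> \bar R) (a : R) :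
  (forall i, 0 <= x i) -> (\prod_(i <- r) x i) `^ a = \prod_(i <- r) x i `^ a.
Proof.
move=> x0; suff [] : 0 <= \prod_(i <- r) x i /\ (\prod_(i <- r) x i) `^ a = \prod_(i <- r) x i `^ a by [].
elim/big_rec2: _ => [|i y z _ [z0 <-]]; first by rewrite poweR1r lee_fin ler01.
by rewrite mule_ge0// poweRM.
Qed.

Lemma powR_prod (I : Type) (r : seq I) (x : I -> R) (a : R) :
  (forall i, 0 <= x i)%R -> ((\prod_(i <- r) x i) `^ a = \prod_(i <- r) x i `^ a)%R.
Proof.
move=> x0; suff [] : (0 <= \prod_(i <- r) x i)%R /\
    ((\prod_(i <- r) x i) `^ a = \prod_(i <- r) x i `^ a)%R by [].
elim/big_rec2: _ => [|i y z _ [z0 <-]]; first by rewrite powR1 ler01.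
by rewrite mulr_ge0// powRM.
Qed.

Lemma prod_poweR (I : finType) (q : I -> R) (x : \bar R) (i0 : I) : 0 <= x ->
  (forall j, 0 < q j)%R -> \prod_j x `^ q j = x `^ (\sum_j q j).
Proof.
move=> x0 q0; have sq i : (0 < q i + \sum_(j | j != i) q j)%R.
  by rewrite ltr_pwDl// sumr_ge0// => j _; exact: ltW.
have S0 : (\sum_j q j != 0)%R by rewrite (bigD1 i0)//= gt_eqF.
have [->|xN0] := eqVneq x 0.
  rewrite poweR0r// (bigD1 i0)// poweR0r ?gt_eqF//; exact: mul0e.
rewrite (_ : x `^ _ = \prod_j x `^ q j)//.
suff [] : (0 <= \sum_j q j)%R /\ x `^ (\sum_j q j) = \prod_j x `^ q j by [].
elim/big_rec2: _ => [|i y z _ [z0 <-]]; first by rewrite poweRe0.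
split; first by rewrite addr_ge0// ltW.
by rewrite poweRD// nneg_neq0_poweRD_def// ltW.
Qed.

Lemma norm1_fin f : integrable_log_concave f -> norm1 f < +oo.
Proof. by move=> [_ fi]; apply: integrable_lty fi. Qed.

Lemma norm1_ge0 f : log_concave f -> 0 <= norm1 f.
Proof. by move=> lf; apply: integral_ge0 => t _; rewrite lee_fin log_concave_ge0. Qed.

Lemma norm1_proj_ge0 f F : log_concave f -> 0 <= norm1_proj F f.
Proof.
move=> lf; apply: integral_ge0 => t _.
apply: (@le_trans _ _ (f (subspace_point t + 0))%:E); first by rewrite lee_fin log_concave_ge0.
by apply: ereal_sup_ubound; exists 0%R => //=; rewrite mem0v.
Qed.

Lemma wedge_norm0 w : rows w \in unitmx -> wedge_norm w finset.set0 = 1%R.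
Proof.
move=> uW; have [v0] := wedge_normE finset.set0 uW.
have -> : gram w finset.set0 = 1%:M.
  by rewrite /gram dsel0 !mul0mx add0r -(dselC finset.set0) dsel0 add0r.
by rewrite det1 => /eqP; rewrite sqrf_eq1 => /orP[/eqP//|/eqP h]; move: v0; rewrite h oppr_gt0 ltr10.
Qed.

Lemma margT (S : {set 'I_n}) G : marg S G S = iint (enum 'I_n) G (origin : n.-tuple (measurableTypeR R)).
Proof.
rewrite /marg finset.setUCr finset.setDv; congr (iint _ _ _).
  by apply: eq_enum => i; rewrite !inE.
apply/funext => x; apply/eqP; rewrite eq_le; apply/andP; split; last exact: msup_ge.
apply: ge_ereal_sup => _ [y xy <-]; rewrite (_ : x = y)//.
by apply: eq_from_tnth => j; apply: xy; rewrite inE.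
Qed.

(** The inequality for one frame. The factors [`|\det W|] of the exact formulas
    cancel because the exponents [q j] sum to [p]. *)
Theorem first_inequality w S m (C : 'I_m -> {set 'I_n}) (q : 'I_m -> R) f (p := (\sum_j q j)%R) :
  rows w \in unitmx -> uniform_cover S C q -> integrable_log_concave f -> (0 < #|S|)%N ->
  norm1_proj (orthocomp (wspan w S)) f `^ (p - 1) * norm1 f <=
  (((#|S|)`!%:R * \prod_j wedge_norm w (S :\: C j) `^ q j) /
   (wedge_norm w S `^ (p - 1) * \prod_j (#|C j|)`!%:R `^ q j))%R%:E *
  \prod_j norm1_proj (orthocomp (wspan w (S :\: C j))) f `^ q j.
Proof.
move=> uW [m0 CS q0 cover] fi d0; have [lf _] := fi.
have [bf|nb] := pselect (bounded_below_on_box f); last first.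
  rewrite norm1_degenerate// mule0; apply: mule_ge0; last first.
    by apply: prode_ge0 => j _; exact: poweR_ge0.
  rewrite lee_fin divr_ge0// mulr_ge0 ?powR_ge0//; apply: prodr_ge0 => j _; exact: powR_ge0.
have vgt0 A : (0 < wedge_norm w A)%R by have [] := wedge_normE A uW.
set D := (`|\det (rows w)|)%R.
have D0 : (0 < D)%R by rewrite normr_gt0 -unitfE -unitmxE.
set G := frame_reg f w; have rG : reg G by exact: reg_frame_reg.
have mge0 A : 0 <= marg S G A by apply: iint_ge0; apply: msup_ge0; have [] := rG.
have margE A : A \subset S -> norm1_proj (orthocomp (wspan w (S :\: A))) f =
    (D / wedge_norm w (S :\: A))%:E * marg S G A.
  by move=> AS; rewrite norm1_projE// /marg finset.setCD finset.setUC.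
have nE : norm1 f = D%:E * marg S G S by rewrite (norm1E lf uW bf) margT.
have mfin : marg S G S < +oo.
  have := norm1_fin fi; rewrite nE; move: (mge0 S); case: (marg S G S) => [r _ _|_|//]; first exact: ltry.
  by rewrite gt0_muley// ltxx.
rewrite nE -[wspan w S]/(wspan w S) -{1}(finset.setD0 S) margE ?finset.sub0set// finset.setD0.
rewrite poweRM//; last by rewrite lee_fin divr_ge0// ltW.
rewrite poweR_EFin muleACA -EFinM.
apply: le_trans (_ : _ <= ((D / wedge_norm w S) `^ (p - 1) * D)%:E *
   (((#|S|)`!%:R / \prod_j (#|C j|)`!%:R `^ q j)%R%:E * \prod_j marg S G (C j) `^ q j)) _.
  apply: lee_wpmul2l; last exact: marg_ineq_reg.
  by rewrite lee_fin mulr_ge0 ?powR_ge0// ltW.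
have -> : \prod_j norm1_proj (orthocomp (wspan w (S :\: C j))) f `^ q j =
    (\prod_j (D / wedge_norm w (S :\: C j)) `^ q j)%R%:E * \prod_j marg S G (C j) `^ q j.
  rewrite -prodEFin -big_split/=; apply: eq_bigr => j _.
  by rewrite margE// poweRM// lee_fin divr_ge0// ltW.
rewrite !muleA -!EFinM; apply: lee_wpmul2r.
  by apply: prode_ge0 => j _; exact: poweR_ge0.
rewrite lee_fin le_eqVlt; apply/orP; left; apply/eqP.
have F0 : (0 < \prod_j (#|C j|)`!%:R `^ q j :> R)%R.
  by apply: prodr_gt0 => j _; rewrite powR_gt0// ltr0n fact_gt0.
have V0 : (0 < \prod_j wedge_norm w (S :\: C j) `^ q j)%R.
  by apply: prodr_gt0 => j _; rewrite powR_gt0.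
have -> : (\prod_j (D / wedge_norm w (S :\: C j)) `^ q j =
   D `^ p / \prod_j wedge_norm w (S :\: C j) `^ q j)%R.
  rewrite /p powR_sumr// -prodf_div; apply: eq_bigr => j _.
  rewrite powRM ?invr_ge0 ?(ltW D0) ?(ltW (vgt0 _))//; congr (_ * _)%R.
  by rewrite -powR_inv1 ?(ltW (vgt0 _))// -powRrM mulN1r powRN.
have -> : ((D / wedge_norm w S) `^ (p - 1) = D `^ (p - 1) / wedge_norm w S `^ (p - 1))%R.
  rewrite powRM ?invr_ge0 ?(ltW D0) ?(ltW (vgt0 _))//; congr (_ * _)%R.
  by rewrite -powR_inv1 ?(ltW (vgt0 _))// -powRrM mulN1r powRN.
have -> : (D `^ p = D `^ (p - 1) * D)%R.
  by rewrite -{3}(powRr1 (ltW D0)) -powRD ?subrK// (gt_eqF D0) implybT.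
have vS0 : (0 < wedge_norm w S `^ (p - 1))%R by rewrite powR_gt0.
by field; rewrite !gt_eqF.
Qed.

(** The first inequality for the complementary cover [S :\: C j] with weights
    [q j / (p - 1)], raised to the power [p - 1]. *)
Lemma complement_inequality (S : {set 'I_n}) (V : {set 'I_n} -> R)
    (Pr : {set 'I_n} -> \bar R) (a : \bar R) :
  (forall A, 0 < V A)%R -> (forall A, 0 <= Pr A) -> 0 <= a -> (0 < #|S|)%N ->
  (forall m (C : 'I_m -> {set 'I_n}) (q : 'I_m -> R), uniform_cover S C q ->
    Pr finset.set0 `^ (\sum_j q j - 1) * a <=
    (((#|S|)`!%:R * \prod_j V (S :\: C j) `^ q j) /
      (V S `^ (\sum_j q j - 1) * \prod_j (#|C j|)`!%:R `^ q j))%R%:E *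
    \prod_j Pr (C j) `^ q j) ->
  forall m (C : 'I_m -> {set 'I_n}) (q : 'I_m -> R), uniform_cover S C q ->
    Pr finset.set0 * a `^ (\sum_j q j - 1) <=
    (((#|S|)`!%:R `^ (\sum_j q j - 1) * \prod_j V (C j) `^ q j) /
      (V S * \prod_j (#|S| - #|C j|)`!%:R `^ q j))%R%:E *
    \prod_j Pr (S :\: C j) `^ q j.
Proof.
move=> V0 Pr0 a0 d0 ineq m C q [m0 CS q0 cover].
set p := (\sum_j q j)%R; pose r := (p - 1)%R.
have /card_gt0P[i0 i0S] := d0; have j0 : 'I_m by case: (m) m0 => // ? _; exact: ord0.
have F0 k : (0 < k`!%:R :> R)%R by rewrite ltr0n fact_gt0.
have p1 : (1 <= p)%R.
  rewrite -(cover i0 i0S); apply: ler_sum => j _.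
  by case: (i0 \in C j); rewrite ?mulr1// mulr0 ltW.
move: p1; rewrite le_eqVlt => /orP[/eqP p1|p1].
  have CSE j : C j = S.
    apply/eqP; rewrite finset.eqEsubset CS; apply/fintype.subsetP => i iS.
    have h : (\sum_j q j * (1 - (i \in C j)%:R) == 0)%R.
      under eq_bigr do rewrite mulrBr mulr1.
      by rewrite sumrB (cover i iS) -/p -p1 subrr.
    move: h; rewrite psumr_eq0 => [/allP /(_ j)|j' _]; last first.
      by rewrite mulr_ge0 ?(ltW (q0 _))//; case: (i \in C j'); rewrite ?subrr// subr0.
    rewrite mem_index_enum mulf_eq0 gt_eqF//= => /(_ isT).
    by case: (i \in C j) => //; rewrite subr0 oner_eq0.
  have -> : C = fun=> S by apply/funext.
  rewrite -p1 subrr poweRe0 mule1 powRr0 mul1r subnn finset.setDv (prod_poweR j0)//.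
  rewrite -powR_sumr// -/p -p1 poweRe1// powRr1 ?(ltW (V0 _))//.
  have -> : (\prod_(j < m) 0`!%:R `^ q j = 1 :> R)%R.
    by apply: big1 => j _; rewrite fact0 powR1.
  by rewrite mulr1 divff ?mul1e// gt_eqF.
have r0 : (0 < r)%R by rewrite subr_gt0.
pose C' j := (S :\: C j)%SET; pose q' j := (q j / r)%R.
have sq' : (\sum_j q' j = p / r)%R by rewrite mulr_suml.
have sq1 : (\sum_j q' j - 1 = r^-1)%R.
  by rewrite sq' -(divff (x := r)) ?gt_eqF// -mulrBl /r opprB addrC subrK mul1r.
have cover' : uniform_cover S C' q'.
  split=> // [j|j|i iS]; first exact: finset.subsetDl.
    by rewrite divr_gt0.
  rewrite (eq_bigr (fun j => (q j - q j * (i \in C j)%:R) / r)%R) => [|j _]; last first.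
    rewrite !inE iS andbT /q'; case: (i \in C j) => /=; first by rewrite mulr0 mulr1 subrr mul0r.
    by rewrite mulr0 subr0 mulr1.
  by rewrite -mulr_suml sumrB (cover i iS) divff// gt_eqF.
have CC j : (S :\: C' j = C j)%SET.
  by rewrite /C' finset.setDDr finset.setDv finset.set0U; apply/finset.setIidPr.
have cC j : #|C' j| = (#|S| - #|C j|)%N.
  by rewrite /C' finset.cardsD (finset.setIidPr (CS j)).
have := ineq m C' q' cover'; rewrite sq1.
have -> : (\prod_j V (S :\: C' j) `^ q' j = \prod_j V (C j) `^ q' j)%R.
  by apply: eq_bigr => j _; rewrite CC.
have -> : (\prod_j (#|C' j|)`!%:R `^ q' j = \prod_j (#|S| - #|C j|)`!%:R `^ q' j :> R)%R.
  by apply: eq_bigr => j _; rewrite cC.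
set K := (_ / _)%R; set Q := \prod_j _ => h.
have K0 : (0 <= K)%R.
  rewrite divr_ge0// mulr_ge0 ?powR_ge0//; apply: prodr_ge0 => j _; exact: powR_ge0.
have Q0 : 0 <= Q by apply: prode_ge0 => j _; exact: poweR_ge0.
have {h} : (Pr finset.set0 `^ r^-1 * a) `^ r <= (K%:E * Q) `^ r.
  apply: gt0_ler_poweR => //; first exact: ltW.
  - by rewrite in_itv/= leey andbT mule_ge0// poweR_ge0.
  - by rewrite in_itv/= leey andbT mule_ge0.
rewrite !poweRM ?poweR_ge0// -poweRrM mulVf ?gt_eqF// poweRe1// => h.
apply: (le_trans h); rewrite poweR_EFin poweR_prod; last by move=> j; exact: poweR_ge0.
rewrite (eq_bigr (fun j => Pr (S :\: C j) `^ q j)) => [|j _]; last first.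
  by rewrite -poweRrM /q' divfK// gt_eqF.
apply: lee_wpmul2r; first by apply: prode_ge0 => j _; exact: poweR_ge0.
rewrite lee_fin le_eqVlt; apply/orP; left; apply/eqP.
have pw0 (x : 'I_m -> R) : (forall j, 0 < x j)%R ->
    ((\prod_j x j `^ q' j) `^ r = \prod_j x j `^ q j)%R.
  move=> x0; rewrite powR_prod => [|j]; last exact: powR_ge0.
  by apply: eq_bigr => j _; rewrite -powRrM /q' divfK// gt_eqF.
have pr0 (x : 'I_m -> R) : (0 <= \prod_j x j `^ q' j)%R.
  by apply: prodr_ge0 => j _; exact: powR_ge0.
rewrite /K powRM ?invr_ge0 ?mulr_ge0 ?powR_ge0//.
rewrite powRM// pw0//; congr (_ * _)%R.
rewrite -powR_inv1 ?mulr_ge0 ?powR_ge0// -powRrM mulN1r powRN; congr (_^-1)%R.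
rewrite powRM ?powR_ge0// pw0// -powRrM mulVf ?gt_eqF// powRr1// ltW//.
Qed.

(** When [S] is empty the four inequalities say that integrating over the whole
    space with an orthonormal basis does not change the integral. *)
Lemma norm1_proj_fullv w f : rows w \in unitmx -> log_concave f ->
  norm1 f = 0 \/ norm1_proj fullv f = norm1 f.
Proof.
move=> uW lf; have [bf|nb] := pselect (bounded_below_on_box f); last first.
  by left; exact: norm1_degenerate.
right; have F0 : orthocomp (wspan w finset.set0) = fullv.
  apply/eqP; rewrite eqEsubv subvf; apply/subvP => x _.
  by apply/mem_orthocomp_wspan => k; rewrite inE.
have := @norm1_projE R n f w lf uW finset.set0 bf; rewrite F0 => ->.
rewrite wedge_norm0// divr1 (norm1E lf uW bf); congr (_ * _).
have := margT finset.set0 (frame_reg f w); rewrite /marg finset.set0U finset.setD0 => ->.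
by [].
Qed.

(** All covering sets are empty and [p] can be any positive number, possibly
    less than 1. Both sides reduce to powers of one number, by
    [norm1_proj_fullv]. *)
Lemma four_inequalities_empty w m (C : 'I_m -> {set 'I_n}) (q : 'I_m -> R) f
    (S := finset.set0 : {set 'I_n}) (p := (\sum_j q j)%R) :
  rows w \in unitmx -> uniform_cover S C q -> integrable_log_concave f ->
  [/\ norm1_proj (orthocomp (wspan w S)) f `^ (p - 1) * norm1 f
        <= (((#|S|)`!%:R * \prod_j wedge_norm w (S :\: C j) `^ q j)
            / (wedge_norm w S `^ (p - 1) * \prod_j (#|C j|)`!%:R `^ q j))%R%:E
           * \prod_j norm1_proj (orthocomp (wspan w (S :\: C j))) f `^ q j,
      norm1_proj (orthocomp (wspan w S)) f * norm1 f `^ (p - 1)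
        <= (((#|S|)`!%:R `^ (p - 1) * \prod_j wedge_norm w (C j) `^ q j)
            / (wedge_norm w S * \prod_j (#|S| - #|C j|)`!%:R `^ q j))%R%:E
           * \prod_j norm1_proj (orthocomp (wspan w (C j))) f `^ q j,
      norm1_proj (orthocomp (wspan w S)) f `^ (p - 1) * norm1 f
        <= (((#|S|)`!%:R * \prod_j wedge_norm w (C j) `^ q j)
            / (wedge_norm w S * \prod_j (#|C j|)`!%:R `^ q j))%R%:E
           * \prod_j norm1_proj (wspan w (C j) + orthocomp (wspan w S))%VS f `^ q j &
      norm1_proj (orthocomp (wspan w S)) f * norm1 f `^ (p - 1)
        <= (((#|S|)`!%:R `^ (p - 1) * \prod_j wedge_norm w (S :\: C j) `^ q j)
            / (wedge_norm w S `^ (p - 1) * \prod_j (#|S| - #|C j|)`!%:R `^ q j))%R%:E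
           * \prod_j norm1_proj (wspan w (S :\: C j) + orthocomp (wspan w S))%VS f `^ q j].
Proof.
move=> uW [m0 CS q0 _] fi; have [lf _] := fi; have a0 := norm1_ge0 lf.
have j0 : 'I_m by case: (m) m0 => // ? _; exact: ord0.
have -> : C = fun=> finset.set0.
  by apply/funext => j; apply/eqP; rewrite -finset.subset0; exact: CS.
have F0 : orthocomp (wspan w finset.set0) = fullv.
  apply/eqP; rewrite eqEsubv subvf; apply/subvP => x _.
  by apply/mem_orthocomp_wspan => k; rewrite inE.
have FD : (wspan w finset.set0 + fullv)%VS = fullv.
  by apply/eqP; rewrite eqEsubv subvf addvSr.
have pN0 : (p != 0)%R.
  by rewrite /p (bigD1 j0)//= gt_eqF// ltr_pwDl//; apply: sumr_ge0 => j _; exact: ltW.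
have one : (\prod_(j < m) 1 `^ q j = 1 :> R)%R by apply: big1 => j _; rewrite powR1.
have X0 := norm1_proj_ge0 fullv lf.
rewrite /S finset.set0D F0 FD wedge_norm0// cards0 subnn fact0 one !powR1 !mulr1 divr1 !mul1e.
rewrite (prod_poweR j0)// -/p.
have key1 : norm1_proj fullv f `^ (p - 1) * norm1 f <= norm1_proj fullv f `^ p.
  have [->|XE] := norm1_proj_fullv uW lf; first by rewrite mule0 poweR_ge0.
  move: (norm1_fin fi) a0; rewrite XE; case: (norm1 f) => //= r _; rewrite lee_fin le_eqVlt.
  move=> /orP[/eqP <-|r0]; first by rewrite mule0 lee_fin powR_ge0.
  by rewrite -EFinM -{2}(powRr1 (ltW r0)) -powRD ?subrK// (gt_eqF r0) implybT.
have key2 : norm1_proj fullv f * norm1 f `^ (p - 1) <= norm1_proj fullv f `^ p.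
  have [n0|XE] := norm1_proj_fullv uW lf; last by move: key1; rewrite XE muleC.
  rewrite n0; have [->|p1] := eqVneq p 1%R; first by rewrite subrr poweRe0 mule1 poweRe1.
  by rewrite poweR0r ?subr_eq0// mule0 poweR_ge0.
by [].
Qed.

End first_inequality.

Theorem theorem4p3 (R : realType) (n : nat) (w : 'I_n -> 'rV[R]_n)
    (S : {set 'I_n}) (m : nat) (C : 'I_m -> {set 'I_n}) (q : 'I_m -> R)
    (f : 'rV[R]_n -> R) :
  basis_of fullv [seq w i | i : 'I_n] ->
  uniform_cover S C q ->
  integrable_log_concave f ->
  let d := #|S| in
  let H := wspan w S in
  let Hj j := wspan w (C j) in
  let Htj j := wspan w (S :\: C j) in
  let dj j := #|C j| in
  let dtj j := (d - dj j)%N in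
  let p := \sum_j q j in
  [/\ (norm1_proj (orthocomp H) f `^ (p - 1) * norm1 f
        <= ((d`!%:R * \prod_j wedge_norm w (S :\: C j) `^ q j)
            / (wedge_norm w S `^ (p - 1) * \prod_j (dj j)`!%:R `^ q j))%R%:E
           * \prod_j norm1_proj (orthocomp (Htj j)) f `^ q j)%E,
      (norm1_proj (orthocomp H) f * norm1 f `^ (p - 1)
        <= ((d`!%:R `^ (p - 1) * \prod_j wedge_norm w (C j) `^ q j)
            / (wedge_norm w S * \prod_j (dtj j)`!%:R `^ q j))%R%:E
           * \prod_j norm1_proj (orthocomp (Hj j)) f `^ q j)%E,
      (norm1_proj (orthocomp H) f `^ (p - 1) * norm1 f
        <= ((d`!%:R * \prod_j wedge_norm w (C j) `^ q j)
            / (wedge_norm w S * \prod_j (dj j)`!%:R `^ q j))%R%:E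
           * \prod_j norm1_proj (Hj j + orthocomp H)%VS f `^ q j)%E &
      (norm1_proj (orthocomp H) f * norm1 f `^ (p - 1)
        <= ((d`!%:R `^ (p - 1) * \prod_j wedge_norm w (S :\: C j) `^ q j)
            / (wedge_norm w S `^ (p - 1) * \prod_j (dtj j)`!%:R `^ q j))%R%:E
           * \prod_j norm1_proj (Htj j + orthocomp H)%VS f `^ q j)%E].
Proof.
have [->|SN0] := eqVneq S finset.set0.
  by move=> /basis_rows uW cov fi; exact: four_inequalities_empty uW cov fi.
move=> /basis_rows uW cov fi d H Hj Htj dj dtj p.
have [lf _] := fi; have [m0 CS q0 cover] := cov.
have a0 := norm1_ge0 lf.
have j0 : 'I_m by case: (m) m0 => // ? _; exact: ord0.
have d0 : (0 < #|S|)%N by rewrite card_gt0.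
have first (w' : 'I_n -> 'rV[R]_n) (uW' : rows w' \in unitmx) m' (C' : 'I_m' -> {set 'I_n}) q' (cov' : uniform_cover S C' q') :=
  first_inequality uW' cov' fi d0.
have vgt0 (w' : 'I_n -> 'rV[R]_n) A : rows w' \in unitmx -> 0 < wedge_norm w' A.
  by move=> uW'; have [] := wedge_normE A uW'.
have SSC j : S :\: (S :\: C j) = C j.
  by rewrite finset.setDDr finset.setDv finset.set0U; apply/finset.setIidPr.
have second (w' : 'I_n -> 'rV[R]_n) (uW' : rows w' \in unitmx) :=
  @complement_inequality _ _ S (wedge_norm w')
    (fun A => norm1_proj (orthocomp (wspan w' (S :\: A))) f) (norm1 f)
    (fun A => vgt0 w' A uW') (fun A => norm1_proj_ge0 _ lf) a0 d0.
have {}second (w' : 'I_n -> 'rV[R]_n) : rows w' \in unitmx ->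
   (norm1_proj (orthocomp (wspan w' S)) f * norm1 f `^ (p - 1)
        <= ((d`!%:R `^ (p - 1) * \prod_j wedge_norm w' (C j) `^ q j)
            / (wedge_norm w' S * \prod_j (dtj j)`!%:R `^ q j))%R%:E
           * \prod_j norm1_proj (orthocomp (wspan w' (C j))) f `^ q j)%E.
  move=> uW'; have := second w' uW' _ m C q cov; rewrite finset.setD0 => h.
  rewrite (eq_bigr (fun j => norm1_proj (orthocomp (wspan w' (S :\: (S :\: C j)))) f `^ q j)%E) => [|j _]; last by rewrite SSC.
  by apply: h => m' C' q' cov'; exact: first.
have [b [uB bE]] := dual_frame S uW.
have [bS bF] := bE _ (finset.sub0set S).
rewrite finset.setD0 in bS bF.
have {}bF : orthocomp (wspan b S) = orthocomp H.
  rewrite bF; have -> : wspan w finset.set0 = 0%VS by rewrite /wspan /image_mem enum_set0 span_nil.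
  by rewrite add0v.
rewrite wedge_norm0// in bS.
have prE (A : 'I_m -> {set 'I_n}) : \prod_j (wedge_norm w (A j) / wedge_norm w S) `^ q j =
    \prod_j wedge_norm w (A j) `^ q j / wedge_norm w S `^ p.
  rewrite /p powR_sumr ?vgt0// -prodf_div; apply: eq_bigr => j _.
  rewrite powRM ?invr_ge0 ?(ltW (vgt0 _ _ uW))//; congr (_ * _).
  by rewrite -powR_inv1 ?(ltW (vgt0 _ _ uW))// -powRrM mulN1r powRN.
have vS : 0 < wedge_norm w S by exact: vgt0.
have vSp : wedge_norm w S `^ p = wedge_norm w S `^ (p - 1) * wedge_norm w S.
  by rewrite -{3}(powRr1 (ltW vS)) -powRD ?subrK// (gt_eqF vS) implybT.
have vSp0 : 0 < wedge_norm w S `^ (p - 1) by rewrite powR_gt0.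
have F0 (k : 'I_m -> nat) : 0 < \prod_j (k j)`!%:R `^ q j :> R.
  by apply: prodr_gt0 => j _; rewrite powR_gt0// ltr0n fact_gt0.
split.
- exact: first.
- exact: second.
- have := first b uB m C q cov; rewrite bF -/p.
  have -> : \prod_j wedge_norm b (S :\: C j) `^ q j =
      \prod_j (wedge_norm w (C j) / wedge_norm w S) `^ q j.
    by apply: eq_bigr => j _; have [-> _] := bE _ (CS j).
  have -> : (\prod_j norm1_proj (orthocomp (wspan b (S :\: C j))) f `^ q j =
      \prod_j norm1_proj (Hj j + orthocomp H)%VS f `^ q j)%E.
    by apply: eq_bigr => j _; have [_ ->] := bE _ (CS j).
  have iS : (wedge_norm w S)^-1 `^ (p - 1) = (wedge_norm w S `^ (p - 1))^-1.
    by rewrite -powR_inv1 ?(ltW vS)// -powRrM mulN1r powRN.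
  rewrite prE bS vSp div1r iS.
  rewrite [X in (_ <= X%:E * _)%E -> _](_ : _ = d`!%:R * \prod_j wedge_norm w (C j) `^ q j /
     (wedge_norm w S * \prod_j (dj j)`!%:R `^ q j))//.
  by rewrite /d /dj; field; rewrite !gt_eqF.
- have := second b uB; rewrite bF.
  have CD j : wedge_norm b (C j) = wedge_norm w (S :\: C j) / wedge_norm w S /\
      orthocomp (wspan b (C j)) = (Htj j + orthocomp H)%VS.
    by have := bE _ (finset.subsetDl S (C j)); rewrite SSC.
  have -> : \prod_j wedge_norm b (C j) `^ q j =
      \prod_j (wedge_norm w (S :\: C j) / wedge_norm w S) `^ q j.
    by apply: eq_bigr => j _; have [-> _] := CD j.
  have -> : (\prod_j norm1_proj (orthocomp (wspan b (C j))) f `^ q j =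
      \prod_j norm1_proj (Htj j + orthocomp H)%VS f `^ q j)%E.
    by apply: eq_bigr => j _; have [_ ->] := CD j.
  rewrite (prE (fun j => S :\: C j)) bS vSp div1r.
  rewrite [X in (_ <= X%:E * _)%E -> _](_ : _ = d`!%:R `^ (p - 1) * \prod_j wedge_norm w (S :\: C j) `^ q j /
     (wedge_norm w S `^ (p - 1) * \prod_j (dtj j)`!%:R `^ q j))//.
  by field; rewrite !gt_eqF.
Qed.
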